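(* For $t\ge 0$ and $\phi\in\mathbb{R}^d$ the solution $\Phi_t$ of the Cauchy problem $\frac{\partial}{\partial t}\Phi_t=\Psi(\nabla)\Phi_t$, $\Phi_0=f=e^{-V}$, has the asymptotic expansion $$\Phi_t(\phi)=\sum_{m=0}^{\infty}\frac{(-1)^m}{m!}\sum_{G\in\bar F(m)}\mathcal{V}[G](t,\phi),$$ where the equality is in the sense of asymptotic series, i.e. for every $N\in\mathbb{N}$ $$\lim_{\beta\searrow 0}\beta^{-N}\Big|\Phi^\beta_t(\phi)-\sum_{m=0}^{N}\frac{(-\beta)^m}{m!}\sum_{G\in\bar F(m)}\mathcal{V}[G](t,\phi)\Big|=0 .$$
   Context: Fourier transform: $\mathcal{F}(g)(\xi)=\int_{\mathbb{R}^d}g(\varphi)e^{i\langle\xi,\varphi\rangle}d\varphi$, extended to tempered distributions $\mathcal{S}'(\mathbb{R}^d)$. Symbol: $\xi\mapsto\Psi(-i\xi)$ is a smooth function $\mathbb{R}^d\to\mathbb{C}$ with $\Psi(0)=0$ such that (P1) it is analytic in a neighbourhood of $0$; (P2) $\Re\Psi(-i\xi)\le c\log(1+\|\xi\|)$ for all $\xi\in\mathbb{R}^d$, for some $c>0$; (P3) for every $\alpha\in\mathbb{N}_0^d$ there are $N_\alpha\in\mathbb{N}$, $b_\alpha>0$ with $|D_\alpha\Psi(-i\xi)|\le b_\alpha(1+\|\xi\|)^{N_\alpha}$ for all $\xi\in\mathbb{R}^d$, $D_\alpha$ being the partial derivative of multi-index $\alpha$. The operator $\Psi(\nabla)$ is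 $\mathcal{F}^{-1}\circ(\text{multiplication by }\Psi(-i\xi))\circ\mathcal{F}$. Put $C^{(n)}_{X_1\cdots X_n}=\frac{\partial^n}{\partial\xi_{X_1}\cdots\partial\xi_{X_n}}\Psi(\xi)|_{\xi=0}$ for $n\ge1$, $X_i\in\{1,\dots,d\}$. Initial condition: $V(\varphi)=\sum_{p=0}^{\bar p}\sum_{X_1,\dots,X_p=1}^d\lambda^{(p)}_{X_1\cdots X_p}\varphi_{X_1}\cdots\varphi_{X_p}$ with real symmetric tensors $\lambda^{(p)}$, $\bar p$ a positive even integer, and $\sum_{X_1,\dots,X_{\bar p}}\lambda^{(\bar p)}_{X_1\cdots X_{\bar p}}\varphi_{X_1}\cdots\varphi_{X_{\bar p}}>0$ for $\varphi\ne0$; $f=e^{-V}$ and $f_\beta=e^{-\beta V}$ for $\beta>0$. Let $\nu_t=\mathcal{F}^{-1}(e^{t\Psi(-i\xi)})\in\mathcal{S}'(\mathbb{R}^d)$. The solution of the Cauchy problem is the convolution $\Phi_t(\phi)=\nu_t*f(\phi)=\langle\nu_t,f_\phi\rangle$, where $f_\phi(\varphi)=f(\varphi-\phi)$; likewise $\Phi_t^\beta=\nu_t*f_\beta$. Generalized amputated Feynman graphs: let $m\in\mathbb{N}_0$, $p_1,\dots,p_m\in\{0,\dots,\bar p\}$ and $\Omega(p_1,\dots,p_m)=\bigcup_{n=1}^m\{(1,n),\dots,(p_n,n)\}$. A graph $G$ has $m$ distinguishable ''inner full'' vertices, the $n$-th one having $p_n$ distinguishable legs labelled $(1,n),\dots,(p_n,n)$;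 finitely many ''inner empty'' vertices and finitely many ''outer empty'' vertices, which are indistinguishable within each type and have indistinguishable legs; each leg of an inner full vertex is joined by a non-directed edge to exactly one empty vertex and these are all the edges; every inner empty vertex is met by at least one edge and every outer empty vertex by exactly one edge. $\bar F(m)$ is the set of all such graphs with $m$ inner full vertices and arbitrary $p_1,\dots,p_m\le\bar p$ such that $\lambda^{(p_j)}\ne0$ for $j=1,\dots,m$; $\bar F(0)$ consists of the empty graph, of value $1$. Feynman rules: for $G\in\bar F(m)$ the number $\mathcal{V}[G](t,\phi)$ is obtained as follows: assign to each leg $a=(s,n)\in\Omega(p_1,\dots,p_m)$ an index $X_a=X^n_s\in\{1,\dots,d\}$; for each outer empty vertex multiply by $(-\phi_{X_b})$, $b$ the leg joined to it; for each inner empty vertex joined to legs $a_1,\dots,a_l$ multiply by $t\,C^{(l)}_{X_{a_1}\cdots X_{a_l}}$; for each $j=1,\dots,m$ multiply by $\lambda^{(p_j)}_{X^j_1\cdots X^j_{p_j}}$; finally sum over all indices $X_a\in\{1,\dots,d\}$, $a\in\Omega(p_1,\dots,p_m)$.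
   Formalization: The signs of φ are corrected: the convolution pairs ν_t with f(φ−·) instead of f(·−φ), and an outer empty vertex contributes φ_X instead of −φ_X; as printed the claim fails, e.g. for d=1, Ψ(ξ)=bξ, V(y)=y². *)

(* Defs.v *)
From HB Require Import structures.
From mathcomp Require Import all_boot all_order all_algebra all_fingroup.
From mathcomp Require Import complex.
From mathcomp Require Import all_classical all_reals all_analysis.
Set Implicit Arguments.
Unset Strict Implicit.
Unset Printing Implicit Defensive.
Import Order.TTheory GRing.Theory Num.Theory.
Import numFieldNormedType.Exports.
Local Open Scope classical_set_scope.
Local Open Scope ring_scope.

Notation cabs := Normc.normc.

Definition cexp {R : realType} (z : R[i]) : R[i] :=
  (expR (complex.Re z))%:C%C *
  Complex (cos (complex.Im z)) (sin (complex.Im z)).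

Definition dotp {R : realType} {d : nat} (x y : 'rV[R]_d) : R :=
  \sum_(j < d) x 0 j * y 0 j.

(* The norm `|x| of the library on 'rV_d is the sup norm; the Euclidean norm
   is defined here. *)
Definition enorm {R : realType} {d : nat} (x : 'rV[R]_d) : R :=
  Num.sqrt (dotp x x).

Definition toC {R : realType} {d : nat} (x : 'rV[R]_d) : 'rV[R[i]]_d :=
  map_mx (real_complex R) x.

(* d-dimensional Lebesgue measure, on the Borel sets of d.-tuple R. *)
Fixpoint lebesgue_tuple (R : realType) (d : nat) :
    set (d.-tuple (measurableTypeR R)) -> \bar R :=
  match d with
  | 0 => dirac [tuple]
  | n.+1 => pushforward (lebesgue_measure \x @lebesgue_tuple R n)%E
      (fun z => [tuple of z.1 :: z.2])
  end.

Definition rintegral {R : realType} {d : nat} (g : 'rV[R]_d -> R) : R :=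
  fine (\int[@lebesgue_tuple R d]_x (g (\row_(j < d) tnth x j))%:E)%E.

Definition cintegral {R : realType} {d : nat} (g : 'rV[R]_d -> R[i]) : R[i] :=
  Complex (rintegral (fun x => complex.Re (g x)))
          (rintegral (fun x => complex.Im (g x))).

(* Elements of S'(R^d) are represented by functionals on complex functions, of
   which only the values at Schwartz functions are meaningful. *)
Definition distribution (R : realType) (d : nat) : Type :=
  ('rV[R]_d -> R[i]) -> R[i].

Definition regular_distribution {R : realType} {d : nat}
    (h : 'rV[R]_d -> R[i]) : distribution R d :=
  fun g => cintegral (fun x => h x * g x).

(* Inverse of g |-> (xi |-> \int g(phi) e^{i <xi, phi>} dphi). *)
Definition inv_fourier {R : realType} {d : nat} (g : 'rV[R]_d -> R[i]) :
    'rV[R]_d -> R[i] :=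
  fun phi => (((2 * pi) ^+ d)^-1)%:C%C *
    cintegral (fun xi => g xi * cexp (Complex 0 (- dotp xi phi))).

(* The inverse Fourier transform on S'(R^d), by transposition: the kernel
   e^{- i <xi, phi>} is symmetric in xi and phi. *)
Definition inv_fourier_distribution {R : realType} {d : nat}
    (T : distribution R d) : distribution R d :=
  fun g => T (inv_fourier g).

(* The usual convolution (T * f)(phi) = <T, y |-> f(phi - y)>, so that
   T * f = f when T is the Dirac mass at 0. With the
   translate y |-> f(y - phi) one would get f(- phi) instead. *)
Definition convolution {R : realType} {d : nat} (T : distribution R d)
    (f : 'rV[R]_d -> R[i]) : 'rV[R]_d -> R[i] :=
  fun phi => T (fun y => f (phi - y)).

(* Partial derivative of a complex-valued function of d real variables; the
   library has no structure of real normed space on R[i]. *)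
Definition partial {R : realType} {d : nat} (j : 'I_d) (f : 'rV[R]_d -> R[i]) :
    'rV[R]_d -> R[i] :=
  fun x => Complex ('D_(delta_mx 0 j) (fun y => complex.Re (f y)) x)
                   ('D_(delta_mx 0 j) (fun y => complex.Im (f y)) x).

Definition partials {R : realType} {d : nat} (s : seq 'I_d)
    (f : 'rV[R]_d -> R[i]) : 'rV[R]_d -> R[i] :=
  foldr partial f s.

Definition smooth {R : realType} {d : nat} (f : 'rV[R]_d -> R[i]) : Prop :=
  forall s : seq 'I_d,
    let re := fun x => complex.Re (partials s f x) in
    let im := fun x => complex.Im (partials s f x) in
    [/\ continuous re, continuous im &
      forall (x : 'rV[R]_d) (j : 'I_d),
        derivable re x (delta_mx 0 j) /\ derivable im x (delta_mx 0 j)].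

Definition multi_index (d : nat) := {ffun 'I_d -> nat}.

Definition Dmulti {R : realType} {d : nat} (a : multi_index d) :
    ('rV[R]_d -> R[i]) -> 'rV[R]_d -> R[i] :=
  partials (flatten [seq nseq (a j) j | j <- enum 'I_d]).

Definition monomial {R : realType} {d : nat} (a : multi_index d)
    (z : 'rV[R[i]]_d) : R[i] :=
  \prod_(j < d) z 0 j ^+ a j.

(* F is, on a polydisc around 0, the sum of an absolutely convergent power
   series; the partial sums range over the multi-indices with entries < n. *)
Definition analytic_near0 {R : realType} {d : nat} (F : 'rV[R[i]]_d -> R[i]) :
    Prop :=
  exists (c : multi_index d -> R[i]) (r : R), 0 < r /\
    forall z : 'rV[R[i]]_d, (forall j, cabs (z 0 j) < r) ->
      (\esum_(a in [set: multi_index d]) (cabs (c a * monomial a z))%:E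
         < +oo)%E /\
      (fun n : nat => cabs (F z -
         \sum_(b : {ffun 'I_d -> 'I_n})
           let a : multi_index d := [ffun j => b j : nat] in
           c a * monomial a z)) @ \oo --> (0 : R).

Definition symbol {R : realType} {d : nat} (Psi : 'rV[R[i]]_d -> R[i])
    (xi : 'rV[R]_d) : R[i] :=
  Psi (- 'i%C *: toC xi).

(* Psi is a function on C^d of which only the values on the imaginary subspace
   and near 0 matter. Analyticity is asked on a complex neighbourhood of 0, so
   that near 0 Psi is the analytic continuation of its restriction to i R^d. *)
Record is_symbol {R : realType} {d : nat} (Psi : 'rV[R[i]]_d -> R[i]) : Prop :=
  IsSymbol {
    symbol_smooth : smooth (symbol Psi);
    symbol_0 : Psi 0 = 0;
    symbol_analytic : analytic_near0 (fun z => Psi (- 'i%C *: z));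
    symbol_log_bound : exists c : R, 0 < c /\
      forall xi : 'rV[R]_d,
        complex.Re (symbol Psi xi) <= c * ln (1 + enorm xi);
    symbol_poly_bound : forall a : multi_index d,
      exists (N : nat) (b : R), 0 < b /\
        forall xi : 'rV[R]_d,
          cabs (Dmulti a (symbol Psi) xi) <= b * (1 + enorm xi) ^+ N
  }.

(* C^{(n)}_{X_1 ... X_n}, for s = [:: X_1; ...; X_n]. *)
Definition Ccoef {R : realType} {d : nat} (Psi : 'rV[R[i]]_d -> R[i])
    (s : seq 'I_d) : R[i] :=
  partials s (fun xi => Psi (toC xi)) 0.

Definition tensor (R : realType) (d p : nat) :=
  {ffun {ffun 'I_p -> 'I_d} -> R}.

Definition tensor_form {R : realType} {d p : nat} (l : tensor R d p)
    (phi : 'rV[R]_d) : R :=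
  \sum_(X : {ffun 'I_p -> 'I_d}) l X * \prod_(s < p) phi 0 (X s).

Definition symmetric_tensor {R : realType} {d p : nat} (l : tensor R d p) :
    Prop :=
  forall (s : {perm 'I_p}) (X : {ffun 'I_p -> 'I_d}),
    l [ffun k => X (s k)] = l X.

Definition potential {R : realType} {d : nat} (pbar : nat)
    (lam : forall p, tensor R d p) (phi : 'rV[R]_d) : R :=
  \sum_(p < pbar.+1) tensor_form (lam p) phi.

Record is_interaction {R : realType} {d : nat} (pbar : nat)
    (lam : forall p, tensor R d p) : Prop :=
  IsInteraction {
    interaction_pos : (0 < pbar)%N;
    interaction_even : ~~ odd pbar;
    interaction_sym : forall p, (p <= pbar)%N -> symmetric_tensor (lam p);
    interaction_lead : forall phi : 'rV[R]_d, phi != 0 ->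
      0 < tensor_form (lam pbar) phi
  }.

Definition initial {R : realType} {d : nat} (pbar : nat)
    (lam : forall p, tensor R d p) (beta : R) (phi : 'rV[R]_d) : R[i] :=
  (expR (- (beta * potential pbar lam phi)))%:C%C.

Definition nu {R : realType} {d : nat} (Psi : 'rV[R[i]]_d -> R[i]) (t : R) :
    distribution R d :=
  inv_fourier_distribution
    (regular_distribution (fun xi => cexp (t%:C%C * symbol Psi xi))).

Definition solution {R : realType} {d : nat} (Psi : 'rV[R[i]]_d -> R[i])
    (pbar : nat) (lam : forall p, tensor R d p) (beta t : R) :
    'rV[R]_d -> R[i] :=
  convolution (nu Psi t) (initial pbar lam beta).

Section Graphs.
Variables (pbar m : nat).

Definition valence := {ffun 'I_m -> 'I_pbar.+1}.

(* The s-th leg of the n-th inner full vertex is Tagged _ s, with tag n. *)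
Definition leg (p : valence) : finType := {n : 'I_m & 'I_(p n)}.

(* An empty vertex is given by its type and the set of legs joined to it.
   Since empty vertices of one type are indistinguishable, as are their legs,
   and since all of them are met by an edge, this determines the vertex, and
   a graph on the legs of p is the set of its empty vertices. *)
Definition empty_vertex (p : valence) : finType := (bool * {set leg p})%type.

Definition is_outer (p : valence) (v : empty_vertex p) : bool := v.1.
Definition is_inner (p : valence) (v : empty_vertex p) : bool := ~~ v.1.
Definition joined (p : valence) (v : empty_vertex p) : {set leg p} := v.2.

Definition is_graph (p : valence) (G : {set empty_vertex p}) : bool :=
  [&& [forall a : leg p, #|[set v in G | a \in joined v]| == 1%N],
      [forall v in G, is_inner v ==> (1 <= #|joined v|)%N] &
      [forall v in G, is_outer v ==> (#|joined v| == 1%N)]].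

Definition graph_on (p : valence) : finType := {set empty_vertex p}.

Definition pregraph : finType := {p : valence & graph_on p}.

Definition valence_of (G : pregraph) : valence := projT1 G.
Definition vertices (G : pregraph) : {set empty_vertex (valence_of G)} :=
  projT2 G.

End Graphs.

Definition Fbar {R : realType} {d : nat} (pbar : nat)
    (lam : forall p, tensor R d p) (m : nat) : {set pregraph pbar m} :=
  [set G | [forall n : 'I_m, lam (valence_of G n) != 0] & is_graph (vertices G)].

(* A leg stands for a factor (phi - y)_X of a vertex V(phi - y), whence the
   factor phi_X of an outer empty vertex. It would be - phi_X for the translate
   V(y - phi), which is not the one of the convolution. *)
Definition graph_value {R : realType} {d : nat} (Psi : 'rV[R[i]]_d -> R[i])
    (pbar : nat) (lam : forall p, tensor R d p) (m : nat)
    (G : pregraph pbar m) (t : R) (phi : 'rV[R]_d) : R[i] :=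
  let p := valence_of G in
  \sum_(X : {ffun leg p -> 'I_d})
    (\prod_(v in vertices G | is_outer v)
        \prod_(b in joined v) (phi 0 (X b))%:C%C) *
    (\prod_(v in vertices G | is_inner v)
        (t%:C%C * Ccoef Psi [seq X a | a <- enum (joined v)])) *
    (\prod_(j < m)
        (lam (p j) [ffun s => X (Tagged (fun n => 'I_(p n)) s)])%:C%C).

(* Main.v *)
Require Import Defs.
From HB Require Import structures.
From mathcomp Require Import all_boot all_order all_algebra all_fingroup.
From mathcomp Require Import complex ring lra zify.
From mathcomp Require Import all_classical all_reals all_analysis measurable_realfun.
Set Implicit Arguments.
Unset Strict Implicit.
Unset Printing Implicit Defensive.
Import Order.TTheory GRing.Theory Num.Theory.
Import numFieldNormedType.Exports.
Local Open Scope classical_set_scope.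
Local Open Scope ring_scope.

(** The solution is (2 pi)^-d times the integral of K(x) F(x), where the
    propagator K(x) is exp (t Psi (- i x)) and F is the Fourier transform of
    y |-> exp (- beta V (phi - y)). Put eps = beta^(1/p), p being the degree of V.
    In the variable eps y the exponent is a polynomial with coefficients bounded
    in eps and coercive uniformly in eps, so that each derivative in y gains a
    factor eps and |x|^n F(x) is of order eps^(n - 2 d), with an integrable decay
    ([fhat_boltz_decay], [fhat_boltz_weighted]). Hence only the Taylor expansion
    of K at 0 matters, together with its polynomial growth.

    The distribution nu_t is therefore replaced by one for which everything is
    finite. Since Vandermonde matrices are invertible, there are complex weights
    kap on the points g of the grid {0, ..., n - 1}^d with prescribed moments
    ([grid_moments]). They are chosen so that their Fourier transform
    theta(x) = sum_g kap_g exp (- i <x, g>) has the Taylor coefficients of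
    t Psi (- i x) - i <x, phi>. Then K(x) differs from
    exp (i <x, phi>) sum_(k < n) theta(x)^k / k! by O(|x|^n) times a polynomial
    ([grid_approximation]). The latter is a finite sum of characters, and Fourier
    inversion ([fourier_inversion]) evaluates its integral against F: up to an
    error O(beta^(N + 1)) for n large, the solution is
    sum_(k < n) 1/k! sum_(g_1 ... g_k) kap_(g_1) ... kap_(g_k)
    exp (- beta V (g_1 + ... + g_k)) ([solution_near_grid]). This can be expanded
    in beta term by term.

    It remains to compute the coefficients, in which the exponential is replaced
    by the power V^m ([graph_expansion]). Expanding V^m gives m full vertices; each
    of their legs carries a coordinate of g_1 + ... + g_k, hence chooses one of the
    k points. The sum over a point is the moment of kap for the legs that have
    chosen it. With l legs this moment is t C^(l), and phi is added to it if l = 1: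
    these are the Feynman rules for an inner and an outer empty vertex. Finally
    1/k! forgets the order of the k empty vertices ([sum_graph_like]). *)

(** * Complex numbers *)
Section ComplexNumbers.
Context {R : realType}.
Implicit Types z w : R[i].

Lemma cabs_ge0 z : 0 <= cabs z.
Proof. by case: z => a b; rewrite /= sqrtr_ge0. Qed.

Lemma cabs0 : cabs (0 : R[i]) = 0.
Proof. exact: Normc.normc0. Qed.

Lemma cabs1 : cabs (1 : R[i]) = 1.
Proof. exact: Normc.normc1. Qed.

Lemma cabsM z w : cabs (z * w) = cabs z * cabs w.
Proof. exact: Normc.normcM. Qed.

Lemma cabsN z : cabs (- z) = cabs z.
Proof. exact: normcN. Qed.

Lemma cabsD z w : cabs (z + w) <= cabs z + cabs w.
Proof. exact: le_normcD. Qed.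

Lemma cabsB z w : cabs (z - w) <= cabs z + cabs w.
Proof. by rewrite -[cabs w]cabsN; exact: cabsD. Qed.

Lemma cabsBC z w : cabs (z - w) = cabs (w - z).
Proof. by rewrite -cabsN opprB. Qed.

Lemma cabsX z n : cabs (z ^+ n) = cabs z ^+ n.
Proof. by elim: n => [|n IH]; rewrite ?expr0 ?cabs1// !exprS cabsM IH. Qed.

Lemma cabsV z : cabs z^-1 = (cabs z)^-1.
Proof. exact: Normc.normcV. Qed.

Lemma cabs_real (x : R) : cabs x%:C%C = `|x|.
Proof. by rewrite /= expr0n /= addr0 sqrtr_sqr. Qed.

Lemma cabs_sum I (r : seq I) (P : pred I) (F : I -> R[i]) :
  cabs (\sum_(i <- r | P i) F i) <= \sum_(i <- r | P i) cabs (F i).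
Proof.
elim/big_rec2: _ => [|i x y Pi h]; first by rewrite cabs0.
by rewrite (le_trans (cabsD _ _))// lerD2l.
Qed.

Lemma cabs_prod I (r : seq I) (P : pred I) (F : I -> R[i]) :
  cabs (\prod_(i <- r | P i) F i) = \prod_(i <- r | P i) cabs (F i).
Proof.
elim/big_rec2: _ => [|i x y Pi h]; first by rewrite cabs1.
by rewrite cabsM h.
Qed.

Lemma Re_le_cabs z : `|complex.Re z| <= cabs z.
Proof.
by case: z => a b /=; rewrite -sqrtr_sqr ler_wsqrtr// lerDl sqr_ge0.
Qed.

Lemma Im_le_cabs z : `|complex.Im z| <= cabs z.
Proof.
by case: z => a b /=; rewrite -sqrtr_sqr ler_wsqrtr// lerDr sqr_ge0.
Qed.

Lemma cabs_le_ReIm z : cabs z <= `|complex.Re z| + `|complex.Im z|.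
Proof.
case: z => a b /=; rewrite -[leRHS]ger0_norm ?addr_ge0// -sqrtr_sqr.
rewrite ler_wsqrtr// sqrrD !real_normK ?num_real//.
by rewrite lerD2r lerDl mulrn_wge0// mulr_ge0.
Qed.

Lemma cabs_eq0 z : cabs z = 0 -> z = 0.
Proof. exact: Normc.eq0_normc. Qed.

Lemma ReD z w : complex.Re (z + w) = complex.Re z + complex.Re w.
Proof. by case: z w => [? ?] [? ?]. Qed.
Lemma ImD z w : complex.Im (z + w) = complex.Im z + complex.Im w.
Proof. by case: z w => [? ?] [? ?]. Qed.
Lemma ReN z : complex.Re (- z) = - complex.Re z.
Proof. by case: z. Qed.
Lemma ImN z : complex.Im (- z) = - complex.Im z.
Proof. by case: z. Qed.
Lemma Re_mul z w : complex.Re (z * w) =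
  complex.Re z * complex.Re w - complex.Im z * complex.Im w.
Proof. by case: z w => [? ?] [? ?]. Qed.
Lemma Im_mul z w : complex.Im (z * w) =
  complex.Re z * complex.Im w + complex.Im z * complex.Re w.
Proof. by case: z w => [? ?] [? ?]; rewrite /= addrC. Qed.
Lemma ReZ (x : R) z : complex.Re (x%:C%C * z) = x * complex.Re z.
Proof. by rewrite Re_mul /= mul0r subr0. Qed.
Lemma ImZ (x : R) z : complex.Im (x%:C%C * z) = x * complex.Im z.
Proof. by rewrite Im_mul /= mul0r addr0. Qed.
Lemma Re_sum I (r : seq I) (P : pred I) (F : I -> R[i]) :
  complex.Re (\sum_(i <- r | P i) F i) = \sum_(i <- r | P i) complex.Re (F i).
Proof. by elim/big_rec2: _ => //= i x y _ <-; rewrite ReD. Qed.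
Lemma Im_sum I (r : seq I) (P : pred I) (F : I -> R[i]) :
  complex.Im (\sum_(i <- r | P i) F i) = \sum_(i <- r | P i) complex.Im (F i).
Proof. by elim/big_rec2: _ => //= i x y _ <-; rewrite ImD. Qed.

Lemma complex_eq z w :
  complex.Re z = complex.Re w -> complex.Im z = complex.Im w -> z = w.
Proof. by case: z w => [a b] [a' b'] /= -> ->. Qed.

Lemma real_complexM (x y : R) : (x * y)%:C%C = x%:C%C * y%:C%C.
Proof. exact: rmorphM. Qed.

Lemma cexpD z w : cexp (z + w) = cexp z * cexp w.
Proof.
case: z w => [a b] [a' b']; apply: complex_eq => /=;
  rewrite !(mul0r, mulr0, subr0, add0r, addr0) expRD ?cosD ?sinD; ring.
Qed.

Lemma cexp0 : cexp (0 : R[i]) = 1.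
Proof. by apply: complex_eq => /=; rewrite expR0 cos0 sin0; ring. Qed.

Lemma cabs_cexp z : cabs (cexp z) = expR (complex.Re z).
Proof.
rewrite /cexp cabsM cabs_real ger0_norm ?expR_ge0//=.
by rewrite cos2Dsin2 sqrtr1 mulr1.
Qed.

Lemma cabs_cexp_i (x : R) : cabs (cexp (Complex 0 x)) = 1.
Proof. by rewrite cabs_cexp expR0. Qed.

End ComplexNumbers.

(** * Integration of complex functions *)
Section ComplexIntegral.
Context d (T : measurableType d) (R : realType).
Variable mu : {measure set T -> \bar R}.
Implicit Types (f g : T -> R[i]) (h : T -> R).

Definition cmeasurable f :=
  measurable_fun setT (fun x => complex.Re (f x)) /\
  measurable_fun setT (fun x => complex.Im (f x)).

Definition cintegrable f :=
  mu.-integrable setT (EFin \o (fun x => complex.Re (f x))) /\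
  mu.-integrable setT (EFin \o (fun x => complex.Im (f x))).

Definition cint f : R[i] :=
  Complex (\int[mu]_x complex.Re (f x)) (\int[mu]_x complex.Im (f x)).

Lemma integrable_measurable h :
  mu.-integrable setT (EFin \o h) -> measurable_fun setT h.
Proof. by move=> /measurable_int/measurable_EFinP. Qed.

Lemma cintegrable_measurable f : cintegrable f -> cmeasurable f.
Proof. by move=> [/integrable_measurable ? /integrable_measurable ?]. Qed.

Lemma integrable_bound h (g : T -> R) : mu.-integrable setT (EFin \o g) ->
  measurable_fun setT h -> (forall x, `|h x| <= g x) ->
  mu.-integrable setT (EFin \o h).
Proof.
move=> ig mh hg; apply: le_integrable ig => //.
  exact/measurable_EFinP.
by move=> x _ /=; rewrite lee_fin (le_trans (hg x))// ler_norm.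
Qed.

Lemma cintegrable_bound f h : mu.-integrable setT (EFin \o h) ->
  cmeasurable f -> (forall x, cabs (f x) <= h x) -> cintegrable f.
Proof.
move=> ih [mr mi] fh; split.
  by apply: integrable_bound ih mr _ => x; rewrite (le_trans (Re_le_cabs _)).
by apply: integrable_bound ih mi _ => x; rewrite (le_trans (Im_le_cabs _)).
Qed.

(** The factor 2 comes from bounding the real and the imaginary part apart. *)
Lemma cabs_cint f h : mu.-integrable setT (EFin \o h) ->
  cmeasurable f -> (forall x, cabs (f x) <= h x) ->
  cabs (cint f) <= 2 * \int[mu]_x h x.
Proof.
move=> ih mf fh; have [ir ii] := cintegrable_bound ih mf fh.
rewrite (le_trans (cabs_le_ReIm _))//= mulr_natl mulr2n; apply: lerD.
- apply: le_trans (le_normr_Rintegral _ ir) _ => //.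
  apply: le_Rintegral => //; first exact: integrable_norm ir.
  by move=> x _; rewrite (le_trans (Re_le_cabs _)).
- apply: le_trans (le_normr_Rintegral _ ii) _ => //.
  apply: le_Rintegral => //; first exact: integrable_norm ii.
  by move=> x _; rewrite (le_trans (Im_le_cabs _)).
Qed.

Lemma eq_cint f g : f =1 g -> cint f = cint g.
Proof. by move=> /funext ->. Qed.

Lemma cintegrableD f g : cintegrable f -> cintegrable g ->
  cintegrable (fun x => f x + g x).
Proof.
move=> [fr fi] [gr gi]; split.
- rewrite (_ : _ \o _ = (EFin \o (fun x => complex.Re (f x))) \+
     (EFin \o (fun x => complex.Re (g x)))); first exact: integrableD.
  by apply/funext => x /=; rewrite ReD.
- rewrite (_ : _ \o _ = (EFin \o (fun x => complex.Im (f x))) \+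
     (EFin \o (fun x => complex.Im (g x)))); first exact: integrableD.
  by apply/funext => x /=; rewrite ImD.
Qed.

Lemma cintD f g : cintegrable f -> cintegrable g ->
  cint (fun x => f x + g x) = cint f + cint g.
Proof.
move=> [fr fi] [gr gi]; apply: complex_eq; rewrite ?ReD ?ImD /=.
- by rewrite -RintegralD//; apply: eq_Rintegral => x _; rewrite ReD.
- by rewrite -RintegralD//; apply: eq_Rintegral => x _; rewrite ImD.
Qed.

Lemma integrable_lin (a b : R) h k : mu.-integrable setT (EFin \o h) ->
  mu.-integrable setT (EFin \o k) ->
  mu.-integrable setT (EFin \o (fun x => a * h x + b * k x)).
Proof.
move=> ih ik.
rewrite (_ : _ \o _ = (fun x => (a%:E * (h x)%:E)%E) \+ (fun x => (b%:E * (k x)%:E)%E)) //.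
by apply: integrableD => //; exact: integrableZl.
Qed.

Lemma Rintegral_lin (a b : R) h k : mu.-integrable setT (EFin \o h) ->
  mu.-integrable setT (EFin \o k) ->
  \int[mu]_x (a * h x + b * k x) = a * (\int[mu]_x h x) + b * \int[mu]_x k x.
Proof.
move=> ih ik; rewrite RintegralD//; first by rewrite !RintegralZl.
- by apply: (integrableZl measurableT a ih).
- by apply: (integrableZl measurableT b ik).
Qed.

Lemma cintegrableZ (c : R[i]) f : cintegrable f -> cintegrable (fun x => c * f x).
Proof.
move=> [fr fi]; split.
- rewrite (_ : (fun x => _) = (fun x => complex.Re c * complex.Re (f x) +
     (- complex.Im c) * complex.Im (f x))); first exact: integrable_lin.
  by apply/funext => x; rewrite Re_mul mulNr.
- rewrite (_ : (fun x => _) = (fun x => complex.Re c * complex.Im (f x) +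
     (complex.Im c) * complex.Re (f x))); first exact: integrable_lin.
  by apply/funext => x; rewrite Im_mul.
Qed.

Lemma cintZ (c : R[i]) f : cintegrable f -> cint (fun x => c * f x) = c * cint f.
Proof.
move=> [fr fi]; apply: complex_eq; rewrite ?Re_mul ?Im_mul /=.
- rewrite -mulNr -Rintegral_lin//; apply: eq_Rintegral => x _.
  by rewrite Re_mul mulNr.
- by rewrite -Rintegral_lin//; apply: eq_Rintegral => x _; rewrite Im_mul.
Qed.

Lemma cintegrable0 : cintegrable (fun=> 0).
Proof. by split; exact: integrable0. Qed.

Lemma cint0 : cint (fun=> 0) = 0.
Proof. by apply: complex_eq; rewrite /= /Rintegral integral0. Qed.

Lemma cintegrable_sum I (r : seq I) (F : I -> T -> R[i]) :
  (forall i, cintegrable (F i)) -> cintegrable (fun x => \sum_(i <- r) F i x).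
Proof.
move=> iF; elim: r => [|i r IH].
  have -> : (fun x => \sum_(i <- [::]) F i x) = fun=> 0.
    by apply/funext => x; rewrite big_nil.
  exact: cintegrable0.
have -> : (fun x => \sum_(j <- i :: r) F j x) =
    fun x => F i x + \sum_(j <- r) F j x.
  by apply/funext => x; rewrite big_cons.
exact: cintegrableD.
Qed.

Lemma cint_sum I (r : seq I) (F : I -> T -> R[i]) :
  (forall i, cintegrable (F i)) ->
  cint (fun x => \sum_(i <- r) F i x) = \sum_(i <- r) cint (F i).
Proof.
move=> iF; elim: r => [|i r IH].
  by rewrite big_nil -[RHS]cint0; apply: eq_cint => x; rewrite big_nil.
rewrite big_cons -IH -cintD//; last exact: cintegrable_sum.
by apply: eq_cint => x; rewrite big_cons.
Qed.

Lemma cmeasurableM f g : cmeasurable f -> cmeasurable g ->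
  cmeasurable (fun x => f x * g x).
Proof.
move=> [fr fi] [gr gi]; split.
- rewrite (_ : (fun x => _) = (fun x => complex.Re (f x) * complex.Re (g x) -
     complex.Im (f x) * complex.Im (g x))); last by apply/funext => x; rewrite Re_mul.
  by apply: measurable_funB; exact: measurable_funM.
- rewrite (_ : (fun x => _) = (fun x => complex.Re (f x) * complex.Im (g x) +
     complex.Im (f x) * complex.Re (g x))); last by apply/funext => x; rewrite Im_mul.
  by apply: measurable_funD; exact: measurable_funM.
Qed.

Lemma cmeasurableD f g : cmeasurable f -> cmeasurable g ->
  cmeasurable (fun x => f x + g x).
Proof.
move=> [fr fi] [gr gi]; split.
- rewrite (_ : (fun x => _) = (fun x => complex.Re (f x) + complex.Re (g x)));
    last by apply/funext => x; rewrite ReD.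
  exact: measurable_funD.
- rewrite (_ : (fun x => _) = (fun x => complex.Im (f x) + complex.Im (g x)));
    last by apply/funext => x; rewrite ImD.
  exact: measurable_funD.
Qed.

Lemma cmeasurable_cst (c : R[i]) : cmeasurable (fun=> c).
Proof. by split; exact: measurable_cst. Qed.

Lemma cmeasurable_real h : measurable_fun setT h -> cmeasurable (fun x => (h x)%:C%C).
Proof. by move=> mh; split => //=; exact: measurable_cst. Qed.

Lemma cmeasurable_cexp f : cmeasurable f -> cmeasurable (fun x => cexp (f x)).
Proof.
move=> [fr fi]; rewrite /cexp; apply: cmeasurableM.
  by apply: cmeasurable_real; exact: measurableT_comp.
split => /=.
  exact: (measurableT_comp (continuous_measurable_fun (@continuous_cos R))).
exact: (measurableT_comp (continuous_measurable_fun (@continuous_sin R))).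
Qed.

Lemma cint_cvg_dominated (F : nat -> T -> R[i]) f h :
  (forall n, cmeasurable (F n)) -> cmeasurable f ->
  (forall x, (fun n => cabs (F n x - f x)) @ \oo --> (0 : R)) ->
  mu.-integrable setT (EFin \o h) -> (forall n x, cabs (F n x) <= h x) ->
  (fun n => cabs (cint (F n) - cint f)) @ \oo --> (0 : R).
Proof.
move=> mF mf Ff ih Fh.
have key (p : R[i] -> R) : (forall z, `|p z| <= cabs z) ->
    {morph p : z w / z + w} -> {morph p : z / - z} ->
    (forall n, measurable_fun setT (fun x => p (F n x))) ->
    measurable_fun setT (fun x => p (f x)) ->
    (fun n => \int[mu]_x p (F n x)) @ \oo --> \int[mu]_x p (f x).
  move=> pl pD pN mpF mpf.
  have cv x : (fun n => (p (F n x))%:E) @ \oo --> (p (f x))%:E.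
    apply/cvg_EFin; first exact: nearW.
    apply/cvgrPdistC_le => e e0; have /cvgr0_norm_le/(_ e e0) := Ff x.
    apply: filterS => n /=; apply: le_trans; rewrite -pN -pD (le_trans (pl _))//.
    by rewrite ler_norm.
  have ipf : mu.-integrable setT (EFin \o (fun x => p (f x))).
    have [] := @dominated_convergence _ _ _ mu _ measurableT
      (fun n x => (p (F n x))%:E) (fun x => (p (f x))%:E) (EFin \o h) => //.
    - by move=> n; exact/measurable_EFinP.
    - exact/measurable_EFinP.
    - by apply/aeW => x _; exact: cv.
    - apply/aeW => x n _; rewrite /= lee_fin (le_trans (pl _))//.
  rewrite /Rintegral; apply: fine_cvg; rewrite fineK; last first.
    exact: integrable_fin_num ipf.
  apply: (@dominated_cvg _ _ _ mu _ measurableT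
      (fun n x => (p (F n x))%:E) (fun x => (p (f x))%:E) (EFin \o h)) => //.
  - by move=> n; exact/measurable_EFinP.
  - by move=> n x _; rewrite /= lee_fin (le_trans (pl _)).
have cr := key _ Re_le_cabs ReD ReN (fun n => (mF n).1) mf.1.
have ci := key _ Im_le_cabs ImD ImN (fun n => (mF n).2) mf.2.
apply/cvgr0Pnorm_le => e e0; have e2 : 0 < e / 2 by rewrite divr_gt0.
move/cvgrPdistC_le/(_ _ e2) : cr => cr; move/cvgrPdistC_le/(_ _ e2) : ci => ci.
near=> n; rewrite ger0_norm ?cabs_ge0// (le_trans (cabs_le_ReIm _))//.
rewrite ReD ImD ReN ImN /= [leRHS]splitr lerD//; first by near: n.
by near: n.
Unshelve. all: by end_near. Qed.

End ComplexIntegral.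

(** * Fubini for dominated functions *)
Section DominatedFubini.
Context d1 d2 (T1 : measurableType d1) (T2 : measurableType d2) (R : realType).
Variable m1 : {sigma_finite_measure set T1 -> \bar R}.
Variable m2 : {sigma_finite_measure set T2 -> \bar R}.

Section Real.
Variables (f : T1 * T2 -> R) (a : T1 -> R) (b : T2 -> R).
Hypothesis mf : measurable_fun setT f.
Hypothesis ia : m1.-integrable setT (EFin \o a).
Hypothesis ib : m2.-integrable setT (EFin \o b).
Hypothesis fab : forall x y, `|f (x, y)| <= a x * b y.

Let ma : measurable_fun setT a. Proof. exact: integrable_measurable ia. Qed.
Let mb : measurable_fun setT b. Proof. exact: integrable_measurable ib. Qed.

Lemma dominated_slice1 x : m2.-integrable setT (EFin \o (fun y => f (x, y))).
Proof.
apply: (@integrable_bound _ _ _ _ _ (fun y => a x * b y)).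
- exact: (integrableZl measurableT (a x) ib).
- exact: measurableT_comp.
- by move=> y; exact: fab.
Qed.

Lemma dominated_slice2 y : m1.-integrable setT (EFin \o (fun x => f (x, y))).
Proof.
apply: (@integrable_bound _ _ _ _ _ (fun x => b y * a x)).
- exact: (integrableZl measurableT (b y) ia).
- exact: measurableT_comp.
- by move=> x; rewrite mulrC; exact: fab.
Qed.

Lemma dominated_prod : (m1 \x m2)%E.-integrable setT (EFin \o f).
Proof.
apply/integrable12ltyP; first exact/measurable_EFinP.
pose B : R := \int[m2]_y `|b y|.
have B0 : 0 <= B by exact: Rintegral_ge0.
apply: (@le_lt_trans _ _ (\int[m1]_x (B * `|a x|)%:E)%E).
  apply: ge0_le_integral => //.
  - by move=> x _; exact: integral_ge0.
  - apply: (measurable_fun_fubini_tonelli_F (fun z => `|(f z)%:E|%E)) => //=.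
    by do 2! apply: measurableT_comp => //.
  - apply/measurable_EFinP; apply: measurable_funM => //.
    exact: measurableT_comp.
  - move=> x _; rewrite EFinM /B /Rintegral fineK; last first.
      by apply: integrable_fin_num => //; exact: (integrable_norm ib).
    rewrite muleC -ge0_integralZl//.
    + apply: ge0_le_integral => //.
      * by apply/measurable_EFinP; apply: measurableT_comp => //; exact: measurableT_comp.
      * by apply/measurable_EFinP; apply: measurable_funM => //; exact: measurableT_comp.
      * move=> y _ /=; rewrite lee_fin (le_trans (fab x y))//.
        by rewrite -normrM ler_norm.
    + by apply/measurable_EFinP; exact: measurableT_comp.
have := integrableZl measurableT B
  (integrable_norm ia).
move=> /integrableP[_]; apply: le_lt_trans.
apply: ge0_le_integral => //=.
- by move=> x _; rewrite lee_fin mulr_ge0.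
- apply/measurable_EFinP; apply: measurable_funM => //; exact: measurableT_comp.
- apply/measurable_EFinP; apply: measurableT_comp => //.
  by apply: measurable_funM => //; exact: measurableT_comp.
- by move=> x _; rewrite lee_fin ler_norm.
Qed.

Let FE : EFin \o (fun x => \int[m2]_y f (x, y)) = fubini_F m2 (EFin \o f).
Proof.
apply/funext => x; rewrite /fubini_F /= /Rintegral fineK//.
by apply: integrable_fin_num => //; exact: dominated_slice1.
Qed.

Let GE : EFin \o (fun y => \int[m1]_x f (x, y)) = fubini_G m1 (EFin \o f).
Proof.
apply/funext => x; rewrite /fubini_G /= /Rintegral fineK//.
by apply: integrable_fin_num => //; exact: dominated_slice2.
Qed.

(** A bound by a product of functions of one variable makes every slice
    integrable, so that the inner integral is a real number for each x. *)
Lemma dominated_fubini1 :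
  m1.-integrable setT (EFin \o (fun x => \int[m2]_y f (x, y))) /\
  \int[m1]_x (\int[m2]_y f (x, y)) = \int[(m1 \x m2)%E]_z f z.
Proof.
split; first by rewrite FE; exact: integrable_fubini_F dominated_prod.
by rewrite {1}/Rintegral [X in fine (integral _ _ X)]FE integral12_prod_meas1// dominated_prod.
Qed.

Lemma dominated_fubini2 :
  m2.-integrable setT (EFin \o (fun y => \int[m1]_x f (x, y))) /\
  \int[m2]_y (\int[m1]_x f (x, y)) = \int[(m1 \x m2)%E]_z f z.
Proof.
split.
  apply: (@integrable_bound _ _ _ _ _ (fun y => (\int[m1]_x a x) * b y)).
  - exact: (integrableZl measurableT (\int[m1]_x a x) ib).
  - by apply/measurable_EFinP; rewrite GE; exact: measurable_fubini_G dominated_prod.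
  - move=> y; rewrite mulrC.
    have iay : m1.-integrable setT (EFin \o (fun x => b y * a x)).
      exact: (integrableZl measurableT (b y) ia).
    rewrite -RintegralZl//.
    apply: le_trans (le_normr_Rintegral _ (dominated_slice2 y)) _ => //.
    apply: le_Rintegral => //; first exact: integrable_norm (dominated_slice2 y).
    by move=> x _; rewrite mulrC.
by rewrite {1}/Rintegral [X in fine (integral _ _ X)]GE integral21_prod_meas1// dominated_prod.
Qed.
End Real.

Section Complex.
Variables (f : T1 * T2 -> R[i]) (a : T1 -> R) (b : T2 -> R).
Hypothesis mf : cmeasurable f.
Hypothesis ia : m1.-integrable setT (EFin \o a).
Hypothesis ib : m2.-integrable setT (EFin \o b).
Hypothesis fab : forall x y, cabs (f (x, y)) <= a x * b y.

Let fr x y : `|complex.Re (f (x, y))| <= a x * b y.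
Proof. exact: le_trans (Re_le_cabs _) _. Qed.
Let fi x y : `|complex.Im (f (x, y))| <= a x * b y.
Proof. exact: le_trans (Im_le_cabs _) _. Qed.

Lemma dominated_cfubini1 :
  cintegrable m1 (fun x => cint m2 (fun y => f (x, y))) /\
  cint m1 (fun x => cint m2 (fun y => f (x, y))) = cint (m1 \x m2)%E f.
Proof.
have [mr mi] := mf.
have [ir er] := dominated_fubini1 mr ia ib fr.
have [ii ei] := dominated_fubini1 mi ia ib fi.
by split => //; rewrite /cint /= er ei.
Qed.

Lemma dominated_cfubini2 :
  cintegrable m2 (fun y => cint m1 (fun x => f (x, y))) /\
  cint m2 (fun y => cint m1 (fun x => f (x, y))) = cint (m1 \x m2)%E f.
Proof.
have [mr mi] := mf.
have [ir er] := dominated_fubini2 mr ia ib fr.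
have [ii ei] := dominated_fubini2 mi ia ib fi.
by split => //; rewrite /cint /= er ei.
Qed.
End Complex.

End DominatedFubini.

Lemma sigma_finite_prod d1 d2 (T1 : measurableType d1) (T2 : measurableType d2)
    (R : realType) (m1 : {sigma_finite_measure set T1 -> \bar R})
    (m2 : {sigma_finite_measure set T2 -> \bar R}) :
  sigma_finite setT (m1 \x m2)%E.
Proof.
have /sigma_finiteP[F [TF ndF Foo]] := sigma_finiteT m1.
have /sigma_finiteP[G [TG ndG Goo]] := sigma_finiteT m2.
exists (fun n => F n `*` G n) => [|k].
  rewrite -setXTT TF TG predeqE => -[x y]; split => [|[n _ []/= ? ?]]; last first.
    by split; exists n.
  move=> [/= [n _ Fnx] [k _ Gky]]; exists (maxn n k) => //; split.
  - by move: x Fnx; exact/subsetPset/ndF/leq_maxl.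
  - by move: y Gky; exact/subsetPset/ndG/leq_maxr.
have [? ?] := Foo k; have [? ?] := Goo k; split; first exact: measurableX.
by rewrite product_measure1E// lte_mul_pinfty// ge0_fin_numE.
Qed.

(** * Lebesgue measure on tuples *)
Section TupleMeasure.
Context {R : realType}.
Local Notation Rm := (measurableTypeR R).

Definition tcons n (z : Rm * n.-tuple Rm) : n.+1.-tuple Rm :=
  [tuple of z.1 :: z.2].

Lemma measurable_tcons n : measurable_fun setT (@tcons n).
Proof. by apply: measurable_cons. Qed.

Section Step.
Variables (n : nat) (m : {sigma_finite_measure set (n.-tuple Rm) -> \bar R}).

Definition tstep : set (n.+1.-tuple Rm) -> \bar R :=
  pushforward (lebesgue_measure \x m)%E (@tcons n).

Let tstep0 : tstep set0 = 0%E.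
Proof. by rewrite /tstep /pushforward preimage_set0 measure0. Qed.

Let tcons_preimage A : measurable A -> measurable (@tcons n @^-1` A).
Proof. by move=> mA; rewrite -[X in measurable X]setTI; exact: measurable_tcons. Qed.

Let tstep_ge0 A : (0 <= tstep A)%E.
Proof. exact: (measure_ge0 (lebesgue_measure \x m)%E). Qed.

Let tstep_sigma_additive : semi_sigma_additive tstep.
Proof.
move=> F mF tF mUF; rewrite /tstep /pushforward preimage_bigcup.
apply: measure_semi_sigma_additive.
- by move=> k; exact: tcons_preimage.
- apply/trivIsetP => /= i j _ _ ij; rewrite -preimage_setI.
  by move/trivIsetP : tF => /(_ _ _ _ _ ij) ->//; rewrite preimage_set0.
- by rewrite -preimage_bigcup; exact: tcons_preimage.
Qed.

HB.instance Definition _ := isMeasure.Build _ _ _ tstep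
  tstep0 tstep_ge0 tstep_sigma_additive.

Let tuncons (x : n.+1.-tuple Rm) : Rm * n.-tuple Rm :=
  (thead x, [tuple of behead x]).

Let measurable_tuncons : measurable_fun setT tuncons.
Proof.
apply/measurable_fun_pairP; split; last exact: measurable_behead.
exact: measurable_tnth.
Qed.

Let tuncons_preimage A : measurable A -> measurable (tuncons @^-1` A).
Proof. by move=> mA; rewrite -[X in measurable X]setTI; exact: measurable_tuncons. Qed.

Let tconsK : cancel (@tcons n) tuncons.
Proof. by move=> [x y]; congr pair; apply/val_inj. Qed.

Let tstep_sigma_finite : sigma_finite setT tstep.
Proof.
have [F FT Fm] := sigma_finite_prod lebesgue_measure m.
exists (fun k => tuncons @^-1` (F k)).
  by rewrite -preimage_bigcup -FT preimage_setT.
move=> k; have [mFk Fk] := Fm k; split; first exact: tuncons_preimage.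
rewrite /tstep /pushforward; congr (_ < +oo)%E : Fk; congr (_ _).
by rewrite -comp_preimage (_ : _ \o _ = id)//; apply/funext => z; exact: tconsK.
Qed.

HB.instance Definition _ := Measure_isSigmaFinite.Build _ _ _ tstep
  tstep_sigma_finite.
End Step.

(** The set function lebesgue_tuple is packaged as a sigma-finite measure by
    induction on the dimension, so that integration theory applies to it. *)
Lemma lebesgue_tuple_measure n :
  {m : {sigma_finite_measure set (n.-tuple Rm) -> \bar R} |
    (m : set _ -> \bar R) = @lebesgue_tuple R n}.
Proof.
elim: n => [|n [m mE]].
  by exists (dirac ([tuple] : 0.-tuple Rm)).
by exists (tstep m); rewrite /= -mE.
Qed.

Definition tleb n := sval (lebesgue_tuple_measure n).

Lemma tlebE n : (tleb n : set _ -> \bar R) = @lebesgue_tuple R n.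
Proof. exact: svalP (lebesgue_tuple_measure n). Qed.

Lemma tlebS n : (tleb n.+1 : set _ -> \bar R) =
  pushforward (lebesgue_measure \x tleb n)%E (@tcons n).
Proof. by rewrite tlebE /= -tlebE. Qed.

Definition rowt n (x : n.-tuple Rm) : 'rV[R]_n := \row_j tnth x j.

(** A row is split into its first coordinate and the others, as tuples are in
    the definition of the measure. *)
Definition rcons0 n (x : R) (y : 'rV[R]_n) : 'rV[R]_n.+1 :=
  \row_j (if unlift ord0 j is Some k then y 0 k else x).

Lemma rowt_tcons n (z : Rm * n.-tuple Rm) :
  rowt (tcons z) = rcons0 z.1 (rowt z.2).
Proof.
apply/rowP => j; rewrite !mxE; case: unliftP => [k ->|->] /=.
  by rewrite tnthS mxE.
by rewrite tnth0.
Qed.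

Lemma cintegralE n (f : 'rV[R]_n -> R[i]) :
  cintegral f = cint (tleb n) (fun x => f (rowt x)).
Proof. by rewrite /cintegral /rintegral -tlebE. Qed.

End TupleMeasure.

(** * Continuous functions on row vectors *)
Section Rows.
Context {R : realType}.

Lemma norm_coord d (x : 'rV[R]_d) (j : 'I_d) : `|x 0 j| <= `|x|.
Proof. by rewrite [leRHS]mx_normrE; apply/bigmax_geP; right; exists (0, j). Qed.

Lemma norm_row_le d (x : 'rV[R]_d) (e : R) :
  0 <= e -> (forall j, `|x 0 j| <= e) -> `|x| <= e.
Proof.
move=> e0 xe; rewrite [leLHS]mx_normrE; apply/bigmax_leP; split=> // -[i j] _ /=.
by rewrite ord1 xe.
Qed.

Lemma norm_row_coord d (x : 'rV[R]_d.+1) : exists j, `|x| = `|x 0 j|.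
Proof.
have [x0|] := eqVneq `|x| 0.
  by exists 0; rewrite x0 (normr0_eq0 x0) mxE normr0.
by move=> /mx_norm_neq0[[i j] /= xE]; exists j; rewrite -[X in `|x X _|](ord1 i).
Qed.

Lemma cvg_row (T : Type) (F : set_system T) d (f : T -> 'rV[R]_d) (a : 'rV[R]_d) :
  Filter F -> (forall j, (fun x => f x 0 j) @ F --> a 0 j) -> f @ F --> a.
Proof.
move=> FF fa; apply/cvgrPdist_le => e e0.
have : \forall x \near F, forall j, `|a 0 j - f x 0 j| <= e.
  by apply: filter_forall => j; have /cvgrPdist_le/(_ e e0) := fa j.
apply: filterS => x h; apply: norm_row_le => [|j]; first exact: ltW.
by rewrite !mxE h.
Qed.

Lemma continuous_row (T : topologicalType) d (f : T -> 'rV[R]_d) :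
  (forall j, continuous (fun x => f x 0 j)) -> continuous f.
Proof. by move=> cf x; apply: cvg_row => j; exact: cf. Qed.

Lemma continuous_rcons0 n (x : R) (y : 'rV[R]_n) :
  continuous (fun u => rcons0 u y) /\ continuous (fun v : 'rV[R]_n => rcons0 x v).
Proof.
split; apply: continuous_row => j; [move=> z|move=> z].
- have E : (fun x : R => rcons0 x y 0 j) = fun x => if unlift ord0 j is Some k then y 0 k else x.
    by apply/funext => u; rewrite mxE.
  by rewrite E; case: unliftP => [k _|_]; [exact: cvg_cst|exact: cvg_id].
- have E : (fun y : 'rV[R]_n => rcons0 x y 0 j) =
      fun y : 'rV[R]_n => if unlift ord0 j is Some k then y 0 k else x.
    by apply/funext => u; rewrite mxE.
  by rewrite E; case: unliftP => [k _|_]; [exact: (@coord_continuous R 1 n 0 k z)|exact: (@cst_continuous 'rV[R]_n R x z)].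
Qed.

Lemma rcons00 n (x : R) (y : 'rV[R]_n) : rcons0 x y 0 ord0 = x.
Proof. by rewrite mxE unlift_none. Qed.

Lemma rcons0S n (x : R) (y : 'rV[R]_n) j : rcons0 x y 0 (lift ord0 j) = y 0 j.
Proof. by rewrite mxE liftK. Qed.

Lemma measurable_discrete d (T : measurableType d) (C : countType) (h : T -> C)
    (g : C -> R) : (forall c, measurable (h @^-1` [set c])) ->
  measurable_fun setT (g \o h).
Proof.
move=> mh _ Y mY; rewrite setTI.
rewrite (_ : _ @^-1` _ = \bigcup_(k in setT) (if unpickle k is Some c then
    (if `[< Y (g c) >] then h @^-1` [set c] else set0) else set0)).
  apply: bigcup_measurable => k _; case: unpickle => [c|//].
  by case: ifP.
apply/seteqP; split=> x /=.
  move=> Yx; exists (pickle (h x)) => //; rewrite pickleK /= ifT//; exact/asboolP.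
move=> [k _]; case: unpickle => [c|//]; case: ifP => // /asboolP Yc /= hx.
by rewrite hx.
Qed.

(** The Borel sets of the product coincide with the product of the Borel sets:
    a continuous function is the limit of its values on finer and finer
    grids, and these take countably many values. *)
Lemma continuous_measurable_rowt d (F : 'rV[R]_d -> R) : continuous F ->
  measurable_fun setT (fun x : d.-tuple (measurableTypeR R) => F (rowt x)).
Proof.
move=> cF.
pose fl (k : nat) (x : d.-tuple (measurableTypeR R)) : {ffun 'I_d -> int} :=
  [ffun j => Num.floor (k.+1%:R * tnth x j)].
pose gr (k : nat) (v : {ffun 'I_d -> int}) : 'rV[R]_d :=
  \row_j ((v j)%:~R / k.+1%:R).
apply: (@measurable_fun_cvg _ _ _ _ (fun k => (F \o gr k) \o fl k)).
- move=> k; apply: measurable_discrete => v.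
  rewrite (_ : _ @^-1` _ = \bigcap_(j in [set: 'I_d])
      ((fun x : d.-tuple (measurableTypeR R) => k.+1%:R * (tnth x j : R)) @^-1`
         `[(v j)%:~R, (v j + 1)%:~R[)).
    apply: fin_bigcap_measurable => // j _.
    rewrite -[X in measurable X]setTI.
    have : measurable_fun setT
       (fun x : d.-tuple (measurableTypeR R) => k.+1%:R * (tnth x j : R)).
      by apply: measurable_funM => //; exact: measurable_tnth.
    by apply.
  apply/seteqP; split=> x /=.
    by move=> <- j _; rewrite /= in_itv /= ffunE floor_le floorD1_gt.
  move=> h; apply/ffunP => j; rewrite ffunE; apply/eqP.
  by rewrite floor_eq; have := h j I; rewrite /= in_itv.
- move=> x _; apply: (continuous_cvg _ (cF (rowt x))).
  apply: cvg_row => j.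
  apply/cvgrPdist_le => e e0; near=> k; rewrite !mxE ffunE.
  have k0 : 0 < k.+1%:R :> R by [].
  rewrite -[X in `|X - _|](mulKf (lt0r_neq0 k0)) mulrC -mulrBl normrM.
  rewrite normfV (gtr0_norm k0) ler_pdivrMr// ger0_norm ?subr_ge0 ?floor_le//.
  apply: (@le_trans _ _ 1).
    by rewrite lerBlDl addrC; apply/ltW; have := floorD1_gt (k.+1%:R * tnth x j); rewrite intrD addrC.
  rewrite -ler_pdivrMl// mulr1.
  apply: (@le_trans _ _ (k%:R)); last by rewrite ler_nat.
  near: k; exact: nbhs_infty_ger.
Unshelve. all: by end_near. Qed.

End Rows.

(** * Integration over R^d by slices *)
Section Slices.
Context {R : realType}.
Local Notation Rm := (measurableTypeR R).
Local Notation leb := (@lebesgue_measure R).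

Lemma tleb_integralS n (D : set (n.+1.-tuple Rm)) (h : n.+1.-tuple Rm -> \bar R) :
  (\int[tleb n.+1]_(x in D) h x =
   \int[pushforward (leb \x tleb n) (@tcons R n)]_(x in D) h x)%E.
Proof. by rewrite -[pushforward _ _]tlebS. Qed.

Section Step.
Variables (n : nat) (f : 'rV[R]_n.+1 -> R) (a : R -> R) (b : 'rV[R]_n -> R).
Hypothesis mf : measurable_fun setT (fun x : n.+1.-tuple Rm => f (rowt x)).
Hypothesis ia : leb.-integrable setT (EFin \o a).
Hypothesis ib : (tleb n).-integrable setT (EFin \o (fun y : n.-tuple Rm => b (rowt y))).
Hypothesis fab : forall x y, `|f (rcons0 x y)| <= a x * b y.

Let g (z : Rm * n.-tuple Rm) : R := f (rcons0 z.1 (rowt z.2)).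

Let gE : g = (fun x : n.+1.-tuple Rm => f (rowt x)) \o @tcons R n.
Proof. by apply/funext => z; rewrite /g /= rowt_tcons. Qed.

Let mg : measurable_fun setT g.
Proof. by rewrite gE; apply: measurableT_comp => //; exact: measurable_tcons. Qed.

Let gab (x : Rm) (y : n.-tuple Rm) : `|g (x, y)| <= a x * b (rowt y).
Proof. exact: fab. Qed.

Let ig : (leb \x tleb n)%E.-integrable setT
  ((EFin \o (fun x : n.+1.-tuple Rm => f (rowt x))) \o @tcons R n).
Proof. by have := dominated_prod mg ia ib gab; rewrite gE. Qed.

Lemma slice_integrable :
  (tleb n.+1).-integrable setT (EFin \o (fun x : n.+1.-tuple Rm => f (rowt x))).
Proof.
apply/integrableP; split; first exact/measurable_EFinP.
rewrite tleb_integralS.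
have /integrableP[_] := @integrable_pushforward _ _ _ _ R _ (@measurable_tcons R n)
  (leb \x tleb n)%E setT (EFin \o (fun x : n.+1.-tuple Rm => f (rowt x)))
  ((measurable_EFinP _ _).2 mf) ig measurableT.
by [].
Qed.

Let pushE : \int[tleb n.+1]_x f (rowt x) = \int[(leb \x tleb n)%E]_z g z.
Proof.
rewrite /Rintegral tleb_integralS (integral_pushforward (@measurable_tcons R n))//.
- by rewrite gE preimage_setT.
- exact/measurable_EFinP.
Qed.

Lemma slice_fubini1 :
  \int[tleb n.+1]_x f (rowt x) =
  \int[leb]_x (\int[tleb n]_y f (rcons0 x (rowt y))).
Proof. by rewrite pushE -(dominated_fubini1 mg ia ib gab).2. Qed.

Lemma slice_fubini2 :
  \int[tleb n.+1]_x f (rowt x) =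
  \int[tleb n]_y (\int[leb]_x f (rcons0 x (rowt y))).
Proof. by rewrite pushE -(dominated_fubini2 mg ia ib gab).2. Qed.

End Step.

Lemma slice_tonelli1 n (f : 'rV[R]_n.+1 -> R) : (forall x, 0 <= f x) ->
  measurable_fun setT (fun x : n.+1.-tuple Rm => f (rowt x)) ->
  (\int[tleb n.+1]_x (f (rowt x))%:E =
   \int[leb]_x \int[tleb n]_y (f (rcons0 x (rowt y)))%:E)%E.
Proof.
move=> f0 mf; rewrite tleb_integralS ge0_integral_pushforward//; last 3 first.
- exact: measurable_tcons.
- exact/measurable_EFinP.
- by move=> y _; rewrite lee_fin.
rewrite preimage_setT.
have mg : measurable_fun setT
   ((fun x : n.+1.-tuple Rm => f (rowt x)) \o @tcons R n).
  by apply: measurableT_comp => //; exact: measurable_tcons.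
pose h (z : Rm * n.-tuple Rm) : \bar R := (f (rowt (tcons z)))%:E.
have mh : measurable_fun setT h by exact/measurable_EFinP.
have h0 z : (0 <= h z)%E by rewrite lee_fin.
transitivity (\int[(leb \x tleb n)]_z h z)%E; first by [].
rewrite (fubini_tonelli1 h mh h0).
by apply: eq_integral => x _; apply: eq_integral => y _; rewrite /h rowt_tcons.
Qed.

Lemma slice_tonelli2 n (f : 'rV[R]_n.+1 -> R) : (forall x, 0 <= f x) ->
  measurable_fun setT (fun x : n.+1.-tuple Rm => f (rowt x)) ->
  (\int[tleb n.+1]_x (f (rowt x))%:E =
   \int[tleb n]_y \int[leb]_x (f (rcons0 x (rowt y)))%:E)%E.
Proof.
move=> f0 mf; rewrite tleb_integralS ge0_integral_pushforward//; last 3 first.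
- exact: measurable_tcons.
- exact/measurable_EFinP.
- by move=> y _; rewrite lee_fin.
rewrite preimage_setT.
have mg : measurable_fun setT
   ((fun x : n.+1.-tuple Rm => f (rowt x)) \o @tcons R n).
  by apply: measurableT_comp => //; exact: measurable_tcons.
pose h (z : Rm * n.-tuple Rm) : \bar R := (f (rowt (tcons z)))%:E.
have mh : measurable_fun setT h by exact/measurable_EFinP.
have h0 z : (0 <= h z)%E by rewrite lee_fin.
transitivity (\int[(leb \x tleb n)]_z h z)%E; first by [].
rewrite (fubini_tonelli2 h mh h0).
by apply: eq_integral => x _; apply: eq_integral => y _; rewrite /h rowt_tcons.
Qed.

(** ** The integrable weight prod_j 1 / (1 + x_j^2) *)

Definition lorentz1 (x : R) : R := (1 + x ^+ 2)^-1.

Lemma lorentz1_gt0 x : 0 < lorentz1 x.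
Proof. by rewrite invr_gt0 ltr_pwDl ?sqr_ge0. Qed.

Lemma lorentz1_le1 x : lorentz1 x <= 1.
Proof. by rewrite invf_le1 ?ltr_pwDl ?sqr_ge0// lerDl sqr_ge0. Qed.

Lemma integral_lorentz1 : (\int[leb]_x (lorentz1 x)%:E = pi%:E)%E.
Proof.
have -> : lorentz1 = (fun x : R => (oneDsqr x)^-1) by [].
rewrite ge0_symfun_integralT.
- rewrite -set_itvcy integral0y_oneDsqr -EFinM; congr EFin; lra.
- by move=> x; rewrite invr_ge0.
- exact: continuous_oneDsqrV.
- by move=> x /=; rewrite /oneDsqr sqrrN.
Qed.

Lemma integrable_lorentz1 : leb.-integrable setT (EFin \o lorentz1).
Proof.
apply/integrableP; split.
  by apply/measurable_EFinP; apply: continuous_measurable_fun; exact: continuous_oneDsqrV.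
under eq_integral do rewrite /= ger0_norm ?(ltW (lorentz1_gt0 _))//.
by rewrite integral_lorentz1 ltry.
Qed.

(** A product of functions of one coordinate, so that bounds by it can be
    integrated slice by slice. *)
Definition lorentz d (x : 'rV[R]_d) : R := \prod_j lorentz1 (x 0 j).

Lemma lorentz_gt0 d (x : 'rV[R]_d) : 0 < lorentz x.
Proof. by apply: prodr_gt0 => j _; exact: lorentz1_gt0. Qed.

Lemma lorentz_le1 d (x : 'rV[R]_d) : lorentz x <= 1.
Proof.
apply: (@le_trans _ _ (\prod_(j < d) (1 : R))); last by rewrite big1.
by apply: ler_prod => j _; rewrite lorentz1_le1 ltW ?lorentz1_gt0.
Qed.

End Slices.

Section LorentzWeight.
Context {R : realType}.
Local Notation Rm := (measurableTypeR R).
Local Notation leb := (@lebesgue_measure R).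

Lemma continuous_bigprod (T : topologicalType) I (r : seq I) (F : I -> T -> R) :
  (forall i, continuous (F i)) -> continuous (fun x => \prod_(i <- r) F i x).
Proof.
move=> cF; elim: r => [|i r IH].
  rewrite (_ : (fun x => _) = fun=> 1); first by move=> x; exact: cvg_cst.
  by apply/funext => x; rewrite big_nil.
rewrite (_ : (fun x => _) = fun x => F i x * \prod_(j <- r) F j x).
  by move=> x; apply: cvgM; [exact: cF|exact: IH].
by apply/funext => x; rewrite big_cons.
Qed.

Lemma continuous_bigsum (T : topologicalType) I (r : seq I) (F : I -> T -> R) :
  (forall i, continuous (F i)) -> continuous (fun x => \sum_(i <- r) F i x).
Proof.
move=> cF; elim: r => [|i r IH].
  rewrite (_ : (fun x => _) = fun=> 0); first by move=> x; exact: cvg_cst.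
  by apply/funext => x; rewrite big_nil.
rewrite (_ : (fun x => _) = fun x => F i x + \sum_(j <- r) F j x).
  by move=> x; apply: cvgD; [exact: cF|exact: IH].
by apply/funext => x; rewrite big_cons.
Qed.

Lemma continuous_lorentz d : continuous (@lorentz R d).
Proof.
apply: continuous_bigprod => j x.
apply: (@continuous_comp _ _ _ (fun x : 'rV[R]_d => x 0 j) lorentz1).
  exact: coord_continuous.
exact: continuous_oneDsqrV.
Qed.

Lemma lorentz_rcons0 n (x : R) (y : 'rV[R]_n) :
  lorentz (rcons0 x y) = lorentz1 x * lorentz y.
Proof.
rewrite /lorentz big_ord_recl rcons00; congr (_ * _).
by apply: eq_bigr => j _; rewrite rcons0S.
Qed.

Lemma tleb0 : tleb 0 [set: 0.-tuple Rm] = 1%E.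
Proof. by rewrite -[LHS]/((tleb 0 : set _ -> \bar R) setT) tlebE /= diracT. Qed.

Lemma integrable_lorentz d :
  (tleb d).-integrable setT (EFin \o (fun x : d.-tuple Rm => lorentz (rowt x))).
Proof.
have ml n : measurable_fun setT (fun x : n.-tuple Rm => lorentz (rowt x)).
  exact: (continuous_measurable_rowt (@continuous_lorentz n)).
elim: d => [|d IH].
  apply/integrableP; split; first by apply/measurable_EFinP; exact: ml.
  under eq_integral do rewrite /= /lorentz big_ord0 normr1.
  by rewrite integral_cst// mul1e [ltLHS]tleb0 ltry.
apply: (slice_integrable (a := @lorentz1 R) (b := @lorentz R d)) => //.
  exact: integrable_lorentz1.
by move=> x y; rewrite lorentz_rcons0 ger0_norm// mulr_ge0// ltW ?lorentz1_gt0 ?lorentz_gt0.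
Qed.

Lemma integrable_lorentzZ d (C : R) :
  (tleb d).-integrable setT (EFin \o (fun x : d.-tuple Rm => C * lorentz (rowt x))).
Proof. exact: (integrableZl measurableT C (integrable_lorentz d)). Qed.

Lemma integrable_lorentz1Z (C : R) :
  leb.-integrable setT (EFin \o (fun x => C * lorentz1 x)).
Proof. exact: (integrableZl measurableT C integrable_lorentz1). Qed.

Lemma integral_lorentz d : \int[@tleb R d]_x lorentz (rowt x : 'rV[R]_d) = pi ^+ d.
Proof.
elim: d => [|d IH].
  rewrite (@eq_Rintegral _ _ _ (tleb 0) setT (fun=> (1 : R))); last by move=> x _; rewrite [lorentz _]big_ord0.
  rewrite Rintegral_cst// mul1r. by rewrite (congr1 fine tleb0) expr0.
rewrite (slice_fubini1 (a := @lorentz1 R) (b := @lorentz R d)).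
- rewrite (@eq_Rintegral _ _ _ leb setT (fun x : R => pi ^+ d * lorentz1 x)).
    rewrite RintegralZl//; last exact: integrable_lorentz1.
    by rewrite /Rintegral integral_lorentz1 exprSr.
  move=> x _; rewrite mulrC -IH -RintegralZl//; last exact: integrable_lorentz.
  by apply: eq_Rintegral => y _; rewrite lorentz_rcons0.
- exact: (continuous_measurable_rowt (@continuous_lorentz d.+1)).
- exact: integrable_lorentz1.
- exact: integrable_lorentz.
- by move=> x y; rewrite lorentz_rcons0 ger0_norm// mulr_ge0// ltW ?lorentz1_gt0 ?lorentz_gt0.
Qed.

Lemma lorentz1_cvgy : lorentz1 (n%:R : R) @[n --> \oo] --> (0 : R).
Proof.
apply: (@squeeze_cvgr _ _ _ _ (fun=> 0) (fun n => 2 * (n.+1%:R)^-1)).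
- near=> n; rewrite ltW ?lorentz1_gt0//=.
  rewrite /lorentz1 ler_pdivlMr// mulrC ler_pdivrMr ?ltr_pwDl ?sqr_ge0//.
  have n0 : 0 <= n%:R :> R by [].
  by rewrite -addn1 natrD; nra.
- exact: cvg_cst.
- by rewrite -[X in _ --> X](mulr0 2); apply: cvgMl_tmp; exact: cvg_harmonic.
Unshelve. all: by end_near. Qed.

(** The integral over [- n, n] is G n - G (- n), which vanishes in the limit. *)
Lemma line_integral_derive0 (G G' : R -> R) (C : R) :
  (forall s : R, is_derive s (1 : R) G (G' s)) -> continuous G' ->
  (forall s, `|G s| <= C * lorentz1 s) -> (forall s, `|G' s| <= C * lorentz1 s) ->
  \int[leb]_s G' s = 0.
Proof.
move=> dG cG' GC G'C.
have mG' : measurable_fun setT G' by exact: continuous_measurable_fun.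
pose F (n : nat) (s : R) : \bar R := ((EFin \o G') \_ `[- n%:R, n%:R]) s.
have FE n : (0 < n)%N -> (\int[leb]_s F n s = (G n%:R - G (- n%:R))%:E)%E.
  move=> n0; rewrite /F -integral_mkcond (@continuous_FTC2 _ _ G)//.
  - by rewrite -subr_gt0 opprK addr_gt0// ltr0n.
  - exact: continuous_subspaceT.
  - split.
    + by move=> x _; exact: (@ex_derive _ _ _ _ _ _ _ (dG x)).
    + apply: cvg_at_right_filter; apply/differentiable_continuous/derivable1_diffP.
      exact: (@ex_derive _ _ _ _ _ _ _ (dG _)).
    + apply: cvg_at_left_filter; apply/differentiable_continuous/derivable1_diffP.
      exact: (@ex_derive _ _ _ _ _ _ _ (dG _)).
  - by move=> x _; rewrite derive1E; exact: derive_val.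
have cvF : (\int[leb]_s F n s)%E @[n --> \oo] --> (\int[leb]_s (G' s)%:E)%E.
  apply: (@dominated_cvg _ _ _ leb _ measurableT F (EFin \o G')
    (EFin \o (fun s => C * lorentz1 s))) => //.
  - move=> n; apply/(measurable_restrictT _ _).1 => //.
    by apply/measurable_EFinP; exact: measurable_funTS.
  - move=> s _; apply: cvg_near_cst; near=> n; rewrite /F patchE ifT//.
    rewrite inE /= in_itv /= -ler_norml; near: n; exact: nbhs_infty_ger.
  - exact: integrable_lorentz1Z.
  - move=> n s _; rewrite /F patchE; case: ifP => _ /=; rewrite lee_fin ?normr0//.
    exact: le_trans (normr_ge0 _) (GC s).
have cvG : ((G n%:R - G (- n%:R))%:E : \bar R) @[n --> \oo] --> (0%:E : \bar R).
  apply/cvg_EFin; first exact: nearW.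
  rewrite -[X in _ --> X]subr0 /=.
  have lem (s : nat -> R) : (forall n, lorentz1 (s n) = lorentz1 (n%:R : R)) ->
     G (s n) @[n --> \oo] --> (0 : R).
    move=> sE; apply/norm_cvg0P.
    apply: (@squeeze_cvgr _ _ _ _ (fun=> 0) (fun n => C * lorentz1 (n%:R : R))).
    + by apply: nearW => n; rewrite normr_ge0 -sE GC.
    + exact: cvg_cst.
    + by rewrite -[X in _ --> X](mulr0 C); apply: cvgMl_tmp; exact: lorentz1_cvgy.
  apply: cvgB; apply: lem => // n.
  by rewrite /lorentz1 sqrrN.
rewrite /Rintegral.
suff -> : (\int[leb]_s (G' s)%:E = 0%:E)%E by [].
apply: (@cvg_unique _ (@ereal_hausdorff R) _ _ _ _ cvF).
apply: cvg_trans cvG; apply: near_eq_cvg; near=> n; rewrite FE//.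
by near: n; exact: nbhs_infty_gt.
Unshelve. all: by end_near. Qed.

End LorentzWeight.

(** * Integration along a coordinate *)
Section Coordinates.
Context {R : realType}.
Local Notation Rm := (measurableTypeR R).
Local Notation leb := (@lebesgue_measure R).

Definition setc d (j : 'I_d) (x : 'rV[R]_d) (s : R) : 'rV[R]_d :=
  \row_k (if k == j then s else x 0 k).

Lemma setc_rcons0 n (x : R) (y : 'rV[R]_n) s :
  setc ord0 (rcons0 x y) s = rcons0 s y.
Proof.
by apply/rowP => k; rewrite !mxE; case: unliftP => [i ->|->].
Qed.

Lemma setc_rconsS n (j : 'I_n) (x : R) (y : 'rV[R]_n) s :
  setc (lift ord0 j) (rcons0 x y) s = rcons0 x (setc j y s).
Proof.
apply/rowP => k; rewrite !mxE; case: unliftP => [i ->|->] //.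
by rewrite (inj_eq lift_inj) mxE.
Qed.

(** Integrate first along the coordinate that is differentiated. *)
Lemma integral_partial0 d (j : 'I_d) (G G' : 'rV[R]_d -> R) (C : R) :
  continuous G' ->
  (forall x (s : R), is_derive s (1 : R) (fun u => G (setc j x u)) (G' (setc j x s))) ->
  (forall x, `|G x| <= C * lorentz x) -> (forall x, `|G' x| <= C * lorentz x) ->
  \int[tleb d]_x G' (rowt x) = 0.
Proof.
elim: d j G G' C => [[]//|d IH] j G G' C cG' dG GC G'C.
have G'C' x (y : 'rV[R]_d) : `|G' (rcons0 x y)| <= lorentz1 x * (C * lorentz y).
  by rewrite (le_trans (G'C _))// lorentz_rcons0 mulrCA.
have mG' := continuous_measurable_rowt cG'.
case: (unliftP ord0 j) dG => [i ->|->] dG.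
- rewrite (slice_fubini1 mG' integrable_lorentz1 (integrable_lorentzZ d C) G'C').
  transitivity (\int[leb]_x (0 : R)); last by rewrite Rintegral_cst// mul0r.
  apply: eq_Rintegral => x _.
  apply: (IH i (fun y => G (rcons0 x y)) (fun y => G' (rcons0 x y)) (C * lorentz1 x)).
  + move=> y; apply: (@continuous_comp _ _ _ (fun y : 'rV[R]_d => rcons0 x y) G').
      exact: (continuous_rcons0 x y).2.
    exact: cG'.
  + move=> y s; have := dG (rcons0 x y) s; rewrite setc_rconsS.
    by under eq_fun do rewrite setc_rconsS.
  + by move=> y; rewrite (le_trans (GC _))// lorentz_rcons0 mulrA.
  + by move=> y; rewrite (le_trans (G'C _))// lorentz_rcons0 mulrA.
- rewrite (slice_fubini2 mG' integrable_lorentz1 (integrable_lorentzZ d C) G'C').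
  transitivity (\int[tleb d]_x (0 : R)); last by rewrite Rintegral_cst// mul0r.
  apply: eq_Rintegral => y _.
  apply: (@line_integral_derive0 _ (fun x => G (rcons0 x (rowt y))) _ (C * lorentz (rowt y))).
  + move=> s; have := dG (rcons0 0 (rowt y)) s; rewrite setc_rcons0.
    by under eq_fun do rewrite setc_rcons0.
  + move=> x; apply: (@continuous_comp _ _ _ (fun x => rcons0 x (rowt y)) G').
      exact: (continuous_rcons0 x (rowt y)).1.
    exact: cG'.
  + by move=> x; rewrite (le_trans (GC _))// lorentz_rcons0 mulrCA mulrC.
  + by move=> x; rewrite (le_trans (G'C _))// lorentz_rcons0 mulrCA mulrC.
Qed.

Lemma slice_measurable1 n (f : 'rV[R]_n.+1 -> R) : (forall x, 0 <= f x) ->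
  continuous f ->
  measurable_fun setT (fun x : Rm => \int[tleb n]_y (f (rcons0 x (rowt y)))%:E)%E.
Proof.
move=> f0 cf; pose h (z : Rm * n.-tuple Rm) : \bar R := (f (rowt (tcons z)))%:E.
have mh : measurable_fun setT h.
  apply/measurable_EFinP; apply: (measurableT_comp (continuous_measurable_rowt cf)).
  exact: measurable_tcons.
have h0 z : (0 <= h z)%E by rewrite lee_fin.
have := measurable_fun_fubini_tonelli_F (m2 := tleb n) h mh h0.
congr (measurable_fun _ _); apply/funext => x; apply: eq_integral => y _.
by rewrite /h rowt_tcons.
Qed.

Lemma slice_measurable2 n (f : 'rV[R]_n.+1 -> R) : (forall x, 0 <= f x) ->
  continuous f ->
  measurable_fun setT (fun y : n.-tuple Rm => \int[leb]_x (f (rcons0 x (rowt y)))%:E)%E.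
Proof.
move=> f0 cf; pose h (z : Rm * n.-tuple Rm) : \bar R := (f (rowt (tcons z)))%:E.
have mh : measurable_fun setT h.
  apply/measurable_EFinP; apply: (measurableT_comp (continuous_measurable_rowt cf)).
  exact: measurable_tcons.
have h0 z : (0 <= h z)%E by rewrite lee_fin.
have := measurable_fun_fubini_tonelli_G (m1 := leb) h mh h0.
congr (measurable_fun _ _); apply/funext => x; apply: eq_integral => y _.
by rewrite /h rowt_tcons.
Qed.

Lemma line_affine (F : R -> R) (a delta : R) : 0 < delta -> continuous F ->
  (forall x, 0 <= F x) ->
  (\int[leb]_x (F x)%:E = delta%:E * \int[leb]_x (F (a + delta * x))%:E)%E.
Proof.
move=> d0 cF F0.
have dA (x : R) : is_derive x (1 : R) (fun u : R => a + delta * u) delta.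
  by apply: is_derive_eq; rewrite add0r mul1r [_%:A]mulr1.
have dE : derive1 (fun u : R => a + delta * u) = fun=> delta.
  by apply/funext => x; rewrite derive1E; exact: derive_val.
rewrite (increasing_ge0_integration_by_substitutionT (F := fun u => a + delta * u))//.
- rewrite dE; under eq_integral do rewrite /= mulrC EFinM.
  rewrite ge0_integralZl//=.
  + apply/measurable_EFinP; apply: measurableT_comp; first exact: continuous_measurable_fun.
    by apply: measurable_funD => //; exact: measurable_funM.
  + by move=> x _; rewrite lee_fin.
  + by rewrite lee_fin ltW.
- by move=> x y xy; rewrite ltrD2l ltr_pM2l.
- by rewrite dE; move=> x; exact: cst_continuous.
- by rewrite dE; exact: is_cvg_cst.
- by rewrite dE; exact: is_cvg_cst.
- apply/cvgrNyPle => M; apply: filterS (nbhs_ninfty_le (num_real ((M - a) / delta))) => x.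
  by rewrite ler_pdivlMr// mulrC lerBrDl.
- apply/cvgryPge => M; apply: filterS (nbhs_pinfty_ge (num_real ((M - a) / delta))) => x.
  by rewrite ler_pdivrMr// mulrC lerBlDl.
Qed.

Lemma rcons0D n (x x' : R) (y y' : 'rV[R]_n) :
  rcons0 (x + x') (y + y') = rcons0 x y + rcons0 x' y'.
Proof. by apply/rowP => k; rewrite !mxE; case: unliftP => [i _|_]; rewrite ?mxE. Qed.

Lemma rcons0Z n (c x : R) (y : 'rV[R]_n) :
  rcons0 (c * x) (c *: y) = c *: rcons0 x y.
Proof. by apply/rowP => k; rewrite !mxE; case: unliftP => [i _|_]; rewrite ?mxE. Qed.

Lemma rcons0_split n (a : 'rV[R]_n.+1) :
  a = rcons0 (a 0 ord0) (\row_j a 0 (lift ord0 j)).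
Proof. by apply/rowP => k; rewrite !mxE; case: unliftP => [i ->|->]; rewrite ?mxE. Qed.

(** One coordinate is changed at a time. The function H has all coordinates
    changed but the first; Tonelli's theorem, applied to it twice, brings the
    first coordinate inside. *)
Lemma affine_integral d (F : 'rV[R]_d -> R) (a : 'rV[R]_d) (delta : R) :
  0 < delta -> continuous F -> (forall x, 0 <= F x) ->
  (\int[tleb d]_x (F (rowt x))%:E =
   (delta ^+ d)%:E * \int[tleb d]_x (F (a + delta *: rowt x))%:E)%E.
Proof.
move=> d0; elim: d F a => [|d IH] F a cF F0.
  rewrite expr0 mul1e; apply: eq_integral => x _; congr (F _)%:E.
  by apply/rowP => -[].
have cA : continuous (fun x : 'rV[R]_d.+1 => F (a + delta *: x)).
  move=> x; apply: (@continuous_comp _ _ _ (fun x : 'rV[R]_d.+1 => a + delta *: x) F);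
    last exact: cF.
  exact: (continuousD (@cst_continuous _ _ a x) (@scaler_continuous _ _ delta x)).
set a0 := a 0 ord0; set a' := \row_j a 0 (lift ord0 j).
have E1 x (y : 'rV[R]_d) :
    rcons0 (a0 + delta * x) (a' + delta *: y) = a + delta *: rcons0 x y.
  by rewrite rcons0D rcons0Z -rcons0_split.
have cFx x : continuous (fun y : 'rV[R]_d => F (rcons0 x y)).
  move=> y; apply: (@continuous_comp _ _ _ (fun y : 'rV[R]_d => rcons0 x y) F).
    exact: (continuous_rcons0 x y).2.
  exact: cF.
have cFy (y : 'rV[R]_d) : continuous (fun x => F (rcons0 x y)).
  move=> x; apply: (@continuous_comp _ _ _ (fun x => rcons0 x y) F).
    exact: (continuous_rcons0 x y).1.
  exact: cF.
pose H (x : 'rV[R]_d.+1) := F (rcons0 (x 0 ord0) (a' + delta *: \row_j x 0 (lift ord0 j))).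
have HE x (y : 'rV[R]_d) : H (rcons0 x y) = F (rcons0 x (a' + delta *: y)).
  rewrite /H rcons00; congr (F (rcons0 _ (_ + _ *: _))).
  by apply/rowP => j; rewrite mxE rcons0S.
have cH : continuous H.
  move=> x; apply: (@continuous_comp _ _ _ (fun x : 'rV[R]_d.+1 =>
     rcons0 (x 0 ord0) (a' + delta *: \row_j x 0 (lift ord0 j))) F); last exact: cF.
  move: x; apply: continuous_row => j x.
  case: (unliftP ord0 j) => [i ->|->].
    rewrite (_ : (fun x => _) = (fun x : 'rV[R]_d.+1 =>
      a 0 (lift ord0 i) + delta * x 0 (lift ord0 i))).
      apply: (continuousD (@cst_continuous _ _ (a 0 (lift ord0 i)) x)).
      apply: (continuousM (@cst_continuous _ _ delta x)).
      exact: coord_continuous.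
    by apply/funext => z; rewrite mxE liftK !mxE.
  rewrite (_ : (fun x => _) = (fun x : 'rV[R]_d.+1 => x 0 ord0)).
    exact: coord_continuous.
  by apply/funext => z; rewrite mxE unlift_none.
have mH := continuous_measurable_rowt cH.
rewrite (slice_tonelli1 F0 (continuous_measurable_rowt cF)).
under eq_integral do rewrite (IH _ a' (cFx _) (fun=> F0 _)).
rewrite ge0_integralZl//; last 3 first.
- have := slice_measurable1 (fun x => F0 _ : 0 <= H x) cH.
  by congr (measurable_fun _ _); apply/funext => x; apply: eq_integral => y _; rewrite HE.
- by move=> x _; apply: integral_ge0 => y _; rewrite lee_fin.
- by rewrite lee_fin exprn_ge0// ltW.
have -> : (\int[leb]_x \int[tleb d]_y (F (rcons0 x (a' + delta *: rowt y)))%:E =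
  \int[leb]_x \int[tleb d]_y (H (rcons0 x (rowt y)))%:E)%E.
  by under [RHS]eq_integral do under eq_integral do rewrite HE.
have H0 x : 0 <= H x by exact: F0.
rewrite -(slice_tonelli1 H0 mH) (slice_tonelli2 H0 mH).
under eq_integral do under eq_integral do rewrite HE.
under eq_integral do rewrite (line_affine a0 d0 (cFy _) (fun=> F0 _)).
under eq_integral do under eq_integral do rewrite E1.
rewrite ge0_integralZl//; last 3 first.
- have := slice_measurable2 (fun x => F0 _ : 0 <= F (a + delta *: x)) cA.
  by [].
- by move=> x _; apply: integral_ge0 => y _; rewrite lee_fin.
- by rewrite lee_fin ltW.
have FA0 x : 0 <= F (a + delta *: x) by exact: F0.
by rewrite -(slice_tonelli2 FA0 (continuous_measurable_rowt cA)) muleA -EFinM exprSr.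
Qed.

End Coordinates.

(** * Fourier inversion *)
Section AbelKernel.
Context {R : realType}.
Local Notation leb := (@lebesgue_measure R).
Implicit Types (G : R -> R) (delta x s : R).

Lemma integral_fold G : (forall s, 0 <= G s) -> continuous G ->
  (\int[leb]_s (G s)%:E = \int[leb]_(s in `[0%R, +oo[) (G s + G (- s))%:E)%E.
Proof.
move=> G0 cG.
have mG : measurable_fun [set: R] G by exact: continuous_measurable_fun.
have cGN : continuous (fun s => G (- s)).
  move=> s; apply: (@continuous_comp _ _ _ (fun s => - s) G); last exact: cG.
  exact: opp_continuous.
have mGN : measurable_fun [set: R] (fun s => G (- s)) by exact: continuous_measurable_fun.
have mpos : measurable [set s : R | 0 <= s] by rewrite -set_itvcy.
rewrite -(setUv [set s : R | 0 <= s]) ge0_integral_setU//=; last 4 first.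
- exact: measurableC.
- by apply/measurable_EFinP; rewrite setUv.
- by move=> s _; rewrite lee_fin.
- exact/disj_setPCl.
under [RHS]eq_integral do rewrite EFinD.
rewrite ge0_integralD//; last 4 first.
- by move=> s _; rewrite lee_fin.
- by apply/measurable_EFinP; exact: measurable_funTS.
- by move=> s _; rewrite lee_fin.
- by apply/measurable_EFinP; exact: measurable_funTS.
rewrite -set_itvcy; congr (_ + _)%E.
rewrite setCitvr integral_itv_bndo_bndc; last exact/measurable_EFinP/measurable_funTS.
rewrite -{1}oppr0 ge0_integration_by_substitutionNy//.
exact: continuous_subspaceT.
Qed.

Lemma is_derive_damped delta x (s : R) : 0 < delta ->
  is_derive s (1 : R) (fun u : R => - (expR (- (delta * u)) / delta) +
     expR (- (delta * u)) * (x * sin (x * u) - delta * cos (x * u)) /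
       (delta ^+ 2 + x ^+ 2))
   (expR (- (delta * s)) * (1 + cos (x * s))).
Proof.
move=> d0; apply: is_derive_eq; rewrite /GRing.scale /=.
have D0 : delta ^+ 2 + x ^+ 2 != 0 by rewrite gt_eqF// ltr_pwDl ?exprn_gt0 ?sqr_ge0.
by field; rewrite D0 gt_eqF.
Qed.

Lemma continuous_damped delta x (c : R) :
  continuous (fun s : R => expR (- (delta * s)) * (c + cos (x * s))).
Proof.
move=> s; apply/differentiable_continuous/derivable1_diffP.
by apply: ex_derive.
Qed.

Lemma integral_damped delta x : 0 < delta ->
  (\int[leb]_(s in `[0%R, +oo[) (expR (- (delta * s)) * (1 + cos (x * s)))%:E =
   (delta^-1 + delta / (delta ^+ 2 + x ^+ 2))%:E)%E.
Proof.
move=> d0.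
pose F u := - (expR (- (delta * u)) / delta) +
     expR (- (delta * u)) * (x * sin (x * u) - delta * cos (x * u)) /
       (delta ^+ 2 + x ^+ 2).
have D0 : 0 < delta ^+ 2 + x ^+ 2 by rewrite ltr_pwDl ?exprn_gt0 ?sqr_ge0.
have dF s := is_derive_damped x s d0.
have cF s : {for s, continuous F}.
  apply/differentiable_continuous/derivable1_diffP.
  exact: (@ex_derive _ _ _ _ _ _ _ (dF s)).
have ce : expR (- (delta * u)) @[u --> +oo%R] --> (0 : R).
  apply: (cvg_comp (fun u => delta * u) (fun v => expR (- v))); last exact: cvgr_expR.
  by apply: gt0_cvgMry => //; exact: cvg_id.
rewrite (@ge0_continuous_FTC2y _ _ F 0 0)//.
- rewrite /F !(mulr0, oppr0, expR0, sin0, cos0, mul1r, mulr1, sub0r) sub0e -EFinN.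
  by congr EFin; field; rewrite !gt_eqF.
- by apply: continuous_subspaceT; exact: continuous_damped.
- have -> : F = fun u => expR (- (delta * u)) *
     (- delta^-1 + (x * sin (x * u) - delta * cos (x * u)) / (delta ^+ 2 + x ^+ 2)).
    by apply/funext => u; rewrite /F; field; rewrite (gt_eqF d0) (gt_eqF D0).
  pose B := delta^-1 + (`|x| + delta) / (delta ^+ 2 + x ^+ 2).
  apply/norm_cvg0P.
  apply: (@squeeze_cvgr _ _ _ _ (fun=> 0) (fun u => expR (- (delta * u)) * B)).
  + near=> u; rewrite normr_ge0 normrM ger0_norm ?expR_ge0// ler_wpM2l ?expR_ge0//.
    rewrite (le_trans (ler_normD _ _))// normrN ger0_norm ?invr_ge0 ?(ltW d0)// /B lerD2l.
    rewrite normrM normfV (gtr0_norm D0) ler_pM2r ?invr_gt0//.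
    rewrite (le_trans (ler_normB _ _))// !normrM (gtr0_norm d0) lerD//.
      by rewrite ler_piMr// ler_norml sin_geN1 sin_le1.
    by rewrite ler_piMr ?(ltW d0)// ler_norml cos_geN1 cos_le1.
  + exact: cvg_cst.
  + by rewrite -[X in _ --> X](mul0r B); apply: cvgMr_tmp.
- by apply: cvg_at_right_filter; exact: cF.
- by move=> s _; rewrite derive1E; exact: derive_val.
Unshelve. all: by end_near. Qed.

Let abel delta s := expR (- (delta * `|s|)).

Let continuous_abel delta : continuous (abel delta).
Proof.
move=> s; apply: (@continuous_comp _ _ _ (fun s => - (delta * `|s|)) expR);
  last exact: continuous_expR.
apply: cvgN; apply: cvgMl_tmp; exact: norm_continuous.
Qed.

Let integral_abel_cos delta x : 0 < delta ->
  (\int[leb]_s (abel delta s * (1 + cos (x * s)))%:E =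
   (2 * (delta^-1 + delta / (delta ^+ 2 + x ^+ 2)))%:E)%E.
Proof.
move=> d0; rewrite (@integral_fold (fun s => abel delta s * (1 + cos (x * s)))).
- rewrite EFinM -(integral_damped x d0) -ge0_integralZl//.
  + apply: eq_integral => s; rewrite inE /= in_itv /= andbT => s0.
    rewrite -EFinM; congr EFin.
    by rewrite /abel mulrN cosN normrN ger0_norm// mulr_natl mulr2n.
  + apply/measurable_EFinP; apply: measurable_funTS.
    by apply: continuous_measurable_fun; exact: continuous_damped.
- by move=> s; rewrite mulr_ge0 ?expR_ge0//.
- move=> s; apply: cvgM; first exact: continuous_abel.
  apply: cvgD; first exact: cvg_cst.
  apply: (@continuous_comp _ _ _ (fun s => x * s) cos); last exact: continuous_cos.
  exact: mulrl_continuous.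
Qed.

Let integral_abel delta : 0 < delta ->
  (\int[leb]_s (abel delta s)%:E = (2 / delta)%:E)%E.
Proof.
move=> d0; have := integral_abel_cos 0 d0.
under eq_integral do rewrite mul0r cos0 -[1 + 1]/2%:R mulrC EFinM.
rewrite ge0_integralZl//; last 2 first.
- by apply/measurable_EFinP; apply: continuous_measurable_fun; exact: continuous_abel.
- by move=> s _; rewrite lee_fin expR_ge0.
move=> /(congr1 (fun z => (2^-1)%:E * z)%E); rewrite muleA -!EFinM mulVf// mul1e => ->.
by congr EFin; field; rewrite gt_eqF.
Qed.

Lemma integrable_abel delta : 0 < delta ->
  leb.-integrable setT (EFin \o (fun s => expR (- (delta * `|s|)))).
Proof.
move=> d0; apply/integrableP; split.
  by apply/measurable_EFinP; apply: continuous_measurable_fun; exact: continuous_abel.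
under eq_integral do rewrite /= ger0_norm ?expR_ge0//.
by rewrite (integral_abel d0) ltry.
Qed.

Let integral_abel_sin delta x : 0 < delta ->
  (\int[leb]_s (abel delta s * (1 + sin (x * s)))%:E = (2 / delta)%:E)%E.
Proof.
move=> d0; rewrite (@integral_fold (fun s => abel delta s * (1 + sin (x * s)))).
- rewrite -(integral_abel d0) (@integral_fold (abel delta)).
  + apply: eq_integral => s _; congr EFin; rewrite /abel mulrN sinN normrN; ring.
  + by move=> s; exact: expR_ge0.
  + exact: continuous_abel.
- by move=> s; rewrite mulr_ge0 ?expR_ge0//.
- move=> s; apply: cvgM; first exact: continuous_abel.
  apply: cvgD; first exact: cvg_cst.
  apply: (@continuous_comp _ _ _ (fun s => x * s) sin); last exact: continuous_sin.
  exact: mulrl_continuous.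
Qed.

(** The Fourier transform of exp (- delta |s|) is the Poisson kernel. The
    summand 1 added to the oscillating factor keeps the integrands
    nonnegative. *)
Lemma cint_abel delta x : 0 < delta ->
  cint leb (fun s => (expR (- (delta * `|s|)))%:C%C * cexp (Complex 0 (s * x))) =
  (2 * delta / (delta ^+ 2 + x ^+ 2))%:C%C.
Proof.
move=> d0; have D0 : 0 < delta ^+ 2 + x ^+ 2 by rewrite ltr_pwDl ?exprn_gt0 ?sqr_ge0.
have ia := integrable_abel d0.
have iosc (f : R -> R) : continuous f -> (forall s, `|f s| <= 1) ->
    leb.-integrable setT (EFin \o (fun s => abel delta s * f s)).
  move=> cf f1; apply: integrable_bound ia _ _.
    apply: continuous_measurable_fun => s.
    by apply: cvgM; [exact: continuous_abel|exact: cf].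
  by move=> s; rewrite normrM ger0_norm ?expR_ge0// ler_piMr ?expR_ge0.
have ic : leb.-integrable setT (EFin \o (fun s => abel delta s * cos (x * s))).
  apply: iosc => [s|s]; last by rewrite ler_norml cos_geN1 cos_le1.
  apply: (@continuous_comp _ _ _ (fun s => x * s) cos); last exact: continuous_cos.
  exact: mulrl_continuous.
have isn : leb.-integrable setT (EFin \o (fun s => abel delta s * sin (x * s))).
  apply: iosc => [s|s]; last by rewrite ler_norml sin_geN1 sin_le1.
  apply: (@continuous_comp _ _ _ (fun s => x * s) sin); last exact: continuous_sin.
  exact: mulrl_continuous.
have ea : \int[leb]_s abel delta s = 2 / delta by rewrite /Rintegral integral_abel.
apply: complex_eq => /=.
- have h1 : \int[leb]_s (abel delta s * (1 + cos (x * s))) =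
      2 * (delta^-1 + delta / (delta ^+ 2 + x ^+ 2)).
    by rewrite /Rintegral integral_abel_cos.
  have h2 : \int[leb]_s (abel delta s * (1 + cos (x * s))) =
      \int[leb]_s abel delta s + \int[leb]_s (abel delta s * cos (x * s)).
    by rewrite -RintegralD//; apply: eq_Rintegral => s _; rewrite mulrDr mulr1.
  transitivity (\int[leb]_s (abel delta s * cos (x * s))).
    apply: eq_Rintegral => s _.
    by rewrite expR0 /= !(mul0r, subr0, mul1r) [s * x]mulrC.
  apply: (@addrI _ (2 / delta)); rewrite -ea -h2 h1 ea; field.
  by rewrite (gt_eqF d0) (gt_eqF D0).
- have h1 : \int[leb]_s (abel delta s * (1 + sin (x * s))) = 2 / delta.
    by rewrite /Rintegral integral_abel_sin.
  have h2 : \int[leb]_s (abel delta s * (1 + sin (x * s))) =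
      \int[leb]_s abel delta s + \int[leb]_s (abel delta s * sin (x * s)).
    by rewrite -RintegralD//; apply: eq_Rintegral => s _; rewrite mulrDr mulr1.
  transitivity (\int[leb]_s (abel delta s * sin (x * s))).
    apply: eq_Rintegral => s _.
    by rewrite expR0 /= !(mul0r, add0r, addr0, mul1r) [s * x]mulrC.
  by apply: (@addrI _ (2 / delta)); rewrite -ea -h2 h1 ea addr0.
Qed.

End AbelKernel.

Section ComplexSlices.
Context {R : realType}.
Local Notation Rm := (measurableTypeR R).
Local Notation leb := (@lebesgue_measure R).

Lemma cint_real d (T : measurableType d) (mu : {measure set T -> \bar R}) (h : T -> R) :
  cint mu (fun x => (h x)%:C%C) = (\int[mu]_x h x)%:C%C.
Proof. by apply: complex_eq => //=; rewrite /Rintegral integral0. Qed.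

Lemma cmeasurable_prod d (T : measurableType d) I (r : seq I) (F : I -> T -> R[i]) :
  (forall i, cmeasurable (F i)) -> cmeasurable (fun x => \prod_(i <- r) F i x).
Proof.
move=> mF; elim: r => [|i r IH].
  have -> : (fun x => \prod_(i <- [::]) F i x) = fun=> 1.
    by apply/funext => x; rewrite big_nil.
  exact: cmeasurable_cst.
have -> : (fun x => \prod_(j <- i :: r) F j x) =
    fun x => F i x * \prod_(j <- r) F j x.
  by apply/funext => x; rewrite big_cons.
exact: cmeasurableM.
Qed.

Lemma cmeasurable_coord d (f : R -> R[i]) (j : 'I_d) :
  cmeasurable (f : Rm -> R[i]) ->
  cmeasurable (fun x : d.-tuple Rm => f (rowt x 0 j)).
Proof.
move=> [mr mi]; split.
- under eq_fun do rewrite mxE.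
  apply: (measurableT_comp (f := fun s : Rm => complex.Re (f s))) => //.
  exact: measurable_tnth.
- under eq_fun do rewrite mxE.
  apply: (measurableT_comp (f := fun s : Rm => complex.Im (f s))) => //.
  exact: measurable_tnth.
Qed.

Lemma measurable_coord d (j : 'I_d) :
  measurable_fun setT (fun x : d.-tuple Rm => rowt x 0 j : R).
Proof. by under eq_fun do rewrite mxE; exact: measurable_tnth. Qed.

Lemma prod_rcons0 d (a : R -> R) (x : R) (y : 'rV[R]_d) :
  \prod_j a (rcons0 x y 0 j) = a x * \prod_j a (y 0 j).
Proof.
rewrite big_ord_recl rcons00; congr (_ * _).
by apply: eq_bigr => j _; rewrite rcons0S.
Qed.

Section Slice.
Variables (n : nat) (f : 'rV[R]_n.+1 -> R[i]) (a : R -> R) (b : 'rV[R]_n -> R).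
Hypothesis mf : cmeasurable (fun x : n.+1.-tuple Rm => f (rowt x)).
Hypothesis ia : leb.-integrable setT (EFin \o a).
Hypothesis ib : (tleb n).-integrable setT (EFin \o (fun y : n.-tuple Rm => b (rowt y))).
Hypothesis fab : forall x y, cabs (f (rcons0 x y)) <= a x * b y.

Lemma slice_cfubini :
  cint (tleb n.+1) (fun x => f (rowt x)) =
  cint leb (fun x => cint (tleb n) (fun y => f (rcons0 x (rowt y)))).
Proof.
have [mr mi] := mf.
apply: complex_eq => /=.
- rewrite (slice_fubini1 (f := fun x => complex.Re (f x)) mr ia ib)// => x y.
  exact: le_trans (Re_le_cabs _) _.
- rewrite (slice_fubini1 (f := fun x => complex.Im (f x)) mi ia ib)// => x y.
  exact: le_trans (Im_le_cabs _) _.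
Qed.
End Slice.

Lemma tensor_integrable d (a : R -> R) : (forall s, 0 <= a s) ->
  leb.-integrable setT (EFin \o a) ->
  (tleb d).-integrable setT (EFin \o (fun x : d.-tuple Rm => \prod_j a (rowt x 0 j))).
Proof.
move=> a0 ia; have ma := integrable_measurable ia.
have mp n : measurable_fun setT (fun x : n.-tuple Rm => \prod_j a (rowt x 0 j)).
  have [mr _] : cmeasurable (fun x : n.-tuple Rm => \prod_j (a (rowt x 0 j))%:C%C).
    apply: cmeasurable_prod => j; apply: (@cmeasurable_coord _ (fun s => (a s)%:C%C)).
    exact: cmeasurable_real.
  move: mr; congr (measurable_fun _ _); apply/funext => x.
  by rewrite -rmorph_prod.
elim: d => [|d IH].
  apply/integrableP; split; first by apply/measurable_EFinP; exact: mp.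
  under eq_integral do rewrite /= big_ord0 normr1.
  by rewrite integral_cst// mul1e [ltLHS]tleb0 ltry.
apply: (slice_integrable (f := fun x => \prod_j a (x 0 j)) (a := a)
  (b := fun y : 'rV[R]_d => \prod_j a (y 0 j))) => //.
by move=> x y; rewrite ger0_norm ?prodr_ge0// prod_rcons0.
Qed.

Lemma cint_tensor d (f : 'I_d -> R -> R[i]) (a : R -> R) :
  (forall s, 0 <= a s) -> leb.-integrable setT (EFin \o a) ->
  (forall j, cmeasurable (f j : Rm -> R[i])) -> (forall j s, cabs (f j s) <= a s) ->
  cint (tleb d) (fun x => \prod_j f j (rowt x 0 j)) = \prod_j cint leb (f j).
Proof.
move=> a0 ia; elim: d f => [|d IH] f mf fa.
  rewrite big_ord0 (_ : (fun _ => _) = (fun=> (1 : R)%:C%C)); last first.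
    by apply/funext => x; rewrite big_ord0.
  by rewrite cint_real Rintegral_cst// mul1r (congr1 fine tleb0).
have mp n (h : 'I_n -> R -> R[i]) : (forall j, cmeasurable (h j : Rm -> R[i])) ->
    cmeasurable (fun x : n.-tuple Rm => \prod_j h j (rowt x 0 j)).
  by move=> mh; apply: cmeasurable_prod => j; exact: cmeasurable_coord.
have bp n (h : 'I_n -> R -> R[i]) (x : 'rV[R]_n) : (forall j s, cabs (h j s) <= a s) ->
    cabs (\prod_j h j (x 0 j)) <= \prod_j a (x 0 j).
  by move=> ha; rewrite cabs_prod; apply: ler_prod => j _; rewrite cabs_ge0 ha.
have ip := tensor_integrable d a0 ia.
rewrite (slice_cfubini (f := fun x => \prod_j f j (x 0 j))
  (b := fun y : 'rV[R]_d => \prod_j a (y 0 j)) (mp _ _ mf) ia ip); last first.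
  by move=> x y; apply: le_trans (bp _ _ _ fa) _; rewrite prod_rcons0.
have igd : cintegrable (tleb d)
    (fun y => \prod_j f (lift ord0 j) (rowt y 0 j)).
  apply: (cintegrable_bound ip); first by apply: (mp _ (fun j => f (lift ord0 j))) => j; exact: mf.
  by move=> y; apply: (bp _ (fun j => f (lift ord0 j))) => j s; exact: fa.
rewrite big_ord_recl -(IH (fun j => f (lift ord0 j)))// mulrC -cintZ; last first.
  exact: (cintegrable_bound ia (mf ord0) (fa ord0)).
apply: eq_cint => x; rewrite mulrC -cintZ//; apply: eq_cint => y.
rewrite big_ord_recl rcons00; congr (_ * _).
by apply: eq_bigr => j _; rewrite rcons0S.
Qed.

Lemma dotpC d (x y : 'rV[R]_d) : dotp x y = dotp y x.
Proof. by apply: eq_bigr => j _; rewrite mulrC. Qed.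

Lemma dotpBr d (x y z : 'rV[R]_d) : dotp x (y - z) = dotp x y - dotp x z.
Proof. by rewrite -sumrB; apply: eq_bigr => j _; rewrite !mxE mulrBr. Qed.

Definition cis (x : R) : R[i] := cexp (Complex 0 x).

Lemma cisD x y : cis (x + y) = cis x * cis y.
Proof. by rewrite /cis -cexpD; congr cexp; apply: complex_eq; rewrite ?ReD ?ImD /= ?addr0. Qed.

Lemma cis_sum I (r : seq I) (F : I -> R) :
  cis (\sum_(i <- r) F i) = \prod_(i <- r) cis (F i).
Proof.
apply: (big_morph cis cisD); rewrite /cis -[RHS]cexp0; congr cexp.
Qed.

Lemma cabs_cis x : cabs (cis x) = 1.
Proof. exact: cabs_cexp_i. Qed.

Lemma cmeasurable_cis d (T : measurableType d) (h : T -> R) :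
  measurable_fun setT h -> cmeasurable (fun x => cis (h x)).
Proof. by move=> mh; apply: cmeasurable_cexp; split => //=; exact: measurable_cst. Qed.

Lemma measurable_bigsum d (T : measurableType d) I (r : seq I) (F : I -> T -> R) :
  (forall i, measurable_fun setT (F i)) ->
  measurable_fun setT (fun x => \sum_(i <- r) F i x).
Proof. by move=> mF; exact: measurable_sum. Qed.

End ComplexSlices.

Section Inversion.
Context {R : realType} (d : nat).
Local Notation Rm := (measurableTypeR R).
Local Notation leb := (@lebesgue_measure R).
Implicit Types (g : 'rV[R]_d -> R) (a : 'rV[R]_d).

Definition fhat g (xi : 'rV[R]_d) : R[i] :=
  cint (tleb d) (fun y => (g (rowt y))%:C%C * cis (- dotp (rowt y) xi)).

Lemma inv_fourierE g xi : inv_fourier (fun y => (g y)%:C%C) xi =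
  (((2 * pi) ^+ d)^-1)%:C%C * fhat g xi.
Proof. by rewrite /inv_fourier cintegralE. Qed.

Lemma measurable_dotp d' (T : measurableType d') (u v : T -> 'rV[R]_d) :
  (forall j, measurable_fun setT (fun x => u x 0 j)) ->
  (forall j, measurable_fun setT (fun x => v x 0 j)) ->
  measurable_fun setT (fun x => dotp (u x) (v x)).
Proof. by move=> mu mv; apply: measurable_bigsum => j; exact: measurable_funM. Qed.

Lemma cint_abel_tensor (delta : R) (x : 'rV[R]_d) : 0 < delta ->
  cint (tleb d) (fun xi =>
    (\prod_j expR (- (delta * `|rowt xi 0 j|)))%:C%C * cis (dotp (rowt xi) x)) =
  (\prod_j (2 * delta / (delta ^+ 2 + x 0 j ^+ 2)))%:C%C.
Proof.
move=> d0; pose f (j : 'I_d) (s : R) :=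
  (expR (- (delta * `|s|)))%:C%C * cis (s * x 0 j).
transitivity (\prod_j cint leb (f j)); last first.
  by rewrite rmorph_prod; apply: eq_bigr => j _; exact: cint_abel.
rewrite -(@cint_tensor _ _ f (fun s => expR (- (delta * `|s|)))).
- by apply: eq_cint => xi; rewrite rmorph_prod cis_sum -big_split.
- by move=> s; exact: expR_ge0.
- exact: integrable_abel.
- move=> j; apply: cmeasurableM.
    apply: cmeasurable_real; exact: integrable_measurable (integrable_abel d0).
  apply: cmeasurable_cis; exact: measurable_funM.
- by move=> j s; rewrite cabsM cabs_cis mulr1 cabs_real ger0_norm ?expR_ge0.
Qed.

End Inversion.

Section InversionTheorem.
Context {R : realType} (d : nat).
Local Notation Rm := (measurableTypeR R).
Local Notation leb := (@lebesgue_measure R).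
Variables (g : 'rV[R]_d -> R) (C C' : R).
Hypothesis cg : continuous g.
Hypothesis g0 : forall x, 0 <= g x.
Hypothesis gC : forall x, g x <= C * lorentz x.

Let damp (delta : R) (x : 'rV[R]_d) : R := \prod_j expR (- (delta * `|x 0 j|)).

Let damp_ge0 delta x : 0 <= damp delta x.
Proof. by apply: prodr_ge0 => j _; exact: expR_ge0. Qed.

Let damp_le1 delta x : 0 < delta -> damp delta x <= 1.
Proof.
move=> d0; apply: (@le_trans _ _ (\prod_(j < d) (1 : R))); last by rewrite big1.
apply: ler_prod => j _; rewrite expR_ge0 -expR0 ler_expR oppr_le0.
by rewrite mulr_ge0// ltW.
Qed.

Let mdamp delta : measurable_fun setT (fun x : d.-tuple Rm => damp delta (rowt x)).
Proof.
apply: continuous_measurable_rowt; apply: continuous_bigprod => j x.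
apply: (@continuous_comp _ _ _ (fun x : 'rV[R]_d => x 0 j)
  (fun s => expR (- (delta * `|s|)))); first exact: coord_continuous.
apply: (@continuous_comp _ _ _ (fun s => - (delta * `|s|)) expR);
  last exact: continuous_expR.
by apply: cvgN; apply: cvgMl_tmp; exact: norm_continuous.
Qed.

Let idamp delta : 0 < delta ->
  (tleb d).-integrable setT (EFin \o (fun x : d.-tuple Rm => damp delta (rowt x))).
Proof.
move=> d0; apply: (@tensor_integrable _ _ (fun s => expR (- (delta * `|s|)))).
  by move=> s; exact: expR_ge0.
exact: integrable_abel.
Qed.

Let C0 : 0 <= C.
Proof.
rewrite -(pmulr_lge0 _ (lorentz_gt0 (0 : 'rV[R]_d))).
exact: le_trans (g0 0) (gC 0).
Qed.

Let mg : measurable_fun setT (fun x : d.-tuple Rm => g (rowt x)).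
Proof. exact: continuous_measurable_rowt. Qed.

Let ig : (tleb d).-integrable setT (EFin \o (fun x : d.-tuple Rm => g (rowt x))).
Proof.
apply: integrable_bound (integrable_lorentzZ d C) mg _ => x.
by rewrite ger0_norm.
Qed.

Lemma fhat_integrand xi : cintegrable (tleb d)
  (fun y => (g (rowt y))%:C%C * cis (- dotp (rowt y) xi)).
Proof.
apply: (cintegrable_bound ig).
  apply: cmeasurableM; first exact: cmeasurable_real.
  apply: cmeasurable_cis; apply: measurableT_comp => //.
  by apply: measurable_dotp => j; [exact: measurable_coord|exact: measurable_cst].
by move=> y; rewrite cabsM cabs_cis mulr1 cabs_real ger0_norm.
Qed.

Section Smoothed.
Variables (a : 'rV[R]_d) (delta : R).
Hypothesis d0 : 0 < delta.

Let G (z : d.-tuple Rm * d.-tuple Rm) : R[i] :=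
  (damp delta (rowt z.1))%:C%C * cis (dotp (rowt z.1) a) *
  ((g (rowt z.2))%:C%C * cis (- dotp (rowt z.2) (rowt z.1))).

Let mG : cmeasurable G.
Proof.
have m1 j : measurable_fun setT (fun z : d.-tuple Rm * d.-tuple Rm => rowt z.1 0 j : R).
  exact: (measurableT_comp (measurable_coord j)).
have m2 j : measurable_fun setT (fun z : d.-tuple Rm * d.-tuple Rm => rowt z.2 0 j : R).
  exact: (measurableT_comp (measurable_coord j)).
apply: cmeasurableM; apply: cmeasurableM.
- by apply: cmeasurable_real; exact: (measurableT_comp (mdamp delta)).
- apply: cmeasurable_cis; apply: measurable_dotp => //.
- by apply: cmeasurable_real; exact: (measurableT_comp mg).
- apply: cmeasurable_cis; apply: measurableT_comp => //.
  exact: measurable_dotp.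
Qed.

Let Gb x y : cabs (G (x, y)) <= damp delta (rowt x) * g (rowt y).
Proof.
by rewrite /G !(cabs_cis, cabsM) !mulr1 !cabs_real /= !ger0_norm.
Qed.

Let GE1 x : cint (tleb d) (fun y => G (x, y)) =
  (damp delta (rowt x))%:C%C * cis (dotp (rowt x) a) * fhat g (rowt x).
Proof. by rewrite /fhat -cintZ//; exact: fhat_integrand. Qed.

Let GE2 y : cint (tleb d) (fun x => G (x, y)) =
  (g (rowt y) * \prod_j (2 * delta / (delta ^+ 2 + (a - rowt y) 0 j ^+ 2)))%:C%C.
Proof.
rewrite rmorphM /= -(cint_abel_tensor _ d0) -cintZ; last first.
  apply: (cintegrable_bound (idamp d0)).
    apply: cmeasurableM; first by apply: cmeasurable_real; exact: mdamp.
    apply: cmeasurable_cis; apply: measurable_dotp => j; first exact: measurable_coord.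
    exact: measurable_cst.
  by move=> x; rewrite cabsM cabs_cis mulr1 cabs_real ger0_norm ?damp_ge0.
apply: eq_cint => x; rewrite /G /= dotpBr cisD [dotp (rowt y) _]dotpC.
set A := _%:C%C; set B := _%:C%C; set A' := cis _; set B' := cis _; ring.
Qed.

(** The transform is a partial integral of the dominated function G, divided
    by a factor that does not vanish. *)
Lemma cmeasurable_fhat :
  cmeasurable (fun x => fhat g (rowt x)).
Proof.
have [i1 _] := dominated_cfubini1 mG (idamp d0) ig Gb.
have -> : (fun x => fhat g (rowt x)) = (fun x =>
    ((damp delta (rowt x))^-1)%:C%C * cis (- dotp (rowt x) a) *
    cint (tleb d) (fun y => G (x, y))).
  apply/funext => x; rewrite GE1; set D := damp _ _; set th := dotp _ _.
  have p0 : D != 0 by rewrite gt_eqF// prodr_gt0// => j _; exact: expR_gt0.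
  have E1 : (D^-1)%:C%C * D%:C%C = 1 :> R[i] by rewrite -rmorphM mulVf.
  have E2 : cis (- th) * cis th = 1 by rewrite -cisD addNr /cis cexp0.
  by rewrite mulrA [X in X * _]mulrACA E1 E2 !mul1r.
apply: cmeasurableM; last exact: cintegrable_measurable i1.
apply: cmeasurableM.
  apply: cmeasurable_real; rewrite (_ : (fun x => _) =
    fun x : d.-tuple Rm => expR (\sum_j delta * `|rowt x 0 j|)).
    apply: measurableT_comp => //; apply: measurable_bigsum => j.
    apply: measurable_funM => //; apply: measurableT_comp => //.
    exact: measurable_coord.
  apply/funext => x; rewrite expR_sum /damp -prodfV; apply: eq_bigr => j _.
  by rewrite expRN invrK.
apply: cmeasurable_cis; apply: measurableT_comp => //; apply: measurable_dotp => j.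
  exact: measurable_coord.
exact: measurable_cst.
Qed.

(** By Fubini the damped integral is the integral of g against a product of
    Poisson kernels of width delta around a. *)
Lemma inversion_smoothed :
  cint (tleb d) (fun x => (damp delta (rowt x))%:C%C * cis (dotp (rowt x) a) *
     fhat g (rowt x)) =
  (2 ^+ d * \int[tleb d]_u (g (a + delta *: rowt u) * lorentz (rowt u)))%:C%C.
Proof.
have [_ e1] := dominated_cfubini1 mG (idamp d0) ig Gb.
have [_ e2] := dominated_cfubini2 mG (idamp d0) ig Gb.
transitivity (cint (tleb d) (fun x => cint (tleb d) (fun y => G (x, y)))).
  by apply: eq_cint => x; rewrite GE1.
rewrite e1 -e2; under eq_fun do rewrite GE2.
rewrite cint_real; congr (_%:C%C).
pose F (y : 'rV[R]_d) := g y * \prod_j (2 * delta / (delta ^+ 2 + (a - y) 0 j ^+ 2)).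
have cP : continuous (fun y : 'rV[R]_d =>
    \prod_j (2 * delta / (delta ^+ 2 + (a - y) 0 j ^+ 2))).
  apply: continuous_bigprod => j.
  have -> : (fun y : 'rV[R]_d => 2 * delta / (delta ^+ 2 + (a - y) 0 j ^+ 2)) =
    (fun s => 2 * delta / (delta ^+ 2 + (a 0 j - s) ^+ 2)) \o (fun y => y 0 j).
    by apply/funext => y /=; rewrite !mxE.
  move=> y; apply: (@continuous_comp _ _ _ (fun y : 'rV[R]_d => y 0 j)
    (fun s => 2 * delta / (delta ^+ 2 + (a 0 j - s) ^+ 2))).
    exact: coord_continuous.
  apply: cvgMl_tmp; apply: cvgV.
    by rewrite gt_eqF// ltr_pwDl ?exprn_gt0 ?sqr_ge0.
  apply: cvgD; first exact: cvg_cst.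
  apply: (@continuous_comp _ _ _ (fun s => a 0 j - s) (fun s => s ^+ 2)).
    by apply: cvgB; [exact: cvg_cst|exact: cvg_id].
  exact: exprn_continuous.
have cF : continuous F.
  by move=> y; exact: (continuousM (@cg y) (cP y)).
have F0 y : 0 <= F y.
  rewrite mulr_ge0// prodr_ge0// => j _.
  by rewrite divr_ge0 ?mulr_ge0 ?addr_ge0 ?sqr_ge0// ltW.
rewrite -[LHS]/(\int[tleb d]_y F (rowt y)).
have FE u : F (a + delta *: u) = (2 / delta) ^+ d * (g (a + delta *: u) * lorentz u).
  rewrite /F mulrCA; congr (_ * _).
  have -> : (2 / delta) ^+ d = \prod_(j < d) (2 / delta) by rewrite prodr_const card_ord.
  rewrite /lorentz -big_split.
  apply: eq_bigr => j _; rewrite !mxE opprD addrA subrr add0r sqrrN exprMn /lorentz1 /=.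
  have u1 : 1 + u 0 j ^+ 2 != 0 by rewrite gt_eqF// ltr_pwDl ?sqr_ge0.
  have u2 : delta ^+ 2 + (delta * u 0 j) ^+ 2 != 0.
    rewrite exprMn.
    by rewrite -[X in X + _]mulr1 -mulrDr mulf_neq0// expf_neq0// gt_eqF.
  by field; rewrite u1 u2 gt_eqF.
rewrite /Rintegral (affine_integral a d0 cF F0).
rewrite (_ : (\int[tleb d]_x (F (a + delta *: rowt x))%:E =
  \int[tleb d]_x (((2 / delta) ^+ d)%:E *
    (g (a + delta *: rowt x) * lorentz (rowt x))%:E))%E); last first.
  by apply: eq_integral => u _; rewrite FE EFinM.
have cga : continuous (fun u : 'rV[R]_d => g (a + delta *: u) * lorentz u).
  have c1 : continuous (fun u : 'rV[R]_d => g (a + delta *: u)).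
    move=> u.
    apply: (@continuous_comp _ _ _ (fun x : 'rV[R]_d => a + delta *: x) g); last exact: cg.
    exact: (continuousD (@cst_continuous _ _ a u) (@scaler_continuous _ _ delta u)).
  by move=> u; exact: (continuousM (c1 u) (@continuous_lorentz R d u)).
have mga := continuous_measurable_rowt cga.
have p2 : 0 <= (2 / delta) ^+ d by rewrite exprn_ge0// divr_ge0// ltW.
rewrite ge0_integralZl//; last 2 first.
- exact/measurable_EFinP.
- by move=> u _; rewrite lee_fin mulr_ge0// ltW ?lorentz_gt0.
have iga : (tleb d).-integrable setT
    (EFin \o (fun u : d.-tuple Rm => g (a + delta *: rowt u) * lorentz (rowt u))).
  apply: integrable_bound (integrable_lorentzZ d C) mga _ => u.
  rewrite ger0_norm ?mulr_ge0 ?(ltW (lorentz_gt0 _))// ler_wpM2r ?(ltW (lorentz_gt0 _))//.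
  by rewrite (le_trans (gC _))// ler_piMr ?lorentz_le1.
rewrite muleA -EFinM fineM//; last exact: integrable_fin_num iga.
by congr (_ * _); rewrite -exprMn mulrC divfK// gt_eqF.
Qed.
End Smoothed.

(** Fourier inversion at a point. The transform is damped by Abel's factors
    exp (- |xi_j| / n); by Fubini the damped integral is an average of g
    against the Poisson kernel, which concentrates at the point. *)
Lemma fourier_inversion (a : 'rV[R]_d) :
  (forall xi, cabs (fhat g xi) <= C' * lorentz xi) ->
  cint (tleb d) (fun x => cis (dotp (rowt x) a) * fhat g (rowt x)) =
  ((2 * pi) ^+ d * g a)%:C%C.
Proof.
move=> gh; pose dl (n : nat) : R := n.+1%:R^-1.
have dl0 n : 0 < dl n by rewrite invr_gt0.
have mh := cmeasurable_fhat 0 (dl0 0%N).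
have mc : cmeasurable (fun x : d.-tuple Rm => cis (dotp (rowt x) a)).
  apply: cmeasurable_cis; apply: measurable_dotp => j; first exact: measurable_coord.
  exact: measurable_cst.
have dlc : dl @ \oo --> (0 : R) by exact: cvg_harmonic.
have L : (fun n => cabs (cint (tleb d) (fun x => (damp (dl n) (rowt x))%:C%C *
    cis (dotp (rowt x) a) * fhat g (rowt x)) -
    cint (tleb d) (fun x => cis (dotp (rowt x) a) * fhat g (rowt x)))) @ \oo --> (0 : R).
  apply: (cint_cvg_dominated (h := fun x => C' * lorentz (rowt x))).
  - move=> n; apply: cmeasurableM => //; apply: cmeasurableM => //.
    by apply: cmeasurable_real; exact: mdamp.
  - exact: cmeasurableM.
  - move=> x; set z := cis _ * fhat _ _.
    apply: (@squeeze_cvgr _ _ _ _ (fun=> 0)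
      (fun n => (1 - damp (dl n) (rowt x)) * cabs z)).
    + apply: nearW => n; rewrite cabs_ge0 -mulrA -/z -[X in _ - X]mul1r -mulrBl cabsM.
      rewrite -(rmorph1 (real_complex R)) -rmorphB cabs_real distrC.
      by rewrite ger0_norm ?lexx// subr_ge0 damp_le1.
    + exact: cvg_cst.
    + rewrite -[X in _ --> X](mul0r (cabs z)); apply: cvgMr_tmp.
      rewrite -[X in _ --> X](subrr 1); apply: cvgB; first exact: cvg_cst.
      have -> : (1 : R) = (fun e : R => damp e (rowt x)) 0.
        by rewrite /damp big1// => j _; rewrite mul0r oppr0 expR0.
      have cd : continuous (fun e : R => damp e (rowt x)).
        apply: (@continuous_bigprod R R _ _ (fun (j : 'I_d) e =>
          expR (- (e * `|rowt x 0 j|)))) => j e.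
        apply: (@continuous_comp R R R (fun e => - (e * `|rowt x 0 j|)) expR);
          last exact: continuous_expR.
        by apply: cvgN; apply: cvgMr_tmp; exact: cvg_id.
      exact: (cvg_comp dl _ dlc (cd 0)).
  - exact: integrable_lorentzZ.
  - move=> n x; rewrite cabsM cabsM [X in _ * X * _]cabs_cis mulr1 cabs_real ger0_norm//.
    apply: (le_trans _ (gh _)); rewrite ler_piMl ?cabs_ge0 ?damp_le1//.
have RL : (fun n => cabs (cint (tleb d) (fun u => (g (a + dl n *: rowt u) *
     lorentz (rowt u))%:C%C) - cint (tleb d) (fun u => (g a * lorentz (rowt u))%:C%C)))
     @ \oo --> (0 : R).
  have cgl : continuous (fun u : 'rV[R]_d => lorentz u) by exact: continuous_lorentz.
  apply: (cint_cvg_dominated (h := fun x => C * lorentz (rowt x))).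
  - move=> n; apply: cmeasurable_real; apply: measurable_funM; last first.
      exact: continuous_measurable_rowt.
    apply: (@continuous_measurable_rowt _ _ (fun u => g (a + dl n *: u))) => u.
    apply: (@continuous_comp _ _ _ (fun x : 'rV[R]_d => a + dl n *: x) g); last exact: cg.
    exact: (continuousD (@cst_continuous _ _ a u) (@scaler_continuous _ _ (dl n) u)).
  - apply: cmeasurable_real; apply: measurable_funM => //.
    exact: continuous_measurable_rowt.
  - move=> u.
    have -> : (fun n => cabs ((g (a + dl n *: rowt u) * lorentz (rowt u))%:C%C -
      (g a * lorentz (rowt u))%:C%C)) =
      (fun n => `|g (a + dl n *: rowt u) - g a| * lorentz (rowt u)).
      apply/funext => n; rewrite -rmorphB -mulrBl cabs_real normrM.
      by rewrite (ger0_norm (ltW (lorentz_gt0 _))).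
    rewrite -[X in _ --> X](mul0r (lorentz (rowt u))); apply: cvgMr_tmp.
    apply/norm_cvg0P; apply/subr_cvg0.
    have c1 : (fun n => a + dl n *: rowt u) @ \oo --> a.
      rewrite -[X in _ --> X]addr0 -(scale0r (rowt u)).
      by apply: cvgD; [exact: cvg_cst|exact: cvgZr_tmp].
    exact: (cvg_comp _ _ c1 (@cg a)).
  - exact: integrable_lorentzZ.
  - move=> n u; rewrite cabs_real ger0_norm ?mulr_ge0 ?(ltW (lorentz_gt0 _))//.
    rewrite ler_wpM2r ?(ltW (lorentz_gt0 _))//.
    by rewrite (le_trans (gC _))// ler_piMr ?lorentz_le1.
set A := cint _ _ in L *.
suff: cabs (((2 * pi) ^+ d * g a)%:C%C - A) = 0.
  by move=> /cabs_eq0 /eqP; rewrite subr_eq0 => /eqP.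
have -> : ((2 * pi) ^+ d * g a)%:C%C =
    (2 ^+ d)%:C%C * cint (tleb d) (fun u => (g a * lorentz (rowt u))%:C%C).
  rewrite cint_real RintegralZl//; last exact: integrable_lorentz.
  by rewrite integral_lorentz -rmorphM exprMn mulrA mulrAC.
apply/eqP; rewrite eq_le cabs_ge0 andbT; apply/ler_addgt0Pl => e e0; rewrite addr0.
have e2 : 0 < e / 2 by rewrite divr_gt0.
have e3 : 0 < e / 2 / 2 ^+ d by rewrite divr_gt0// exprn_gt0.
have [n [n1 n2]] : exists n, cabs (cint (tleb d) (fun x => (damp (dl n) (rowt x))%:C%C *
    cis (dotp (rowt x) a) * fhat g (rowt x)) - A) <= e / 2 /\
    cabs (cint (tleb d) (fun u => (g (a + dl n *: rowt u) *
     lorentz (rowt u))%:C%C) - cint (tleb d) (fun u => (g a * lorentz (rowt u))%:C%C))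
    <= e / 2 / 2 ^+ d.
  have /cvgr0_norm_le/(_ _ e2) h1 := L; have /cvgr0_norm_le/(_ _ e3) h2 := RL.
  have : \forall n \near \oo, cabs (cint (tleb d) (fun x => (damp (dl n) (rowt x))%:C%C *
    cis (dotp (rowt x) a) * fhat g (rowt x)) - A) <= e / 2 /\
    cabs (cint (tleb d) (fun u => (g (a + dl n *: rowt u) *
     lorentz (rowt u))%:C%C) - cint (tleb d) (fun u => (g a * lorentz (rowt u))%:C%C))
    <= e / 2 / 2 ^+ d.
    near=> n; split.
      by rewrite -[leLHS]ger0_norm ?cabs_ge0//; near: n; exact: h1.
    by rewrite -[leLHS]ger0_norm ?cabs_ge0//; near: n; exact: h2.
  by move=> /filter_ex.
rewrite (inversion_smoothed _ (dl0 n)) in n1.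
rewrite cint_real in n2.
set I := \int[_]_u _ in n1; rewrite -/I in n2.
have -> : forall B, (2 ^+ d)%:C%C * B - A = ((2 ^+ d * I)%:C%C - A) - (2 ^+ d)%:C%C * (I%:C%C - B).
  by move=> B; rewrite rmorphM; ring.
rewrite (le_trans (cabsB _ _))// [leRHS]splitr lerD// cabsM cabs_real ger0_norm ?exprn_ge0//.
by rewrite mulrC -ler_pdivlMr ?exprn_gt0.
Unshelve. all: by end_near. Qed.

End InversionTheorem.

(** * Decay of the Fourier transform of exp (- polynomial) *)
Section PolynomialExpressions.
Context {R : realType} (d : nat).
Implicit Types (eps : R) (u : 'rV[R]_d) (j : 'I_d).

(** Polynomials in a scaling parameter and the coordinates of a vector are kept
    as syntax: derivatives of any order, and bounds uniform in the parameter,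
    then follow by induction. *)
Inductive pexp :=
| PCst of R
| PEps
| PVar of 'I_d
| PAdd of pexp & pexp
| PMul of pexp & pexp.

Fixpoint peval (e : pexp) eps u : R :=
  match e with
  | PCst c => c
  | PEps => eps
  | PVar j => u 0 j
  | PAdd a b => peval a eps u + peval b eps u
  | PMul a b => peval a eps u * peval b eps u
  end.

Fixpoint pderiv j (e : pexp) : pexp :=
  match e with
  | PCst _ | PEps => PCst 0
  | PVar k => PCst (k == j)%:R
  | PAdd a b => PAdd (pderiv j a) (pderiv j b)
  | PMul a b => PAdd (PMul (pderiv j a) b) (PMul a (pderiv j b))
  end.

Lemma is_derive_peval (e : pexp) j eps u (s : R) :
  is_derive s (1 : R) (fun v => peval e eps (setc j u v)) (peval (pderiv j e) eps (setc j u s)).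
Proof.
elim: e => [c||k|a IHa b IHb|a IHa b IHb] /=.
- exact: is_derive_cst.
- exact: is_derive_cst.
- have -> : (fun v : R => setc j u v 0 k) = if k == j then id else cst (u 0 k).
    by apply/funext => v; rewrite mxE; case: ifP.
  by case: eqP => _; [exact: is_derive_id|exact: is_derive_cst].
- exact: is_deriveD.
- apply: is_derive_eq; rewrite /GRing.scale /=; ring.
Qed.

Lemma continuous_peval (e : pexp) eps : continuous (peval e eps).
Proof.
elim: e => [c||k|a IHa b IHb|a IHa b IHb] /=.
- exact: cst_continuous.
- exact: cst_continuous.
- exact: coord_continuous.
- by move=> u; exact: (continuousD (IHa u) (IHb u)).
- by move=> u; exact: (continuousM (IHa u) (IHb u)).
Qed.

Lemma peval_bound (e : pexp) : exists (C : R) (k : nat), 0 <= C /\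
  forall eps u, 0 <= eps <= 1 -> `|peval e eps u| <= C * (1 + `|u|) ^+ k.
Proof.
have p1 u k : 1 <= (1 + `|u|) ^+ k by rewrite exprn_ege1// lerDl.
elim: e => [c||k|a [C1 [k1 [C10 h1]]] b [C2 [k2 [C20 h2]]]|a [C1 [k1 [C10 h1]]] b [C2 [k2 [C20 h2]]]] /=.
- by exists `|c|, 0%N; split=> // eps u _; rewrite expr0 mulr1.
- exists 1, 0%N; split=> // eps u /andP[e0 e1]; by rewrite expr0 mulr1 ger0_norm.
- exists 1, 1%N; split=> // eps u _; rewrite expr1 mul1r.
  by rewrite (le_trans (norm_coord u k))// lerDr.
- exists (C1 + C2), (k1 + k2)%N; split; first exact: addr_ge0.
  move=> eps u e01; rewrite (le_trans (ler_normD _ _))// mulrDl.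
  rewrite exprD lerD// (le_trans (h1 _ _ e01), le_trans (h2 _ _ e01))//.
    by rewrite ler_wpM2l// ler_peMr// (le_trans _ (p1 u k1)).
  by rewrite ler_wpM2l// ler_peMl// (le_trans _ (p1 u k2)).
- exists (C1 * C2), (k1 + k2)%N; split; first exact: mulr_ge0.
  move=> eps u e01; rewrite normrM exprD mulrACA.
  by apply: ler_pM => //; [exact: h1|exact: h2].
Qed.

Definition pexp_sum (I : Type) (r : seq I) (F : I -> pexp) : pexp :=
  foldr (fun i e => PAdd (F i) e) (PCst 0) r.
Definition pexp_prod (I : Type) (r : seq I) (F : I -> pexp) : pexp :=
  foldr (fun i e => PMul (F i) e) (PCst 1) r.

Lemma peval_sum (I : Type) (r : seq I) (F : I -> pexp) eps u :
  peval (pexp_sum r F) eps u = \sum_(i <- r) peval (F i) eps u.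
Proof. by elim: r => [|i r IH]; rewrite ?big_nil ?big_cons//= IH. Qed.

Lemma peval_prod (I : Type) (r : seq I) (F : I -> pexp) eps u :
  peval (pexp_prod r F) eps u = \prod_(i <- r) peval (F i) eps u.
Proof. by elim: r => [|i r IH]; rewrite ?big_nil ?big_cons//= IH. Qed.

Lemma peval_exp (e : pexp) n eps u :
  peval (iter n (PMul e) (PCst 1)) eps u = peval e eps u ^+ n.
Proof. by elim: n => [|n IH] //=; rewrite exprS IH. Qed.

End PolynomialExpressions.

Section Weights.
Context {R : realType} (d : nat).
Implicit Types (u : 'rV[R]_d).

Lemma pow_expR_bound (k : nat) : exists C : R, 0 <= C /\
  forall r : R, 0 <= r -> (1 + r) ^+ k * expR (- r) <= C.
Proof.
exists (expR 1 * k%:R ^+ k); split; first by rewrite mulr_ge0 ?expR_ge0 ?exprn_ge0.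
move=> r r0; case: k => [|k].
  rewrite !expr0 mul1r mulr1; apply: (@le_trans _ _ 1).
    by rewrite -expR0 ler_expR oppr_le0.
  by rewrite -expR0 ler_expR.
have k0 : 0 < k.+1%:R :> R by [].
rewrite expRN ler_pdivrMr ?expR_gt0// mulrAC -expRD -ler_pdivrMr ?exprn_gt0//.
rewrite -expr_div_n -[1 + r](divfK (lt0r_neq0 k0)) [X in _ <= expR X]mulrC expRM_natl.
rewrite mulfK ?lt0r_neq0// lerXn2r// ?nnegrE ?divr_ge0 ?addr_ge0 ?expR_ge0//.
by apply: le_trans (expR_ge1Dx _); rewrite lerDr.
Qed.

Lemma lorentz_lower u : ((1 + `|u|) ^+ (2 * d))^-1 <= lorentz u.
Proof.
have -> : ((1 + `|u|) ^+ (2 * d))^-1 = \prod_(j < d) ((1 + `|u|) ^+ 2)^-1.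
  by rewrite prodr_const card_ord exprVn exprM.
apply: ler_prod => j _; rewrite invr_ge0 exprn_ge0 ?addr_ge0//=.
rewrite lef_pV2 ?posrE ?exprn_gt0 ?ltr_pwDl ?sqr_ge0//.
have := norm_coord u j; rewrite -[u 0 j ^+ 2]real_normK ?num_real//.
have := normr_ge0 (u 0 j); nra.
Qed.

Lemma lorentz_scale (eps : R) u : 0 < eps <= 1 ->
  lorentz (eps *: u) <= (eps ^+ (2 * d))^-1 * lorentz u.
Proof.
move=> /andP[e0 e1].
have -> : (eps ^+ (2 * d))^-1 = \prod_(j < d) (eps ^+ 2)^-1.
  by rewrite prodr_const card_ord exprVn exprM.
rewrite /lorentz -big_split; apply: ler_prod => j _; rewrite ltW ?lorentz1_gt0//=.
rewrite /lorentz1 mxE -invfM lef_pV2 ?posrE ?ltr_pwDl ?sqr_ge0//; last first.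
  by rewrite mulr_gt0 ?exprn_gt0// ltr_pwDl ?sqr_ge0.
by rewrite mulrDr mulr1 exprMn lerD2r exprn_ile1// ltW.
Qed.

End Weights.

Section FourierPartial.
Context {R : realType} (d : nat).
Local Notation Rm := (measurableTypeR R).

Lemma continuous_scale (T : topologicalType) (a : R) (f : T -> R) :
  continuous f -> continuous (fun x => a * f x).
Proof. by move=> cf x; apply: cvgMl_tmp; exact: cf. Qed.

Lemma continuous_mul (T : topologicalType) (f h : T -> R) :
  continuous f -> continuous h -> continuous (fun x => f x * h x).
Proof. by move=> cf ch x; exact: (continuousM (cf x) (ch x)). Qed.

Lemma continuous_add (T : topologicalType) (f h : T -> R) :
  continuous f -> continuous h -> continuous (fun x => f x + h x).
Proof. by move=> cf ch x; exact: (continuousD (cf x) (ch x)). Qed.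

Lemma continuous_dotp (xi : 'rV[R]_d) : continuous (fun y : 'rV[R]_d => dotp y xi).
Proof.
apply: (@continuous_bigsum R 'rV[R]_d _ _ (fun j y => y 0 j * xi 0 j)) => j y.
exact: (continuousM (@coord_continuous R 1 d 0 j y) (@cst_continuous _ _ (xi 0 j) y)).
Qed.

Lemma is_derive_dotp j (y xi : 'rV[R]_d) (s : R) :
  is_derive s (1 : R) (fun v => dotp (setc j y v) xi) (xi 0 j).
Proof.
have -> : (fun v => dotp (setc j y v) xi) =
    fun v => v * xi 0 j + \sum_(k < d | k != j) y 0 k * xi 0 k.
  apply/funext => v; rewrite /dotp (bigD1 j)//= mxE eqxx; congr (_ + _).
  by apply: eq_bigr => k /negPf kj; rewrite mxE kj.
by apply: is_derive_eq; rewrite /GRing.scale /=; ring.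
Qed.

Variables (G G' : 'rV[R]_d -> R) (C : R) (j : 'I_d).
Hypothesis cG : continuous G.
Hypothesis cG' : continuous G'.
Hypothesis dG : forall x (s : R),
  is_derive s (1 : R) (fun v => G (setc j x v)) (G' (setc j x s)).
Hypothesis GC : forall x, `|G x| <= C * lorentz x.
Hypothesis G'C : forall x, `|G' x| <= C * lorentz x.

(** Integration by parts multiplies the transform by i xi_j. *)
Lemma cabs_fhat_partial (xi : 'rV[R]_d) :
  cabs (fhat G' xi) = `|xi 0 j| * cabs (fhat G xi).
Proof.
pose th (y : 'rV[R]_d) := - dotp y xi.
have cth : continuous th.
  by move=> y; exact: (continuousN (@continuous_dotp xi y)).
have dth (x : 'rV[R]_d) (s : R) :
    is_derive s (1 : R) (fun v => th (setc j x v)) (- xi 0 j).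
  by have := is_derive_dotp j x xi s => h; exact: is_deriveN.
have ccos : continuous (fun y => cos (th y)).
  by move=> y; apply: (@continuous_comp _ _ _ th cos); [exact: cth|exact: continuous_cos].
have csin : continuous (fun y => sin (th y)).
  by move=> y; apply: (@continuous_comp _ _ _ th sin); [exact: cth|exact: continuous_sin].
have cos1 (y : 'rV[R]_d) : `|cos (th y)| <= 1 by rewrite ler_norml cos_geN1 cos_le1.
have sin1 (y : 'rV[R]_d) : `|sin (th y)| <= 1 by rewrite ler_norml sin_geN1 sin_le1.
have C0 : 0 <= C.
  rewrite -(pmulr_lge0 _ (lorentz_gt0 (0 : 'rV[R]_d))).
  exact: le_trans (normr_ge0 _) (GC 0).
have ibd (H f : 'rV[R]_d -> R) : continuous H -> continuous f ->
    (forall y, `|f y| <= 1) -> (forall x, `|H x| <= C * lorentz x) ->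
    (tleb d).-integrable setT (EFin \o (fun y : d.-tuple Rm => H (rowt y) * f (rowt y))).
  move=> cH cf f1 HC; apply: integrable_bound (integrable_lorentzZ d C) _ _.
    by apply: measurable_funM; exact: continuous_measurable_rowt.
  move=> y; rewrite normrM (le_trans _ (HC (rowt y)))// ler_piMr//.
have xi1 : 1 <= 1 + `|xi 0 j| by rewrite lerDl.
have zero (f f' : 'rV[R]_d -> R) : continuous f -> continuous f' ->
    (forall y, `|f y| <= 1) -> (forall y, `|f' y| <= 1) ->
    (forall x (s : R), is_derive s (1 : R) (fun v => f (setc j x v)) (xi 0 j * f' (setc j x s))) ->
    \int[tleb d]_y (G' (rowt y) * f (rowt y)) = - xi 0 j * \int[tleb d]_y (G (rowt y) * f' (rowt y)).
  move=> cf cf' f1 f'1 df.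
  have := @integral_partial0 _ d j (fun y => G y * f y)
    (fun y => 1 * (G' y * f y) + xi 0 j * (G y * f' y)) ((1 + `|xi 0 j|) * C).
  rewrite Rintegral_lin; [|exact: ibd|exact: ibd].
  rewrite mul1r => h; apply/eqP; rewrite mulNr -subr_eq0 opprK; apply/eqP; apply: h.
  - by apply: continuous_add; apply: continuous_scale; exact: continuous_mul.
  - move=> x s; have := dG x s => h1; have := df x s => h2.
    by apply: is_derive_eq; rewrite /GRing.scale /=; ring.
  - move=> x; rewrite normrM (@le_trans _ _ (C * lorentz x))//.
      by rewrite (le_trans _ (GC x))// ler_piMr.
    by rewrite ler_wpM2r ?(ltW (lorentz_gt0 _))// ler_peMl.
  - move=> x; rewrite mul1r (le_trans (ler_normD _ _))// !normrM -mulrA mulrDl mul1r lerD//.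
      by rewrite (le_trans _ (G'C x))// ler_piMr.
    by rewrite ler_wpM2l// (le_trans _ (GC x))// ler_piMr.
have fhatE (H : 'rV[R]_d -> R) : fhat H xi =
    Complex (\int[tleb d]_y (H (rowt y) * cos (th (rowt y))))
            (\int[tleb d]_y (H (rowt y) * sin (th (rowt y)))).
  apply: complex_eq => /=; apply: eq_Rintegral => y _;
    by rewrite expR0 !(mul0r, subr0, mul1r, addr0, add0r).
have csinN : continuous (fun y => - cos (th y)).
  by move=> y; exact: (continuousN (ccos y)).
have e1 : \int[tleb d]_y (G' (rowt y) * cos (th (rowt y))) =
    - xi 0 j * \int[tleb d]_y (G (rowt y) * sin (th (rowt y))).
  apply: (zero (fun y => cos (th y)) (fun y => sin (th y))) => // x s.
  have := dth x s => h; apply: is_derive_eq; rewrite /GRing.scale /=; ring.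
have e2 : \int[tleb d]_y (G' (rowt y) * sin (th (rowt y))) =
    - xi 0 j * \int[tleb d]_y (G (rowt y) * - cos (th (rowt y))).
  apply: (zero (fun y => sin (th y)) (fun y => - cos (th y))) => // [y|x s].
    by rewrite normrN.
  have := dth x s => h; apply: is_derive_eq; rewrite /GRing.scale /=; ring.
rewrite !fhatE e1 e2.
have -> : \int[tleb d]_y (G (rowt y) * - cos (th (rowt y))) =
    - \int[tleb d]_y (G (rowt y) * cos (th (rowt y))).
  rewrite -mulN1r -RintegralZl//; last by apply: (ibd G (fun y => cos (th y))).
  by apply: eq_Rintegral => y _; rewrite mulrN mulN1r.
set A := \int[_]_y _; set B := \int[_]_y _.
have -> : Complex (- xi 0 j * A) (- xi 0 j * - B) = (xi 0 j)%:C%C * (Complex 0 1 * Complex B A).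
  by apply: complex_eq => /=; ring.
rewrite cabsM cabs_real cabsM.
have -> : cabs (Complex 0 1 : R[i]) = 1 by rewrite /= expr0n /= add0r expr1n sqrtr1.
by rewrite mul1r.
Qed.

Lemma cabs_fhat_le (H : 'rV[R]_d -> R) (B : R) (xi : 'rV[R]_d) : continuous H ->
  (forall x, `|H x| <= B * lorentz x) -> cabs (fhat H xi) <= 2 * (B * pi ^+ d).
Proof.
move=> cH HB; rewrite -integral_lorentz -RintegralZl//; last exact: integrable_lorentz.
apply: cabs_cint; first exact: integrable_lorentzZ.
  apply: cmeasurableM.
    by apply: cmeasurable_real; exact: continuous_measurable_rowt.
  apply: cmeasurable_cis; apply: measurableT_comp => //.
  by apply: measurable_dotp => k; [exact: measurable_coord|exact: measurable_cst].
by move=> y; rewrite cabsM cabs_cis mulr1 cabs_real.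
Qed.

End FourierPartial.

Section Decay.
Context {R : realType} (d : nat).
Variables (w : @pexp R d) (Cw : R).
Hypothesis coercive : forall (eps : R) (u : 'rV[R]_d), 0 < eps <= 1 ->
  `|u| - Cw <= peval w eps u.

(** The function exp (- beta V (phi - y)), for the polynomial w of
    boltz_scaled_potential and eps^pbar = beta. *)
Definition boltz (eps : R) (y : 'rV[R]_d) : R := expR (- peval w eps (eps *: y)).

(** The n-th derivative of exp (- w) in direction j is P j n * exp (- w). *)
Let P (j : 'I_d) (n : nat) : @pexp R d :=
  iter n (fun e => PAdd (pderiv j e) (PMul (PCst _ (-1)) (PMul (pderiv j w) e))) (PCst _ 1).

Let G j n (eps : R) (y : 'rV[R]_d) : R :=
  eps ^+ n * (peval (P j n) eps (eps *: y) * boltz eps y).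

Let setcZ (eps v : R) j (y : 'rV[R]_d) :
  eps *: setc j y v = setc j (eps *: y) (eps * v).
Proof. by apply/rowP => k; rewrite !mxE; case: ifP. Qed.

Let is_derive_scale (e : pexp d) j (eps s : R) (y : 'rV[R]_d) :
  is_derive s (1 : R) (fun v => peval e eps (eps *: setc j y v))
    (eps * peval (pderiv j e) eps (eps *: setc j y s)).
Proof.
have -> : (fun v => peval e eps (eps *: setc j y v)) =
    (fun v => peval e eps (setc j (eps *: y) v)) \o (fun v => eps * v).
  by apply/funext => v /=; rewrite setcZ.
have h := is_derive_peval e j eps (eps *: y) (eps * s).
have h2 : is_derive s (1 : R) (fun v : R => eps * v) eps.
  by apply: is_derive_eq; rewrite [_ *: _]mulr1.
rewrite setcZ; have h3 := @is_derive1_comp _ _ _ _ _ _ h h2.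
by apply: (is_derive_eq h3); rewrite mulrC.
Qed.

Let dG j n (eps : R) x (s : R) :
  is_derive s (1 : R) (fun v => G j n eps (setc j x v)) (G j n.+1 eps (setc j x s)).
Proof.
have h1 := is_derive_scale (P j n) j eps s x.
have h2 := is_derive_scale w j eps s x.
rewrite /G /boltz; apply: is_derive_eq; rewrite /GRing.scale /= exprS; ring.
Qed.

Let cscale (e : pexp d) (eps : R) : continuous (fun y : 'rV[R]_d => peval e eps (eps *: y)).
Proof.
move=> y; apply: (@continuous_comp _ _ _ (fun y : 'rV[R]_d => eps *: y) (peval e eps)).
  exact: scaler_continuous.
exact: continuous_peval.
Qed.

Lemma continuous_boltz eps : continuous (boltz eps).
Proof.
rewrite -[boltz eps]/(expR \o (fun y => - peval w eps (eps *: y))) => y.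
apply: continuous_comp.
  exact: (continuousN (@cscale w eps y)).
exact: continuous_expR.
Qed.

Let cG j n eps : continuous (G j n eps).
Proof.
apply: continuous_scale; apply: continuous_mul; first exact: cscale.
exact: continuous_boltz.
Qed.

(** Each derivative gives a factor eps, and the weight lorentz costs
    eps^(2 d) when it is rescaled. *)
Let Gb j n : exists C : R, 0 <= C /\ forall eps, 0 < eps <= 1 -> forall y,
  `|G j n eps y| <= C * (eps ^+ n / eps ^+ (2 * d)) * lorentz y.
Proof.
have [C1 [k [C10 h1]]] := peval_bound (P j n).
have [C2 [C20 h2]] := @pow_expR_bound R (k + 2 * d).
exists (C1 * expR Cw * C2); split; first by rewrite !mulr_ge0 ?expR_ge0.
move=> eps /[dup] e01 /andP[e0 e1] y; rewrite /G normrM (ger0_norm (exprn_ge0 _ (ltW e0))).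
rewrite [_ * (_ / _)]mulrCA -!mulrA ler_wpM2l ?exprn_ge0 ?(ltW e0)//.
set u := eps *: y; rewrite normrM [`|boltz _ _|]ger0_norm ?expR_ge0// /boltz -/u.
apply: (@le_trans _ _ (C1 * (1 + `|u|) ^+ k * (expR Cw * expR (- `|u|)))).
  apply: ler_pM => //; first by apply: h1; rewrite (ltW e0).
  by rewrite -expRD ler_expR lerNl opprD opprK addrC coercive.
apply: (@le_trans _ _ (C1 * (expR Cw * (C2 * lorentz u)))).
  rewrite -mulrA ler_wpM2l// mulrCA ler_wpM2l ?expR_ge0//.
  apply: (@le_trans _ _ (C2 * ((1 + `|u|) ^+ (2 * d))^-1)); last first.
    by rewrite ler_wpM2l// lorentz_lower.
  by rewrite ler_pdivlMr ?exprn_gt0 ?ltr_pwDl// mulrAC -exprD h2.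
rewrite ler_wpM2l// ler_wpM2l ?expR_ge0// ler_wpM2l//.
exact: lorentz_scale.
Qed.

Let P0 j eps : G j 0 eps = boltz eps.
Proof. by apply/funext => y; rewrite /G /= expr0 !mul1r. Qed.

Let fhatG j n eps xi : 0 < eps <= 1 ->
  cabs (fhat (G j n eps) xi) = `|xi 0 j| ^+ n * cabs (fhat (boltz eps) xi).
Proof.
move=> e01; elim: n => [|n IH]; first by rewrite P0 expr0 mul1r.
have [C1 [C10 h1]] := Gb j n; have [C2 [C20 h2]] := Gb j n.+1.
pose C := Num.max (C1 * (eps ^+ n / eps ^+ (2 * d))) (C2 * (eps ^+ n.+1 / eps ^+ (2 * d))).
rewrite exprS -mulrA -IH; apply: (@cabs_fhat_partial _ _ _ _ C).
- exact: cG.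
- exact: cG.
- by move=> x s; exact: dG.
- move=> x; rewrite (le_trans (h1 _ e01 x))// ler_wpM2r ?(ltW (lorentz_gt0 _))//.
  by rewrite le_max lexx.
- move=> x; rewrite (le_trans (h2 _ e01 x))// ler_wpM2r ?(ltW (lorentz_gt0 _))//.
  by rewrite le_max lexx orbT.
Qed.

Lemma boltz_bound : exists C : R, 0 <= C /\ forall eps, 0 < eps <= 1 -> forall y,
  boltz eps y <= C / eps ^+ (2 * d) * lorentz y.
Proof.
have [C2 [C20 h2]] := @pow_expR_bound R (2 * d).
exists (expR Cw * C2); split; first by rewrite !mulr_ge0 ?expR_ge0.
move=> eps e01 y; rewrite -!mulrA.
apply: (@le_trans _ _ (expR Cw * (C2 * lorentz (eps *: y)))); last first.
  rewrite ler_wpM2l ?expR_ge0// ler_wpM2l//; exact: lorentz_scale.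
apply: (@le_trans _ _ (expR Cw * expR (- `|eps *: y|))).
  by rewrite -expRD ler_expR lerNl opprD opprK addrC coercive.
rewrite ler_wpM2l ?expR_ge0//.
apply: (@le_trans _ _ (C2 * ((1 + `|eps *: y|) ^+ (2 * d))^-1)); last first.
  by rewrite ler_wpM2l// lorentz_lower.
by rewrite ler_pdivlMr ?exprn_gt0 ?ltr_pwDl// mulrC h2.
Qed.

Lemma fhat_boltz_partial (j : 'I_d) (n : nat) : exists C : R, 0 <= C /\
  forall eps, 0 < eps <= 1 -> forall xi : 'rV[R]_d,
  `|xi 0 j| ^+ n * cabs (fhat (boltz eps) xi) <= C * (eps ^+ n / eps ^+ (2 * d)).
Proof.
have [C [C0 h]] := Gb j n; exists (2 * (C * pi ^+ d)); split.
  by rewrite !mulr_ge0 ?exprn_ge0 ?pi_ge0.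
move=> eps e01 xi; rewrite -(fhatG _ _ _ e01).
apply: le_trans (cabs_fhat_le _ (@cG j n eps) (h _ e01)) _.
by set q := _ / _; rewrite le_eqVlt; apply/orP; left; apply/eqP; ring.
Qed.

End Decay.

(** A power of |xi| is that of the coordinate of largest modulus. *)
Lemma fhat_boltz_decay (R : realType) (d : nat) (w : @pexp R d.+1) (Cw : R) :
  (forall (eps : R) (u : 'rV[R]_d.+1), 0 < eps <= 1 -> `|u| - Cw <= peval w eps u) ->
  forall n : nat, exists C : R, 0 <= C /\ forall eps, 0 < eps <= 1 -> forall xi,
  `|xi| ^+ n * cabs (fhat (boltz w eps) xi) <= C * (eps ^+ n / eps ^+ (2 * d.+1)).
Proof.
move=> coer n.
have /choice[C hC] := fun j => fhat_boltz_partial coer j n.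
exists (\sum_j C j); split; first by apply: sumr_ge0 => j _; exact: (hC j).1.
move=> eps e01 xi; have [j ->] := norm_row_coord xi.
rewrite (le_trans ((hC j).2 _ e01 xi))// ler_wpM2r//.
  by move: e01 => /andP[/ltW e0 _]; rewrite divr_ge0 ?exprn_ge0.
by rewrite (bigD1 j)//= lerDl sumr_ge0// => i _; exact: (hC i).1.
Qed.

(** * The scaled potential *)
Section Potential.
Context {R : realType} (d : nat).

Lemma tensor_formZ p (l : tensor R d p) (k : R) (v : 'rV[R]_d) :
  tensor_form l (k *: v) = k ^+ p * tensor_form l v.
Proof.
rewrite /tensor_form mulr_sumr; apply: eq_bigr => X _; rewrite mulrCA; congr (_ * _).
have -> : k ^+ p = \prod_(s < p) k by rewrite prodr_const card_ord.
by rewrite -big_split; apply: eq_bigr => s _; rewrite mxE.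
Qed.

Lemma continuous_tensor_form p (l : tensor R d p) : continuous (tensor_form l).
Proof.
apply: continuous_bigsum => X; apply: continuous_scale.
by apply: continuous_bigprod => s; exact: coord_continuous.
Qed.

Lemma tensor_form_le p (l : tensor R d p) : exists C : R, 0 <= C /\
  forall v, `|tensor_form l v| <= C * `|v| ^+ p.
Proof.
exists (\sum_X `|l X|); split; first exact: sumr_ge0.
move=> v; rewrite (le_trans (ler_norm_sum _ _ _))// mulr_suml ler_sum// => X _.
rewrite normrM ler_wpM2l// normr_prod.
have -> : `|v| ^+ p = \prod_(s < p) `|v| by rewrite prodr_const card_ord.
by apply: ler_prod => s _; rewrite normr_ge0 norm_coord.
Qed.

Variables (pbar : nat) (lam : forall p, tensor R d p) (phi : 'rV[R]_d).

(** This is eps^pbar V (phi - u / eps). No negative power of eps occurs, as V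
    has degree pbar. *)
Definition scaled_potential : pexp d :=
  pexp_sum (index_enum 'I_pbar.+1) (fun q => pexp_sum (index_enum {ffun 'I_q -> 'I_d}) (fun X =>
    PMul (@PCst R d (lam q X)) (PMul (iter (pbar - q) (PMul (PEps d)) (@PCst R d 1))
      (pexp_prod (index_enum 'I_q) (fun s => PAdd (PMul (@PCst R d (phi 0 (X s))) (PEps d))
         (PMul (@PCst R d (-1)) (PVar (X s)))))))).

Lemma peval_scaled_potential (eps : R) (u : 'rV[R]_d) :
  peval scaled_potential eps u =
  \sum_(q < pbar.+1) eps ^+ (pbar - q) * tensor_form (lam q) (eps *: phi - u).
Proof.
rewrite peval_sum; apply: eq_bigr => q _.
rewrite peval_sum mulr_sumr; apply: eq_bigr => X _ /=.
rewrite peval_exp peval_prod mulrCA /=; congr (_ * (_ * _)).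
by apply: eq_bigr => s _ /=; rewrite !mxE mulN1r [_ * eps]mulrC.
Qed.

Lemma boltz_scaled_potential (eps : R) (y : 'rV[R]_d) :
  boltz scaled_potential eps y =
  expR (- (eps ^+ pbar * potential pbar lam (phi - y))).
Proof.
rewrite /boltz peval_scaled_potential /potential mulr_sumr; congr (expR (- _)).
apply: eq_bigr => q _; rewrite -scalerBr tensor_formZ mulrA -exprD subnK//.
by rewrite -ltnS.
Qed.

End Potential.

(** The leading form is bounded below on the unit sphere, hence dominates the
    forms of lower degree, whose coefficients are at most 1 in eps. *)
Lemma coercive_scaled_potential (R : realType) (d pbar : nat)
    (lam : forall p, tensor R d.+1 p) (phi : 'rV[R]_d.+1) :
  is_interaction pbar lam ->
  exists Cw : R, forall (eps : R) (u : 'rV[R]_d.+1), 0 < eps <= 1 ->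
    `|u| - Cw <= peval (scaled_potential pbar lam phi) eps u.
Proof.
move=> [p0 pe _ lead].
pose S : set 'rV[R]_d.+1 := [set v | `|v| = 1].
have p2 : (1 < pbar)%N by case: pbar p0 pe {lead lam} => [|[|]].
have [c0 [c00 hc0]] : exists c0 : R, 0 < c0 /\
    forall v : 'rV[R]_d.+1, c0 * `|v| ^+ pbar <= tensor_form (lam pbar) v.
  have cS : compact S.
    apply: bounded_closed_compact.
      exists 1; split; first exact: num_real.
      by move=> M M1 v /= ->; exact: ltW.
    rewrite (_ : S = (fun v : 'rV[R]_d.+1 => `|v|) @^-1` [set 1]); last by [].
    apply: closed_comp; last exact: closed_eq.
    by move=> v _; exact: norm_continuous.
  have S0 : S !=set0.
    exists (const_mx 1); rewrite /S /=.
    apply/eqP; rewrite eq_le; apply/andP; split.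
      by apply: norm_row_le => // j; rewrite mxE normr1.
    by have := norm_coord (const_mx 1 : 'rV[R]_d.+1) 0; rewrite mxE normr1.
  have [v0 Sv0 v0min] := compact_EVT_min S0 cS
    (continuous_subspaceT (@continuous_tensor_form R d.+1 pbar (lam pbar))).
  exists (tensor_form (lam pbar) v0); split.
    apply: lead; rewrite -normr_gt0; move: Sv0; rewrite inE /S /= => ->//.
  move=> v; have [->|v0'] := eqVneq v 0.
    rewrite normr0 expr0n gtn_eqF// mulr0 -(scale0r (0 : 'rV[R]_d.+1)) tensor_formZ.
    by rewrite expr0n gtn_eqF// mul0r.
  have n0 : 0 < `|v| by rewrite normr_gt0.
  have {2}-> : v = `|v| *: (`|v|^-1 *: v) by rewrite scalerA divff ?scale1r// gt_eqF.
  rewrite tensor_formZ mulrC ler_wpM2l ?exprn_ge0//; apply: v0min.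
  by rewrite inE /S /= normrZ normfV normr_id mulVf// gt_eqF.
have /choice[C hC] := fun q : 'I_pbar => tensor_form_le (lam q).
pose A := \sum_q C q.
have A0 : 0 <= A by apply: sumr_ge0 => q _; exact: (hC q).1.
have low eps (v : 'rV[R]_d.+1) : 0 < eps <= 1 ->
    c0 * `|v| ^+ pbar - A * (1 + `|v| ^+ pbar.-1) <=
    \sum_(q < pbar.+1) eps ^+ (pbar - q) * tensor_form (lam q) v.
  move=> /andP[e0 e1]; rewrite big_ord_recr /= subnn expr0 mul1r addrC lerD//.
  rewrite lerNl -sumrN /A mulr_suml ler_sum// => q _.
  rewrite -mulrN (le_trans (ler_norm _))// normrM normrN ger0_norm ?exprn_ge0 ?(ltW e0)//.
  rewrite (@le_trans _ _ (1 * (C q * `|v| ^+ q)))//.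
    by apply: ler_pM => //; [rewrite exprn_ge0// ltW|rewrite exprn_ile1// ltW|exact: (hC q).2].
  rewrite mul1r ler_wpM2l//; first exact: (hC q).1.
  have [v1|/ltW v1] := leP `|v| 1.
    by rewrite (@le_trans _ _ 1)// ?exprn_ile1// lerDl exprn_ge0.
  rewrite (@le_trans _ _ (`|v| ^+ pbar.-1))// ?lerDr//.
  by rewrite ler_weXn2l// -ltnS prednK.
pose R0 := 1 + (A + 1) / c0.
have R01 : 1 <= R0 by rewrite lerDl divr_ge0 ?addr_ge0// ltW.
have R00 : 0 <= R0 by rewrite (le_trans _ R01).
pose C' := A + R0 + A * R0 ^+ pbar.-1.
have main (r : R) : 0 <= r -> r - C' <= c0 * r ^+ pbar - A * (1 + r ^+ pbar.-1).
  move=> r0; have [rR|/ltW Rr] := leP r R0.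
    have h1 : r ^+ pbar.-1 <= R0 ^+ pbar.-1 by rewrite lerXn2r.
    have h2 : A * r ^+ pbar.-1 <= A * R0 ^+ pbar.-1 by rewrite ler_wpM2l.
    have h3 : 0 <= c0 * r ^+ pbar by rewrite mulr_ge0 ?exprn_ge0// ltW.
    by rewrite /C'; lra.
  have r1 : 1 <= r by rewrite (le_trans R01).
  have h1 : A + 1 <= c0 * r.
    rewrite mulrC -ler_pdivrMr// (le_trans _ Rr)// /R0 lerDr//.
  have h2 : r <= r ^+ pbar.-1.
    by rewrite -[leLHS]expr1 ler_weXn2l// -ltnS prednK.
  have h3 : (A + 1) * r ^+ pbar.-1 <= c0 * r ^+ pbar.
    by rewrite -{2}(prednK p0) exprS mulrA ler_wpM2r// exprn_ge0.
  have h4 : 0 <= A * R0 ^+ pbar.-1 by rewrite mulr_ge0 ?exprn_ge0.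
  by rewrite /C'; move: h3; rewrite mulrDl mul1r; lra.
exists (C' + `|phi|) => eps u e01; rewrite peval_scaled_potential.
apply: le_trans (low _ _ e01); apply: le_trans (main _ (normr_ge0 _)).
rewrite opprD addrA [_ - C']addrC -addrA [leRHS]addrC lerD2l.
rewrite lerBlDr; have := ler_normD (u - eps *: phi) (eps *: phi); rewrite subrK.
move=> /le_trans; apply; rewrite distrC lerD2l normrZ.
by move: e01 => /andP[e0 e1]; rewrite gtr0_norm// ler_piMl.
Qed.

(** * Power series over boxes of multi-indices *)
Section BoxSums.
Context {R : realType} {d : nat}.
Local Notation MI := (multi_index d).

Definition box_index n (b : {ffun 'I_d -> 'I_n}) : MI := [ffun j => b j : nat].

Definition box_sum (V : nmodType) n (u : MI -> V) : V :=
  \sum_(b : {ffun 'I_d -> 'I_n}) u (box_index b).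

Definition in_box n (a : MI) : bool := [forall j, a j < n]%N.

Lemma in_box_index n (b : {ffun 'I_d -> 'I_n}) : in_box n (box_index b).
Proof. by apply/forallP => j; rewrite ffunE. Qed.

Lemma box_sum_widen (V : nmodType) n N (u : MI -> V) : (0 < n)%N -> (n <= N)%N ->
  box_sum n u = \sum_(b : {ffun 'I_d -> 'I_N} | in_box n (box_index b)) u (box_index b).
Proof.
case: n => // n _ nN; pose h (b : {ffun 'I_d -> 'I_n.+1}) : {ffun 'I_d -> 'I_N} :=
  [ffun j => widen_ord nN (b j)].
have hE b : box_index (h b) = box_index b by apply/ffunP => j; rewrite !ffunE.
pose k (b : {ffun 'I_d -> 'I_N}) : {ffun 'I_d -> 'I_n.+1} := [ffun j => inord (b j)].
rewrite /box_sum [RHS](reindex_onto h k) /=.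
  apply: eq_big => [b|b _]; last by rewrite hE.
  rewrite hE in_box_index /=; apply/esym/eqP/ffunP => j; rewrite !ffunE /=.
  by apply/val_inj; rewrite /= inordK.
move=> b /forallP bn; apply/ffunP => j; rewrite !ffunE; apply/val_inj => /=.
by rewrite inordK//; have := bn j; rewrite ffunE.
Qed.

Lemma box_sum_diff n N (u : MI -> R[i]) : (0 < n)%N -> (n <= N)%N ->
  box_sum N u - box_sum n u =
  \sum_(b : {ffun 'I_d -> 'I_N} | ~~ in_box n (box_index b)) u (box_index b).
Proof.
move=> n0 nN; rewrite (box_sum_widen u n0 nN) /box_sum.
by rewrite (bigID (fun b => in_box n (box_index b)))/= addrAC subrr add0r.
Qed.

Definition box_summable (u : MI -> R[i]) : Prop :=
  exists B : R, 0 <= B /\ forall n, box_sum n (fun a => cabs (u a)) <= B.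

Definition box_lim (u : MI -> R[i]) (l : R[i]) : Prop :=
  (fun n => cabs (l - box_sum n u)) @ \oo --> (0 : R).

Lemma box_sum_mono n N (u : MI -> R) : (forall a, 0 <= u a) ->
  (0 < n)%N -> (n <= N)%N -> box_sum n u <= box_sum N u.
Proof.
move=> u0 n0 nN; rewrite (box_sum_widen u n0 nN) /box_sum.
rewrite [leRHS](bigID (fun b => in_box n (box_index b)))/= lerDl.
by apply: sumr_ge0 => b _; exact: u0.
Qed.

Lemma box_cvg_real (u : MI -> R) (B : R) : (forall a, 0 <= u a) ->
  (forall n, box_sum n u <= B) -> exists l : R, (fun n => box_sum n u) @ \oo --> l.
Proof.
move=> u0 uB; suff : cvgn (fun n => box_sum n.+1 u).
  move=> /cvg_ex[l hl]; exists l; by rewrite -(cvg_shiftS (fun n => box_sum n u)).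
apply: nondecreasing_is_cvgn.
  by move=> n m nm; apply: box_sum_mono.
by exists B => _ [n _ <-]; exact: uB.
Qed.

Lemma box_lim_exists (u : MI -> R[i]) : box_summable u -> exists l, box_lim u l.
Proof.
move=> [B [B0 uB]].
have key (p : R[i] -> R) : (forall z, `|p z| <= cabs z) ->
    exists l : R, (fun n => box_sum n (fun a => p (u a))) @ \oo --> l.
  move=> pl.
  have [l1 h1] : exists l : R, (fun n => box_sum n (fun a => p (u a) + cabs (u a))) @ \oo --> l.
    apply: (@box_cvg_real _ (B + B)) => [a|n].
      by have := pl (u a); rewrite ler_norml => /andP[h _]; rewrite -lerBlDr sub0r.
    rewrite /box_sum big_split/= lerD ?uB// (le_trans _ (uB n))//.
    by apply: ler_sum => b _; rewrite (le_trans (ler_norm _)).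
  have [l2 h2] := box_cvg_real (fun a => cabs_ge0 (u a)) uB.
  exists (l1 - l2).
  have -> : (fun n => box_sum n (fun a => p (u a))) = (fun n =>
      box_sum n (fun a => p (u a) + cabs (u a)) - box_sum n (fun a => cabs (u a))).
    by apply/funext => n; rewrite /box_sum big_split/= addrK.
  exact: cvgB.
have [lr hr] := key _ Re_le_cabs; have [li hi] := key _ Im_le_cabs.
exists (Complex lr li); apply/cvgr0Pnorm_le => e e0.
have e2 : 0 < e / 2 by rewrite divr_gt0.
move/cvgrPdist_le/(_ _ e2) : hr => hr; move/cvgrPdist_le/(_ _ e2) : hi => hi.
near=> n; rewrite ger0_norm ?cabs_ge0// (le_trans (cabs_le_ReIm _))//.
rewrite ReD ImD ReN ImN /box_sum Re_sum Im_sum [leRHS]splitr lerD//; first by near: n.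
by near: n.
Unshelve. all: by end_near. Qed.

Lemma box_lim_le (f : nat -> R[i]) (l : R[i]) (B : R) :
  (fun n => cabs (l - f n)) @ \oo --> (0 : R) ->
  (\forall n \near \oo, cabs (f n) <= B) -> cabs l <= B.
Proof.
move=> fl fB; apply/ler_addgt0Pr => e e0.
have /cvgr0_norm_le/(_ _ e0) h := fl.
have [n [h1 h2]] : exists n, cabs (f n) <= B /\ cabs (l - f n) <= e.
  have : \forall n \near \oo, cabs (f n) <= B /\ cabs (l - f n) <= e.
    near=> n; split; first by near: n.
    by rewrite -[leLHS]ger0_norm ?cabs_ge0//; near: n.
  by move=> /filter_ex.
by rewrite -[l](subrK (f n)) (le_trans (cabsD _ _))// addrC lerD.
Unshelve. all: by end_near. Qed.

End BoxSums.

Section Monomials.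
Context {R : realType} {d : nat}.
Local Notation MI := (multi_index d).

(** Bound a single term of the binomial expansion of (r1 + (r - r1))^a. *)
Lemma ffact_pow_bound (k : nat) (r1 r : R) : 0 <= r1 -> r1 < r ->
  forall a, (a ^_ k)%:R * r1 ^+ (a - k) <= k`!%:R / (r - r1) ^+ k * r ^+ a.
Proof.
move=> r10 r1r a; have s0 : 0 < r - r1 by rewrite subr_gt0.
have [ak|ka] := ltnP a k.
  by rewrite ffact_small// mul0r !mulr_ge0 ?invr_ge0 ?exprn_ge0 ?(ltW s0)// (le_trans r10) ?ltW.
have key : 'C(a, k)%:R * (r - r1) ^+ k * r1 ^+ (a - k) <= r ^+ a.
  have -> : r ^+ a = (r1 + (r - r1)) ^+ a by rewrite addrC subrK.
  rewrite [leRHS]exprDn.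
  have kl : (k < a.+1)%N by rewrite ltnS.
  rewrite (bigD1 (Ordinal kl))//= -[leLHS]addr0 lerD//.
    by rewrite -[leRHS]mulr_natl -mulrA [r1 ^+ _ * _]mulrC.
  apply: sumr_ge0 => i _; apply: mulrn_wge0.
  by rewrite mulr_ge0 ?exprn_ge0 ?(ltW s0).
rewrite -bin_ffact natrM.
have -> : 'C(a, k)%:R * k`!%:R * r1 ^+ (a - k) =
    k`!%:R / (r - r1) ^+ k * ('C(a, k)%:R * (r - r1) ^+ k * r1 ^+ (a - k)).
  by field; rewrite gt_eqF ?exprn_gt0.
by rewrite ler_wpM2l// divr_ge0// exprn_ge0// ltW.
Qed.

End Monomials.

Section PowerSeries.
Context {R : realType} {d : nat}.
Local Notation MI := (multi_index d).
Implicit Types (a k : MI) (x : 'rV[R]_d).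

Lemma derive_of_quadratic (f : 'rV[R]_d -> R) x v (g M del : R) : 0 < del ->
  (forall h, `|h| < del -> `|f (x + h *: v) - f x - h * g| <= M * h ^+ 2) ->
  'D_v f x = g.
Proof.
move=> d0 H; apply/cvg_lim; first exact: Rhausdorff.
apply/cvgrPdist_le => e e0.
have M0 : 0 <= `|M| + 1 by rewrite addr_ge0.
have M1 : 0 < `|M| + 1 by rewrite ltr_wpDl.
near=> h.
have h0 : h != 0 by near: h; exact: nbhs_dnbhs_neq.
have hd : `|h| < del by near: h; exact: dnbhs0_lt.
have he : `|h| < e / (`|M| + 1) by near: h; apply: dnbhs0_lt; rewrite divr_gt0.
rewrite /= [h *: v + x]addrC.
have -> : g - h^-1 *: (f (x + h *: v) - f x) =
   - (h^-1 * (f (x + h *: v) - f x - h * g)).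
  by rewrite /GRing.scale /=; field.
rewrite normrN normrM normfV ler_pdivrMl ?normr_gt0//.
apply: le_trans (H h hd) _; rewrite -real_normK ?num_real// expr2 mulrCA.
rewrite ler_wpM2l//; apply: (@le_trans _ _ ((`|M| + 1) * `|h|)).
  by rewrite ler_wpM2r// (le_trans (ler_norm _))// lerDl.
by rewrite mulrC -ler_pdivlMr// ltW.
Unshelve. all: by end_near. Qed.

Definition dmono1 (k a : nat) (t : R) : R := (a ^_ k)%:R * t ^+ (a - k).

(** The partial derivative of multi-order k of the monomial of exponent a. *)
Definition dmono k a x : R := \prod_j dmono1 (k j) (a j) (x 0 j).

Definition mdeg a : nat := \sum_j a j.

Definition madd k (j : 'I_d) : MI := [ffun i => (k i + (i == j))%N].

Lemma pow_taylor2 (m : nat) (t h r1 : R) : 0 <= r1 -> `|t| <= r1 -> `|t + h| <= r1 ->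
  `|(t + h) ^+ m - t ^+ m - h * (m%:R * t ^+ m.-1)| <= h ^+ 2 * ((m ^_ 2)%:R * r1 ^+ (m - 2)).
Proof.
move=> r10 tr thr; elim: m => [|m IH].
  by rewrite !expr0 subrr mul0r mulr0 subrr normr0 mulr0.
have -> : (t + h) ^+ m.+1 - t ^+ m.+1 - h * (m.+1%:R * t ^+ m) =
    (t + h) * ((t + h) ^+ m - t ^+ m - h * (m%:R * t ^+ m.-1)) +
    h ^+ 2 * (m%:R * t ^+ m.-1).
  case: m {IH} => [|m] /=; first by rewrite !expr1 !expr0; ring.
  by rewrite !exprS -!natr1; ring.
apply: le_trans (ler_normD _ _) _.
apply: (@le_trans _ _ (r1 * (h ^+ 2 * ((m ^_ 2)%:R * r1 ^+ (m - 2))) +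
    h ^+ 2 * (m%:R * r1 ^+ m.-1))).
  apply: lerD; first by rewrite normrM; exact: ler_pM.
  rewrite normrM (ger0_norm (sqr_ge0 h)) ler_wpM2l ?sqr_ge0// normrM normr_nat ler_wpM2l//.
  by rewrite normrX lerXn2r// nnegrE.
rewrite mulrCA -mulrDr ler_wpM2l ?sqr_ge0//.
case: m {IH} => [|m]; first by rewrite !mul0r mulr0 addr0.
rewrite !subSS subn0 subn1 /= mulrCA.
have -> : ((m.+1 ^_ 2)%:R : R) * (r1 * r1 ^+ m.-1) = (m.+1 ^_ 2)%:R * r1 ^+ m.
  case: m => [|m]; first by rewrite !mul0r.
  by rewrite -exprS.
rewrite -mulrDl ler_wpM2r ?exprn_ge0// -natrD ler_nat.
by rewrite !ffactnS !ffactn0 /=; nia.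
Qed.

Lemma dmono1_taylor (k a : nat) (t h r1 : R) : 0 <= r1 -> `|t| <= r1 -> `|t + h| <= r1 ->
  `|dmono1 k a (t + h) - dmono1 k a t - h * dmono1 k.+1 a t| <=
  h ^+ 2 * ((a ^_ k.+2)%:R * r1 ^+ (a - k.+2)).
Proof.
move=> r10 tr thr.
have e1 : dmono1 k.+1 a t = (a ^_ k)%:R * ((a - k)%:R * t ^+ (a - k).-1).
  by rewrite /dmono1 ffactnSr natrM -mulrA subnS.
have e2 : (a ^_ k.+2)%:R * r1 ^+ (a - k.+2) =
    (a ^_ k)%:R * (((a - k) ^_ 2)%:R * r1 ^+ (a - k - 2)).
  have -> : (a ^_ k.+2 = a ^_ k * (a - k) ^_ 2)%N.
    by rewrite !ffactnSr ffactn0 mul1n subn0 -mulnA -subnDA addn1.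
  by rewrite natrM -mulrA -subnDA addn2.
rewrite e1 e2 /dmono1; set m := (a - k)%N; set A := (a ^_ k)%:R.
have -> : A * (t + h) ^+ m - A * t ^+ m - h * (A * (m%:R * t ^+ m.-1)) =
    A * ((t + h) ^+ m - t ^+ m - h * (m%:R * t ^+ m.-1)) by ring.
have A0 : 0 <= A by rewrite ler0n.
by rewrite normrM (ger0_norm A0) [leRHS]mulrCA ler_wpM2l// pow_taylor2.
Qed.

Variables (c : MI -> R[i]) (rho B : R).
Hypothesis rho0 : 0 < rho.
Hypothesis cB : forall n, box_sum n (fun a => cabs (c a) * rho ^+ mdeg a) <= B.

Definition is_pseries_at k (f : 'rV[R]_d -> R[i]) : Prop :=
  forall x, `|x| < rho -> box_lim (fun a => c a * (dmono k a x)%:C%C) (f x).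

Lemma rho_mdeg a : rho ^+ mdeg a = \prod_j rho ^+ a j.
Proof. by rewrite /mdeg (big_morph (fun n => rho ^+ n) (exprD rho) (expr0 rho)). Qed.

Let K (r1 : R) (k : nat) : R := k`!%:R / (rho - r1) ^+ k.

Let K_ge0 r1 (k : nat) : r1 < rho -> 0 <= K r1 k.
Proof. by move=> h; rewrite divr_ge0// exprn_ge0// subr_ge0 ltW. Qed.

Let dmono1_bound r1 (k a : nat) t : 0 <= r1 -> r1 < rho -> `|t| <= r1 ->
  `|dmono1 k a t| <= K r1 k * rho ^+ a.
Proof.
move=> r10 r1r tr; rewrite normrM normr_nat normrX.
apply: le_trans (ffact_pow_bound k r10 r1r a); by rewrite ler_wpM2l// lerXn2r// nnegrE.
Qed.

Lemma dmono_bound r1 k : 0 <= r1 -> r1 < rho -> exists M, 0 <= M /\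
  forall a x, `|x| <= r1 -> `|dmono k a x| <= M * rho ^+ mdeg a.
Proof.
move=> r10 r1r; exists (\prod_j K r1 (k j)); split.
  by apply: prodr_ge0 => j _; exact: K_ge0.
move=> a x xr; rewrite normr_prod rho_mdeg -big_split; apply: ler_prod => j _.
by rewrite normr_ge0 dmono1_bound// (le_trans (norm_coord _ _)).
Qed.

Lemma dmono_taylor r1 k j : 0 <= r1 -> r1 < rho -> exists M, 0 <= M /\
  forall a x h, `|x| <= r1 -> `|x + h *: delta_mx 0 j| <= r1 ->
  `|dmono k a (x + h *: delta_mx 0 j) - dmono k a x - h * dmono (madd k j) a x| <=
   M * h ^+ 2 * rho ^+ mdeg a.
Proof.
move=> r10 r1r; exists (K r1 (k j).+2 * \prod_(i < d | i != j) K r1 (k i)); split.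
  by rewrite mulr_ge0 ?K_ge0// prodr_ge0// => i _; exact: K_ge0.
move=> a x h xr xhr.
pose Q := \prod_(i < d | i != j) dmono1 (k i) (a i) (x 0 i).
have e1 : dmono k a (x + h *: delta_mx 0 j) = dmono1 (k j) (a j) (x 0 j + h) * Q.
  rewrite /dmono (bigD1 j)//= !mxE !eqxx mulr1; congr (_ * _).
  by apply: eq_bigr => i /negPf ij; rewrite !mxE ij andbF mulr0 addr0.
have e2 : dmono k a x = dmono1 (k j) (a j) (x 0 j) * Q by rewrite /dmono (bigD1 j).
have e3 : dmono (madd k j) a x = dmono1 (k j).+1 (a j) (x 0 j) * Q.
  rewrite /dmono (bigD1 j)//= ffunE eqxx addn1; congr (_ * _).
  by apply: eq_bigr => i /negPf ij; rewrite ffunE ij addn0.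
have rE : rho ^+ mdeg a = rho ^+ a j * \prod_(i < d | i != j) rho ^+ a i.
  by rewrite rho_mdeg (bigD1 j).
rewrite e1 e2 e3 mulrA -!mulrBl normrM rE.
have hQ : `|Q| <= (\prod_(i < d | i != j) K r1 (k i)) * \prod_(i < d | i != j) rho ^+ a i.
  rewrite normr_prod -big_split; apply: ler_prod => i _.
  by rewrite normr_ge0 dmono1_bound// (le_trans (norm_coord _ _)).
have xj : `|x 0 j| <= r1 by exact: le_trans (norm_coord _ _) xr.
have xhj : `|x 0 j + h| <= r1.
  by have := le_trans (norm_coord _ j) xhr; rewrite !mxE !eqxx mulr1.
have hj : `|dmono1 (k j) (a j) (x 0 j + h) - dmono1 (k j) (a j) (x 0 j) -
    h * dmono1 (k j).+1 (a j) (x 0 j)| <= K r1 (k j).+2 * rho ^+ a j * h ^+ 2.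
  apply: le_trans (dmono1_taylor _ _ r10 xj xhj) _.
  by rewrite mulrC ler_wpM2r ?sqr_ge0// ffact_pow_bound.
apply: le_trans (ler_pM (normr_ge0 _) (normr_ge0 _) hj hQ) _.
by rewrite le_eqVlt; apply/orP; left; apply/eqP; ring.
Qed.

Lemma weighted_summable (u : MI -> R) M : 0 <= M ->
  (forall a, `|u a| <= M * rho ^+ mdeg a) -> forall n,
  box_sum n (fun a => cabs (c a * (u a)%:C%C)) <= M * B.
Proof.
move=> M0 uM n; apply: (@le_trans _ _ (M * box_sum n (fun a => cabs (c a) * rho ^+ mdeg a))).
  rewrite /box_sum mulr_sumr; apply: ler_sum => b _.
  by rewrite cabsM cabs_real mulrCA ler_wpM2l ?cabs_ge0.
by rewrite ler_wpM2l.
Qed.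

Let B0 : 0 <= B.
Proof.
apply: le_trans (cB 0); apply: sumr_ge0 => b _.
by rewrite mulr_ge0 ?cabs_ge0 ?exprn_ge0 ?(ltW rho0).
Qed.

(** Termwise, the first order Taylor remainder in direction j is at most
    M h^2 rho^|a|, and this bound can be summed against the coefficients. *)
Lemma pseries_partial k j f : is_pseries_at k f ->
  is_pseries_at (madd k j) (partial j f).
Proof.
move=> psf x xr.
pose r1 := (`|x| + rho) / 2.
have xr1 : `|x| < r1 by rewrite /r1; lra.
have r1r : r1 < rho by rewrite /r1; lra.
have r10 : 0 <= r1 by rewrite (le_trans _ (ltW xr1)).
have [M1 [M10 h1]] := dmono_bound (madd k j) r10 r1r.
have [M2 [M20 h2]] := dmono_taylor k j r10 r1r.
have [l hl] : exists l, box_lim (fun a => c a * (dmono (madd k j) a x)%:C%C) l.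
  apply: box_lim_exists; exists (M1 * B); split; first exact: mulr_ge0.
  by apply: weighted_summable => // a; apply: h1; exact: ltW.
have est h : `|h| < r1 - `|x| ->
    cabs (f (x + h *: delta_mx 0 j) - f x - h%:C%C * l) <= M2 * B * h ^+ 2.
  move=> hr.
  have xh : `|x + h *: delta_mx 0 j| <= r1.
    rewrite (le_trans (ler_normD _ _))// normrZ.
    have : `|delta_mx 0 j : 'rV[R]_d| <= 1.
      by apply: norm_row_le => // i; rewrite mxE; case: (_ && _); rewrite ?normr1 ?normr0.
    have := normr_ge0 h; nra.
  have l1 := psf _ xr; have l2 := psf _ (le_lt_trans xh r1r).
  apply: (@box_lim_le _ (fun n =>
     box_sum n (fun a => c a * (dmono k a (x + h *: delta_mx 0 j))%:C%C) -
     box_sum n (fun a => c a * (dmono k a x)%:C%C) -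
     h%:C%C * box_sum n (fun a => c a * (dmono (madd k j) a x)%:C%C))).
    apply/cvgr0Pnorm_le => e e0.
    have e1 : 0 < e / 3 by lra.
    have e2 : 0 < e / 3 / (`|h| + 1) by rewrite divr_gt0// ltr_wpDl.
    have /cvgr0_norm_le/(_ _ e1) H1 := l1.
    have /cvgr0_norm_le/(_ _ e1) H2 := l2.
    have /cvgr0_norm_le/(_ _ e2) H3 := hl.
    near=> n; rewrite ger0_norm ?cabs_ge0//.
    have b1 : cabs (f x - box_sum n (fun a => c a * (dmono k a x)%:C%C)) <= e / 3.
      by rewrite -[leLHS]ger0_norm ?cabs_ge0//; near: n.
    have b2 : cabs (f (x + h *: delta_mx 0 j) -
        box_sum n (fun a => c a * (dmono k a (x + h *: delta_mx 0 j))%:C%C)) <= e / 3.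
      by rewrite -[leLHS]ger0_norm ?cabs_ge0//; near: n.
    have b3 : cabs (l - box_sum n (fun a => c a * (dmono (madd k j) a x)%:C%C)) <=
        e / 3 / (`|h| + 1).
      by rewrite -[leLHS]ger0_norm ?cabs_ge0//; near: n.
    move: b1 b2 b3; set s1 := box_sum n _; set s2 := box_sum n _; set s3 := box_sum n _.
    move=> b1 b2 b3.
    have -> : f (x + h *: delta_mx 0 j) - f x - h%:C%C * l - (s2 - s1 - h%:C%C * s3) =
      (f (x + h *: delta_mx 0 j) - s2) - (f x - s1) - h%:C%C * (l - s3) by ring.
    have b4 : cabs (h%:C%C * (l - s3)) <= e / 3.
      rewrite cabsM cabs_real; move: b3; rewrite ler_pdivlMr ?ltr_wpDl// => b3.
      by apply: le_trans b3; rewrite mulrC ler_wpM2l ?cabs_ge0// lerDl.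
    have := cabsB (f (x + h *: delta_mx 0 j) - s2 - (f x - s1)) (h%:C%C * (l - s3)).
    have := cabsB (f (x + h *: delta_mx 0 j) - s2) (f x - s1).
    lra.
  apply: nearW => n.
  have -> : box_sum n (fun a => c a * (dmono k a (x + h *: delta_mx 0 j))%:C%C) -
     box_sum n (fun a => c a * (dmono k a x)%:C%C) -
     h%:C%C * box_sum n (fun a => c a * (dmono (madd k j) a x)%:C%C) =
     box_sum n (fun a => c a * (dmono k a (x + h *: delta_mx 0 j) - dmono k a x
        - h * dmono (madd k j) a x)%:C%C).
    rewrite /box_sum mulr_sumr -!sumrB; apply: eq_bigr => b _.
    by rewrite !rmorphB rmorphM /=; ring.
  apply: le_trans (cabs_sum _ _ _) _; rewrite mulrAC.
  apply: (@weighted_summable (fun a => dmono k a (x + h *: delta_mx 0 j) -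
    dmono k a x - h * dmono (madd k j) a x)) => [|a].
    by rewrite mulr_ge0 ?sqr_ge0.
  by apply: h2 => //; exact: ltW.
have del0 : 0 < r1 - `|x| by rewrite subr_gt0.
suff -> : partial j f x = l by [].
apply: complex_eq => /=.
- apply: (derive_of_quadratic del0 (M := M2 * B)) => h hr.
  apply: le_trans (est h hr); apply: le_trans (Re_le_cabs _).
  by rewrite !ReD !ReN ReZ.
- apply: (derive_of_quadratic del0 (M := M2 * B)) => h hr.
  apply: le_trans (est h hr); apply: le_trans (Im_le_cabs _).
  by rewrite !ImD !ImN ImZ.
Unshelve. all: by end_near. Qed.

Definition mcount (s : seq 'I_d) : MI := [ffun j => count_mem j s].

Lemma pseries_partials s f : is_pseries_at [ffun=> 0%N] f ->
  is_pseries_at (mcount s) (partials s f).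
Proof.
move=> psf; elim: s => [|j s IH] /=.
  by have -> : mcount [::] = [ffun=> 0%N] by apply/ffunP => j; rewrite !ffunE.
have -> : mcount (j :: s) = madd (mcount s) j; last exact: pseries_partial.
by apply/ffunP => i; rewrite !ffunE /= addnC eq_sym.
Qed.

Definition mfact k : nat := \prod_j (k j)`!.

(** At 0 only the monomial of exponent k has a nonzero derivative of order k. *)
Lemma pseries_at0 k f : is_pseries_at k f -> f 0 = c k * (mfact k)%:R.
Proof.
move=> psf; have h : `|0 : 'rV[R]_d| < rho by rewrite normr0.
have {h}hl := psf 0 h.
have d0 a : a != k -> dmono k a 0 = 0.
  move=> ak; have [j jak] : exists j, a j != k j.
    by apply/existsP; apply: contra_neqT ak; rewrite negb_exists => /forallP e;
      apply/ffunP => j; apply/eqP; have := e j; rewrite negbK.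
  rewrite /dmono (bigD1 j)//= mxE /dmono1.
  have [lt|gt|e] := ltngtP (a j) (k j).
  - by rewrite ffact_small// !mul0r.
  - by rewrite expr0n subn_eq0 leqNgt gt /= mulr0 mul0r.
  - by rewrite e eqxx in jak.
have dk : dmono k k 0 = (mfact k)%:R.
  rewrite /dmono /mfact natr_prod; apply: eq_bigr => j _.
  by rewrite /dmono1 subnn expr0 mulr1 ffactnn.
have e : \forall n \near \oo, box_sum n (fun a => c a * (dmono k a 0)%:C%C) =
    c k * (mfact k)%:R.
  near=> n.
  have kn j : (k j < n)%N.
    apply: (@leq_ltn_trans (mdeg k)); last by near: n; exact: nbhs_infty_gt.
    by rewrite /mdeg (bigD1 j)//= leq_addr.
  pose b : {ffun 'I_d -> 'I_n} := [ffun j => Ordinal (kn j)].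
  have bk : box_index b = k by apply/ffunP => j; rewrite !ffunE.
  rewrite /box_sum (bigD1 b)//= bk dk rmorph_nat big1 ?addr0// => b' bb'.
  rewrite d0 ?mulr0//; apply: contra_neq bb' => b'k.
  apply/ffunP => j; apply/val_inj; move/ffunP: b'k => /(_ j).
  by rewrite !ffunE.
apply/eqP; rewrite -subr_eq0; apply/eqP/cabs_eq0/eqP.
rewrite eq_le cabs_ge0 andbT; apply/ler_addgt0Pr => eps eps0; rewrite add0r.
have /cvgr0_norm_le/(_ _ eps0) h := hl.
have [n [h1 h2]] : exists n, box_sum n (fun a => c a * (dmono k a 0)%:C%C) =
    c k * (mfact k)%:R /\ `|cabs (f 0 - box_sum n (fun a => c a * (dmono k a 0)%:C%C))| <= eps.
  by have /filter_ex : \forall n \near \oo, box_sum n (fun a => c a * (dmono k a 0)%:C%C) =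
    c k * (mfact k)%:R /\ `|cabs (f 0 - box_sum n (fun a => c a * (dmono k a 0)%:C%C))| <= eps
    by near=> n; split; near: n.
by move: h2; rewrite h1 ger0_norm ?cabs_ge0.
Unshelve. all: by end_near. Qed.

End PowerSeries.

Section SymbolSeries.
Context {R : realType} {d : nat}.
Local Notation MI := (multi_index d).
Implicit Types (a k : MI) (x : 'rV[R]_d).

Definition mono0 : MI := [ffun=> 0%N].

Lemma dmono0E a x : dmono mono0 a x = \prod_j x 0 j ^+ a j.
Proof. by apply: eq_bigr => j _; rewrite /dmono1 ffunE ffactn0 mul1r subn0. Qed.

Lemma norm_dmono0 a x : `|dmono mono0 a x| <= `|x| ^+ mdeg a.
Proof.
rewrite dmono0E normr_prod /mdeg.
rewrite (big_morph (fun n => `|x| ^+ n) (exprD `|x|) (expr0 `|x|)).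
by apply: ler_prod => j _; rewrite normr_ge0 normrX lerXn2r ?nnegrE ?norm_coord.
Qed.

(** A monomial that is not in the box has degree at least n. *)
Lemma pseries_taylor (c : MI -> R[i]) (rho B : R) (f : 'rV[R]_d -> R[i]) n :
  0 < rho -> (forall n, box_sum n (fun a => cabs (c a) * rho ^+ mdeg a) <= B) ->
  is_pseries_at c rho mono0 f -> (0 < n)%N -> forall x, `|x| < rho ->
  cabs (f x - box_sum n (fun a => c a * (dmono mono0 a x)%:C%C)) <= B / rho ^+ n * `|x| ^+ n.
Proof.
move=> r0 cB psf n0 x xr; have hl := psf x xr.
apply: (@box_lim_le _ (fun N => box_sum N (fun a => c a * (dmono mono0 a x)%:C%C) -
   box_sum n (fun a => c a * (dmono mono0 a x)%:C%C))).
  rewrite [X in X @ _ --> _](_ : _ = fun N =>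
    cabs (f x - box_sum N (fun a => c a * (dmono mono0 a x)%:C%C)))//.
  by apply/funext => N; congr cabs; ring.
near=> N; have nN : (n <= N)%N by near: N; exact: nbhs_infty_ge.
rewrite box_sum_diff// (le_trans (cabs_sum _ _ _))//.
apply: (@le_trans _ _ (\sum_(b : {ffun 'I_d -> 'I_N})
    cabs (c (box_index b)) * rho ^+ mdeg (box_index b) * (`|x| / rho) ^+ n)); last first.
  have -> : B / rho ^+ n * `|x| ^+ n = B * (`|x| / rho) ^+ n.
    by rewrite expr_div_n mulrAC mulrA.
  rewrite -mulr_suml; apply: ler_wpM2r; last exact: cB.
  by rewrite exprn_ge0// divr_ge0// ltW.
rewrite [leRHS](bigID (fun b => in_box n (box_index b)))/= -[leLHS]add0r lerD//.
  by apply: sumr_ge0 => b _; rewrite !mulr_ge0 ?cabs_ge0 ?exprn_ge0 ?divr_ge0 ?(ltW r0).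
apply: ler_sum => b bn; rewrite cabsM cabs_real -mulrA ler_wpM2l ?cabs_ge0//.
apply: le_trans (norm_dmono0 _ _) _; set a := box_index b.
have an : (n <= mdeg a)%N.
  move: bn; rewrite negb_forall => /existsP[j]; rewrite -leqNgt => h.
  by rewrite (leq_trans h)// /mdeg (bigD1 j)//= leq_addr.
have -> : `|x| ^+ mdeg a = rho ^+ mdeg a * (`|x| / rho) ^+ mdeg a.
  by rewrite -exprMn mulrC divfK// gt_eqF.
rewrite ler_wpM2l ?exprn_ge0 ?(ltW r0)//.
by rewrite ler_wiXn2l// ?divr_ge0 ?(ltW r0)// ler_pdivrMr// mul1r ltW.
Unshelve. all: by end_near. Qed.

Lemma box_sum_le_esum (u : MI -> R) n : (forall a, 0 <= u a) ->
  ((box_sum n u)%:E <= \esum_(a in [set: MI]) (u a)%:E)%E.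
Proof.
move=> u0; pose s := [seq box_index b | b <- index_enum {ffun 'I_d -> 'I_n}].
apply: esum_ge; exists [set` s]; first by split => //; exact: finite_seq.
have us : uniq s.
  rewrite map_inj_uniq ?index_enum_uniq// => b b' /ffunP e.
  by apply/ffunP => j; apply/val_inj; have := e j; rewrite !ffunE.
by rewrite -fsbig_seq// big_map -sumEFin.
Qed.

Variable Psi : 'rV[R[i]]_d -> R[i].
Hypothesis hPsi : is_symbol Psi.

Lemma monomialZ (w : R[i]) a x :
  monomial a (w *: toC x) = w ^+ mdeg a * (dmono mono0 a x)%:C%C.
Proof.
rewrite /monomial dmono0E rmorph_prod /mdeg.
rewrite (big_morph (fun n => w ^+ n) (exprD w) (expr0 w)) -big_split.
by apply: eq_bigr => j _; rewrite !mxE exprMn rmorphXn.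
Qed.

(** The power series is that of z |-> Psi (- i z). It gives the symbol at z = x
    and Psi itself at z = i x, which accounts for the powers of i. *)
Lemma symbol_series : exists (c : MI -> R[i]) (rho B : R), [/\ 0 < rho,
  forall n, box_sum n (fun a => cabs (c a) * rho ^+ mdeg a) <= B,
  is_pseries_at c rho mono0 (symbol Psi) &
  is_pseries_at (fun a => c a * 'i%C ^+ mdeg a) rho mono0 (fun xi => Psi (toC xi))].
Proof.
have [c [r [r0 hc]]] := symbol_analytic hPsi.
pose rho := r / 2; have rho0 : 0 < rho by rewrite divr_gt0.
have rhor : rho < r by rewrite /rho; lra.
have cabs_i : cabs ('i%C : R[i]) = 1 by rewrite /= expr0n /= add0r expr1n sqrtr1.
exists c, rho.
have [S1 _] : (\esum_(a in [set: MI]) (cabs (c a * monomial a (1 *: toC (const_mx rho))))%:E < +oo)%E /\ True.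
  split=> //; apply: (hc _ _).1 => j.
  by rewrite scale1r !mxE cabs_real gtr0_norm.
exists (fine (\esum_(a in [set: MI]) (cabs (c a * monomial a (1 *: toC (const_mx rho))))%:E)%E).
have box w x : cabs w = 1 -> `|x| < rho ->
    (fun n => cabs (Psi (- 'i%C *: (w *: toC x)) - box_sum n (fun a =>
      c a * w ^+ mdeg a * (dmono mono0 a x)%:C%C))) @ \oo --> (0 : R).
  move=> w1 xr.
  have wr j : cabs ((w *: toC x) 0 j) < r.
    rewrite !mxE cabsM w1 mul1r cabs_real (le_lt_trans (norm_coord _ _))//.
    exact: lt_trans xr rhor.
  have [_ h] := hc _ wr; apply: cvg_trans h; apply: near_eq_cvg; apply: nearW => n.
  congr (cabs (_ - _)); apply: eq_bigr => b _ /=.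
  by rewrite -/(box_index b) monomialZ mulrA.
split => //.
- move=> n; rewrite -lee_fin fineK; last first.
    rewrite ge0_fin_numE// esum_ge0// => a _; by rewrite lee_fin cabs_ge0.
  apply: le_trans (box_sum_le_esum n (fun a => cabs_ge0 _)).
  rewrite lee_fin; apply: ler_sum => b _; rewrite cabsM monomialZ expr1n mul1r cabs_real.
  rewrite ler_wpM2l ?cabs_ge0// dmono0E ger0_norm ?prodr_ge0//; last first.
    by move=> j _; rewrite mxE exprn_ge0// ltW.
  rewrite rho_mdeg; apply: ler_prod => j _; by rewrite mxE exprn_ge0 ?(ltW rho0)//=.
- move=> x xr; apply: cvg_trans (box 1 x (@cabs1 R) xr); apply: near_eq_cvg.
  apply: nearW => n; rewrite scale1r; congr (cabs (_ - _)).
  by apply: eq_bigr => b _; rewrite expr1n mulr1.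
- move=> x xr; apply: cvg_trans (box 'i%C x cabs_i xr); apply: near_eq_cvg.
  apply: nearW => n; congr (cabs (Psi _ - _)).
  by rewrite scalerA mulNr -expr2 sqr_i opprK scale1r.
Qed.

End SymbolSeries.

(** * Taylor's formula for the complex exponential *)
Section ComplexTaylor.
Context {R : realType}.

Definition exp_poly n (z : R[i]) : R[i] := \sum_(l < n) z ^+ l / (l`!)%:R.

Let is_derive_rpoly (r : nat -> R) n (s : R) :
  is_derive s (1 : R) (fun u : R => \sum_(l < n.+1) r l * u ^+ l)
    (\sum_(l < n) r l.+1 * (l.+1%:R * s ^+ l)).
Proof.
elim: n => [|n IH].
  rewrite big_ord0 (_ : (fun _ => _) = cst (r 0%N)); first exact: is_derive_cst.
  by apply/funext => u; rewrite big_ord_recl big_ord0 expr0 mulr1 addr0.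
rewrite (_ : (fun _ => _) = (fun u : R => (\sum_(l < n.+1) r l * u ^+ l) + r n.+1 * u ^+ n.+1));
  last by apply/funext => u; rewrite big_ord_recr.
have h : is_derive s (1 : R) (fun u : R => r n.+1 * u ^+ n.+1) (r n.+1 * (n.+1%:R * s ^+ n)).
  have h0 := is_deriveZ (r n.+1) (is_deriveX n.+1 (is_derive_id s (1 : R))).
  have e0 : (fun u : R => r n.+1 * u ^+ n.+1) = r n.+1 \*: ((id : R -> R) ^+ n.+1).
    by apply/funext => u; rewrite exprfctE.
  by rewrite e0; apply: (is_derive_eq h0); rewrite /GRing.scale /= mulr1.
by rewrite big_ord_recr /=; exact: (is_deriveD IH h).
Qed.

Let taylor_rem n (z : R[i]) (s : R) : R[i] := cexp (s%:C%C * z) - exp_poly n (s%:C%C * z).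

(** The derivative in s of the remainder of order n + 1 is z times the remainder
    of order n. The mean value theorem is applied to the real and imaginary
    parts, whence the factor 2 at each step. *)
Let taylor_rem_bound n (z : R[i]) (s : R) : 0 <= s <= 1 ->
  cabs (taylor_rem n z s) <= (2 * cabs z) ^+ n * expR (cabs z).
Proof.
elim: n s => [|n IH] s /andP[s0 s1].
  rewrite /taylor_rem /exp_poly big_ord0 subr0 expr0 mul1r cabs_cexp ReZ ler_expR.
  rewrite (le_trans (ler_norm _))// normrM ger0_norm//.
  by rewrite (le_trans (ler_wpM2l s0 (Re_le_cabs z)))// ler_piMl ?cabs_ge0.
have step (p : R[i] -> R) (f df : R -> R) : (forall w, `|p w| <= cabs w) ->
    (forall u, f u = p (taylor_rem n.+1 z u)) ->
    (forall u, df u = p (z * taylor_rem n z u)) ->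
    (forall u : R, is_derive u (1 : R) f (df u)) -> f 0 = 0 ->
    `|p (taylor_rem n.+1 z s)| <= cabs z * ((2 * cabs z) ^+ n * expR (cabs z)).
  move=> pl fE dfE dfd f0; rewrite -fE.
  have cf : {within `[0, s], continuous f}.
    apply: continuous_subspaceT => u; apply/differentiable_continuous/derivable1_diffP.
    exact: (@ex_derive _ _ _ _ _ _ _ (dfd u)).
  have [c cI e] := MVT_segment s0 (fun x _ => dfd x) cf.
  rewrite -[f s]subr0 -f0 e dfE subr0 normrM (ger0_norm s0).
  have c01 : 0 <= c <= 1.
    by move: cI; rewrite in_itv /= => /andP[-> /le_trans ->].
  apply: (@le_trans _ _ (cabs (z * taylor_rem n z c) * 1)).
    by apply: ler_pM.
  by rewrite mulr1 cabsM ler_wpM2l ?cabs_ge0// IH.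
apply: le_trans (cabs_le_ReIm _) _.
have taylorE p (pD : {morph p : x y / x + y >-> (x + y : R)}) (pN : {morph p : x / - x >-> - x})
    (pZ : forall (r : R) w, p (r%:C%C * w) = r * p w) k (u : R) :
    p (exp_poly k (u%:C%C * z)) = \sum_(l < k) p (z ^+ l / (l`!)%:R) * u ^+ l.
  rewrite /exp_poly; elim: k => [|k IHk].
    by rewrite !big_ord0; have := pZ 0 0; rewrite mulr0 mul0r.
  rewrite !big_ord_recr /= pD IHk; congr (_ + _).
  have -> : (u%:C%C * z) ^+ k / (k`!)%:R = (u ^+ k)%:C%C * (z ^+ k / (k`!)%:R).
    by rewrite exprMn rmorphXn mulrA.
  by rewrite pZ mulrC.
have zE l : z * (z ^+ l / (l`!)%:R) = (l.+1%:R)%:C%C * (z ^+ l.+1 / (l.+1`!)%:R).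
  rewrite rmorph_nat exprS factS natrM; field.
  by rewrite pnatr_eq0 -lt0n fact_gt0 nat1r pnatr_eq0.
have polyE p (pD : {morph p : x y / x + y >-> (x + y : R)}) (pN : {morph p : x / - x >-> - x})
    (pZ : forall (r : R) w, p (r%:C%C * w) = r * p w) (u : R) :
    p (z * exp_poly n (u%:C%C * z)) =
    \sum_(l < n) p (z ^+ l.+1 / (l.+1`!)%:R) * (l.+1%:R * u ^+ l).
  rewrite /exp_poly; elim: (n) => [|k IHk].
    by rewrite !big_ord0 mulr0; have := pZ 0 0; rewrite mulr0 mul0r.
  rewrite !big_ord_recr /= mulrDr pD IHk; congr (_ + _).
  have -> : z * ((u%:C%C * z) ^+ k / (k`!)%:R) = (u ^+ k)%:C%C * (z * (z ^+ k / (k`!)%:R)).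
    by rewrite exprMn rmorphXn; ring.
  by rewrite pZ zE pZ; ring.
have -> : (2 * cabs z) ^+ n.+1 * expR (cabs z) =
    cabs z * ((2 * cabs z) ^+ n * expR (cabs z)) +
    cabs z * ((2 * cabs z) ^+ n * expR (cabs z)) by rewrite exprS; ring.
apply: lerD.
- apply: (step (@complex.Re R) (fun u => expR (u * complex.Re z) * cos (u * complex.Im z) -
     \sum_(l < n.+1) complex.Re (z ^+ l / (l`!)%:R) * u ^+ l)
   (fun u => expR (u * complex.Re z) * (complex.Re z * cos (u * complex.Im z) -
      complex.Im z * sin (u * complex.Im z)) -
      \sum_(l < n) complex.Re (z ^+ l.+1 / (l.+1`!)%:R) * (l.+1%:R * u ^+ l))) => [w|u|u|u|].
  + exact: Re_le_cabs.
  + rewrite /taylor_rem ReD ReN taylorE; [|exact: ReD|exact: ReN|exact: ReZ].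
    by congr (_ - _); rewrite /cexp !(ReZ, ImZ).
  + rewrite /taylor_rem [in RHS]mulrBr ReD ReN polyE; [|exact: ReD|exact: ReN|exact: ReZ].
    by congr (_ - _); rewrite Re_mul /cexp !(ReZ, ImZ) /=; ring.
  + have h := is_derive_rpoly (fun l => complex.Re (z ^+ l / (l`!)%:R)) n u.
    by apply: is_derive_eq; rewrite /GRing.scale /=; ring.
  + rewrite !mul0r expR0 cos0 mul1r big_ord_recl expr0 divr1 big1 ?addr0 ?mulr1 ?subrr//.
    by move=> l _; rewrite expr0n /= mulr0.
- apply: (step (@complex.Im R) (fun u => expR (u * complex.Re z) * sin (u * complex.Im z) -
     \sum_(l < n.+1) complex.Im (z ^+ l / (l`!)%:R) * u ^+ l)
   (fun u => expR (u * complex.Re z) * (complex.Re z * sin (u * complex.Im z) +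
      complex.Im z * cos (u * complex.Im z)) -
      \sum_(l < n) complex.Im (z ^+ l.+1 / (l.+1`!)%:R) * (l.+1%:R * u ^+ l))) => [w|u|u|u|].
  + exact: Im_le_cabs.
  + rewrite /taylor_rem ImD ImN taylorE; [|exact: ImD|exact: ImN|exact: ImZ].
    by congr (_ - _); rewrite /cexp !(ReZ, ImZ).
  + rewrite /taylor_rem [in RHS]mulrBr ImD ImN polyE; [|exact: ImD|exact: ImN|exact: ImZ].
    by congr (_ - _); rewrite Im_mul /cexp !(ReZ, ImZ) /=; ring.
  + have h := is_derive_rpoly (fun l => complex.Im (z ^+ l / (l`!)%:R)) n u.
    by apply: is_derive_eq; rewrite /GRing.scale /=; ring.
  + rewrite !mul0r expR0 sin0 mul1r big_ord_recl expr0 divr1 mulr1 big1 /= ?addr0 ?subrr//.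
    by move=> l _; rewrite expr0n /= mulr0.
Qed.

Lemma cexp_taylor n (z : R[i]) :
  cabs (cexp z - exp_poly n z) <= (2 * cabs z) ^+ n * expR (cabs z).
Proof.
have := @taylor_rem_bound n z 1; rewrite /taylor_rem rmorph1 mul1r; apply.
by rewrite ler01 lexx.
Qed.

End ComplexTaylor.

(** * Finite measures with prescribed moments *)
Section Grid.
Context {R : realType}.

Lemma vandermonde_dual n : exists W : 'I_n -> 'I_n -> R[i],
  forall b b' : 'I_n, \sum_(g < n) (g%:R : R[i]) ^+ b * W g b' = (b == b')%:R.
Proof.
pose V : 'M[R[i]]_n := Vandermonde n (\row_j (j : nat)%:R).
have Vu : V \in unitmx.
  rewrite unitmxE det_Vandermonde unitfE prodf_seq_neq0; apply/allP => i _ /=.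
  rewrite prodf_seq_neq0; apply/allP => j _; apply/implyP => ij /=.
  by rewrite !mxE subr_eq0 eqr_nat gtn_eqF.
exists (fun g b => invmx V g b) => b b'.
have /matrixP/(_ b b') := mulmxV Vu; rewrite !mxE => <-.
by apply: eq_bigr => g _; rewrite !mxE.
Qed.

Variable d : nat.

Definition gridpt n (g : {ffun 'I_d -> 'I_n}) : 'rV[R]_d := \row_j (g j)%:R.

(** The weights are products of columns of the inverse of a Vandermonde matrix. *)
Lemma grid_moments n (m : multi_index d -> R[i]) :
  exists kap : {ffun 'I_d -> 'I_n} -> R[i], forall b : {ffun 'I_d -> 'I_n},
  \sum_g kap g * \prod_j (g j)%:R ^+ b j = m (box_index b).
Proof.
have [W hW] := vandermonde_dual n.
exists (fun g => \sum_b m (box_index b) * \prod_j W (g j) (b j)) => b.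
transitivity (\sum_(b' : {ffun 'I_d -> 'I_n}) m (box_index b') *
    \prod_j \sum_(g < n) (g%:R : R[i]) ^+ b j * W g (b' j)).
  under eq_bigr do rewrite mulr_suml.
  rewrite exchange_big /=; apply: eq_bigr => b' _.
  rewrite bigA_distr_bigA mulr_sumr; apply: eq_bigr => g _ /=.
  by rewrite -mulrA; congr (_ * _); rewrite -big_split; apply: eq_bigr => j _; rewrite mulrC.
rewrite (bigD1 b)//= [X in m _ * X]big1 ?mulr1; last first.
  by move=> j _; rewrite hW eqxx.
rewrite big1 ?addr0// => b' bb'.
have [j bj] : exists j, b j != b' j.
  by apply/existsP; apply: contra_neqT bb'; rewrite negb_exists => /forallP e;
    apply/ffunP => j; apply/eqP; rewrite eq_sym; have := e j; rewrite negbK.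
by rewrite (bigD1 j)//= hW (negPf bj) mul0r mulr0.
Qed.

(** The factors are replaced one at a time. *)
Lemma cabs_prod_diff (I : Type) (r : seq I) (A B : I -> R[i]) (M del : R) : 1 <= M ->
  0 <= del -> (forall i, cabs (A i) <= M) -> (forall i, cabs (B i) <= M) ->
  (forall i, cabs (A i - B i) <= del) ->
  cabs (\prod_(i <- r) A i - \prod_(i <- r) B i) <= (size r)%:R * M ^+ size r * del.
Proof.
move=> M1 d0 hA hB hAB; have M0 : 0 <= M by exact: le_trans M1.
elim: r => [|i r IH]; first by rewrite !big_nil subrr cabs0 mul0r mul0r.
have hP : cabs (\prod_(i <- r) B i) <= M ^+ size r.
  elim: r {IH} => [|j r IH]; first by rewrite big_nil cabs1 expr0.
  by rewrite big_cons cabsM /= exprS ler_pM ?cabs_ge0.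
rewrite !big_cons.
have -> : A i * \prod_(j <- r) A j - B i * \prod_(j <- r) B j =
  A i * (\prod_(j <- r) A j - \prod_(j <- r) B j) + (A i - B i) * \prod_(j <- r) B j by ring.
rewrite (le_trans (cabsD _ _))// !cabsM /=.
apply: (@le_trans _ _ (M * ((size r)%:R * M ^+ size r * del) + del * M ^+ size r)).
  by apply: lerD; apply: ler_pM => //; exact: cabs_ge0.
apply: (@le_trans _ _ (M * ((size r)%:R * M ^+ size r * del) + M * (del * M ^+ size r))).
  by rewrite lerD2l ler_peMl// mulr_ge0// exprn_ge0.
by rewrite le_eqVlt; apply/orP; left; apply/eqP; rewrite exprS -natr1; ring.
Qed.

End Grid.

(** * Graphs as unordered families of vertices *)
Section GraphCount.
Context {K : numFieldType}.
Local Open Scope set_scope.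

Section OrderedFamilies.
Variables (T : finType) (w : bool * {set T} -> K).

(** This is is_graph for an arbitrary finite type of legs. *)
Definition graph_like (G : {set bool * {set T}}) : bool :=
  [&& [forall a : T, #|[set v in G | a \in v.2]| == 1%N],
      [forall v in G, ~~ v.1 ==> (1 <= #|v.2|)%N] &
      [forall v in G, v.1 ==> (#|v.2| == 1%N)]].

Definition admissible (v : bool * {set T}) : bool :=
  if v.1 then #|v.2| == 1%N else (0 < #|v.2|)%N.

Definition covers k (h : {ffun 'I_k -> bool * {set T}}) : bool :=
  [forall a : T, #|[set i | a \in (h i).2]| == 1%N].

(** The legs are distributed by u.1 over k vertices, whose types are u.2. *)
Definition assign k (u : {ffun T -> 'I_k} * {ffun 'I_k -> bool}) :
  {ffun 'I_k -> bool * {set T}} := [ffun i => (u.2 i, [set a | u.1 a == i])].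

Lemma assign_inj k : injective (@assign k).
Proof.
move=> [f c] [f' c'] /ffunP e; congr pair; apply/ffunP => a.
  have := e (f a); rewrite !ffunE => -[_ /setP/(_ a)].
  by rewrite !inE eqxx => /esym/eqP.
by have := e a; rewrite !ffunE => -[].
Qed.

Lemma assign_image k : [set assign u | u : {ffun T -> 'I_k} * {ffun 'I_k -> bool}] =
  [set h | covers h].
Proof.
apply/setP => h; rewrite inE; apply/imsetP/idP => [[[f c] _ ->]|/forallP hc].
  apply/forallP => a; apply/cards1P; exists (f a); apply/setP => i.
  by rewrite !inE ffunE inE eq_sym.
have ex a : exists i, [set i | a \in (h i).2] == [set i].
  by have /cards1P[i e] := hc a; exists i; apply/eqP.
have fP a i : (a \in (h i).2) = (xchoose (ex a) == i).
  by have /eqP/setP/(_ i) := xchooseP (ex a); rewrite !inE eq_sym.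
exists ([ffun a => xchoose (ex a)], [ffun i => (h i).1]) => //.
apply/ffunP => i; rewrite !ffunE /=; case: (h i) (fP ^~ i) => b B /= e.
by congr pair; apply/setP => a; rewrite inE ffunE e.
Qed.

Lemma sum_assign k (F : {ffun 'I_k -> bool * {set T}} -> K) :
  \sum_(f : {ffun T -> 'I_k}) \sum_(c : {ffun 'I_k -> bool}) F (assign (f, c)) =
  \sum_(h | covers h) F h.
Proof.
rewrite pair_bigA /=; transitivity (\sum_(h in [set assign u | u : {ffun T -> 'I_k} * {ffun 'I_k -> bool}]) F h).
  rewrite big_imset /=; last by move=> u v _ _; exact: assign_inj.
  by apply: eq_bigr => -[].
by rewrite assign_image; apply: eq_bigl => h; rewrite inE.
Qed.

Lemma admissible_gt0 v : admissible v -> (0 < #|v.2|)%N.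
Proof. by rewrite /admissible; case: v.1 => // /eqP->. Qed.

Lemma cover_inj k (h : {ffun 'I_k -> bool * {set T}}) :
  covers h -> (forall i, admissible (h i)) -> injective h.
Proof.
move=> /forallP hc adm i j hij.
have /card_gt0P[a ai] := admissible_gt0 (adm i).
have /cards1P[l e] := hc a.
have il : i \in [set l] by rewrite -e inE.
have jl : j \in [set l] by rewrite -e inE -hij.
by move: il jl; rewrite !inE => /eqP-> /eqP->.
Qed.

Lemma graph_like_image k (h : {ffun 'I_k -> bool * {set T}}) : injective h ->
  graph_like (h @: 'I_k) = covers h && [forall i, admissible (h i)].
Proof.
move=> hi; rewrite /graph_like /covers; congr (_ && _).
  apply: eq_forallb => a; rewrite -(card_imset _ hi); congr (#|pred_of_set _| == _).
  apply/setP => v; rewrite !inE; apply/andP/imsetP => [[/imsetP[i _ ->] ai] | [i + ->]].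
    by exists i; rewrite ?inE.
  by rewrite inE => ai; split => //; exact: imset_f.
apply/andP/forallP => [[/forall_inP h1 /forall_inP h2] i|adm].
  have hI : h i \in h @: 'I_k by exact: imset_f.
  have := h1 _ hI; have := h2 _ hI; rewrite /admissible.
  by case: (h i).1.
split; apply/forall_inP => v /imsetP[i _ ->]; have := adm i; rewrite /admissible;
  by case: (h i).1.
Qed.

Hypothesis w0 : forall v, ~~ admissible v -> w v = 0.

(** A family of admissible vertices that covers each leg once is injective, as
    its vertices are joined to disjoint nonempty sets of legs. Hence a graph
    with k vertices is the image of k! such families. *)
Lemma sum_covers k : \sum_(h : {ffun 'I_k -> bool * {set T}} | covers h) \prod_i w (h i) =
  (k`!)%:R * \sum_(G | graph_like G && (#|G| == k)) \prod_(v in G) w v.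
Proof.
rewrite (bigID (fun h : {ffun 'I_k -> bool * {set T}} => [forall i, admissible (h i)]))/= [X in _ + X]big1 ?addr0; last first.
  move=> h /andP[_]; rewrite negb_forall => /existsP[i hi].
  by rewrite (bigD1 i)//= w0 ?mul0r.
rewrite (partition_big (fun h : {ffun 'I_k -> bool * {set T}} => h @: 'I_k)
   (fun G => graph_like G && (#|G| == k))) /=; last first.
  move=> h /andP[hc /forallP adm]; have hi := cover_inj hc adm.
  by rewrite graph_like_image// hc card_imset// card_ord eqxx andbT; apply/forallP.
rewrite mulr_sumr; apply: eq_bigr => G /andP[gG /eqP cG].
transitivity (\sum_(h in [set h : {ffun 'I_k -> bool * {set T}} in ffun_on (mem G) | injectiveb h])
   \prod_(v in G) w v); last first.
  by rewrite sumr_const card_inj_ffuns_on card_ord cG ffactnn mulr_natl.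
apply: eq_big => [h|h /andP[/andP[hc /forallP adm] /eqP <-]]; last first.
  by rewrite big_imset /=; [apply: eq_bigl => i; rewrite inE|move=> i j _ _; exact: cover_inj].
rewrite !inE; apply/andP/andP => [[/andP[hc /forallP adm] /eqP hG] | [/ffun_onP hG /injectiveP hi]].
  split; last by apply/injectiveP; exact: cover_inj.
  by apply/ffun_onP => i; rewrite -hG; exact: imset_f.
have e : h @: 'I_k = G.
  apply/eqP; rewrite eqEcard card_imset// card_ord cG leqnn andbT.
  by apply/fintype.subsetP => v /imsetP[i _ ->]; exact: hG.
by rewrite -graph_like_image// e.
Qed.

Lemma graph_like_card G : graph_like G -> (#|G| <= #|T|)%N.
Proof.
move=> /and3P[/forallP h1 /forall_inP h2 /forall_inP h3].
have adm v : v \in G -> (0 < #|v.2|)%N.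
  by move=> vG; have := h2 v vG; have := h3 v vG; case: v.1 => /= [/eqP->|].
have [->//|/card_gt0P[v0 v0G]] := posnP #|G|.
have /card_gt0P[a0 _] := adm _ v0G.
pose f (v : bool * {set T}) : T := odflt a0 [pick a in v.2].
have fP v : v \in G -> f v \in v.2.
  move=> vG; rewrite /f; case: pickP => //= e.
  by have /card_gt0P[a] := adm v vG; have := e a => /= ->.
rewrite -(card_in_imset (f := f)) ?max_card// => v v' vG v'G e.
have /cards1P[u hu] := h1 (f v).
have vu : v \in [set u] by rewrite -hu inE vG fP.
have v'u : v' \in [set u] by rewrite -hu inE v'G e fP.
by move: vu v'u; rewrite !inE => /eqP-> /eqP->.
Qed.

(** The factor 1/k! cancels the number of orderings of the vertices of a graph. *)
Lemma sum_graph_like n : (#|T| < n)%N ->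
  \sum_(k < n) (k`!)%:R^-1 * (\sum_(f : {ffun T -> 'I_k})
     \prod_i \sum_(c : bool) w (c, [set a | f a == i])) =
  \sum_(G | graph_like G) \prod_(v in G) w v.
Proof.
move=> Tn; transitivity (\sum_(k < n) \sum_(G | graph_like G && (#|G| == k)) \prod_(v in G) w v).
  apply: eq_bigr => k _; rewrite -[RHS](mulKf (x := (k`!)%:R)); last first.
    by rewrite pnatr_eq0 -lt0n fact_gt0.
  congr (_ * _); rewrite -sum_covers -sum_assign; apply: eq_bigr => f _.
  rewrite bigA_distr_bigA; apply: eq_bigr => c _; apply: eq_bigr => i _.
  by rewrite ffunE.
rewrite (exchange_big_dep graph_like) /=; last by move=> k G _ /andP[].
apply: eq_bigr => G gG; have cn : (#|G| < n)%N by exact: leq_ltn_trans (graph_like_card gG) Tn.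
rewrite (big_pred1 (Ordinal cn))//= => k; rewrite gG /=.
by apply/eqP/eqP => [e|->//]; apply/val_inj.
Qed.

End OrderedFamilies.

(** Each leg chooses one of the k points, and the sum over a point involves only
    the legs that have chosen it. *)
Lemma prod_sum_moments (T D : finType) (A : finType) (kap : A -> K) (y : A -> D -> K) (X : T -> D) k :
  \sum_(g : {ffun 'I_k -> A}) (\prod_i kap (g i)) * \prod_(l : T) (\sum_i y (g i) (X l)) =
  \sum_(f : {ffun T -> 'I_k}) \prod_i \sum_(a : A) kap a * \prod_(l in [set l | f l == i]) y a (X l).
Proof.
transitivity (\sum_(g : {ffun 'I_k -> A}) \sum_(f : {ffun T -> 'I_k})
   \prod_i (kap (g i) * \prod_(l in [set l | f l == i]) y (g i) (X l))).
  apply: eq_bigr => g _; rewrite bigA_distr_bigA mulr_sumr; apply: eq_bigr => f _.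
  rewrite big_split; congr (_ * _) => /=.
  rewrite (partition_big f xpredT)//=; apply: eq_bigr => i _.
  by apply: eq_big => [l|l /eqP <-]; rewrite ?inE.
rewrite exchange_big /=; apply: eq_bigr => f _.
by rewrite bigA_distr_bigA.
Qed.

End GraphCount.

(** * The graph expansion of the moments of a power of V *)
Section GraphExpansion.
Context {R : realType}.

(** Distributivity for sums over function spaces with different domains: a
    family of functions on the J i is a function on their disjoint union. *)
Lemma prod_sum_dffun (K : comNzRingType) (I D : finType) (J : I -> finType)
    (F : forall i, {ffun J i -> D} -> K) :
  \prod_i \sum_(Y : {ffun J i -> D}) F i Y =
  \sum_(X : {ffun {i : I & J i} -> D}) \prod_i F i [ffun s => X (Tagged J s)].
Proof.
pose T_ i : finType := {ffun J i -> D}.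
pose P_ i : {ffun T_ i -> K} := [ffun Y => F i Y].
transitivity (\sum_(t : fprod T_) \prod_i P_ i (t i)).
  rewrite (big_fprod _ _ P_) -(bigA_distr_big_dep (fun i => tagged_with T_ i) (fun i u => untag 0 (P_ i) u)); apply: eq_bigr => i _.
  rewrite -(big_tag (fun i : I => P_ i)).
  by apply: eq_bigr => Y _; rewrite ffunE.
pose to (X : {ffun {i : I & J i} -> D}) : fprod T_ :=
  fprod_of_fun (fun i => [ffun s => X (Tagged J s)] : T_ i).
pose from (t : fprod T_) : {ffun {i : I & J i} -> D} := [ffun u => t (tag u) (tagged u)].
rewrite (reindex to) /=.
  by apply: eq_bigr => X _; apply: eq_bigr => i _; rewrite ffunE fprodE.
exists from => [X _|t _].
  by apply/ffunP => -[i s]; rewrite ffunE /= fprodE ffunE.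
by apply/fprodP => i; rewrite fprodE; apply/ffunP => s; rewrite !ffunE.
Qed.

Context {d : nat}.
Variables (pbar : nat) (lam : forall p, tensor R d p).

Definition couplings m (p : valence pbar m) (X : {ffun leg p -> 'I_d}) : R :=
  \prod_(j < m) lam (p j) [ffun s => X (Tagged (fun n => 'I_(p n)) s)].

Lemma potentialX m (y : 'rV[R]_d) : potential pbar lam y ^+ m =
  \sum_(p : valence pbar m) \sum_(X : {ffun leg p -> 'I_d})
    couplings X * \prod_l y 0 (X l).
Proof.
transitivity (\prod_(j < m) \sum_(p < pbar.+1) tensor_form (lam p) y).
  by rewrite prodr_const card_ord.
rewrite bigA_distr_bigA; apply: eq_bigr => p _ /=.
rewrite (@prod_sum_dffun _ _ _ (fun j => 'I_(p j)) (fun j Y => lam (p j) Y * \prod_s y 0 (Y s))) /=.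
apply: eq_bigr => X _; rewrite big_split; congr (_ * _) => /=.
rewrite (sig_big_dep (fun _ => true) (fun _ _ => true) (fun j s => y 0 ([ffun s => X (Tagged (fun n => 'I_(p n)) s)] s))) /=.
by apply: eq_bigr => -[j s] _; rewrite ffunE.
Qed.

Variables (Psi : 'rV[R[i]]_d -> R[i]) (t : R) (phi : 'rV[R]_d).
Variables (A : finType) (kap : A -> R[i]) (pt : A -> 'rV[R]_d).

(** The Feynman rule for an empty vertex, extended by 0 to the outer vertices
    that are not joined to exactly one leg. A moment of kap is then the sum of
    the factors of the inner and of the outer vertex with the same legs. *)
Definition vertex_factor (T : finType) (X : T -> 'I_d) (v : bool * {set T}) : R[i] :=
  if v.1 then if #|v.2| == 1%N then \prod_(b in v.2) (phi 0 (X b))%:C%C else 0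
  else t%:C%C * Ccoef Psi [seq X a | a <- enum v.2].

Variable n : nat.
Hypothesis moments : forall s : seq 'I_d, (size s < n)%N ->
  \sum_a kap a * \prod_(j <- s) (pt a 0 j)%:C%C =
  t%:C%C * Ccoef Psi s + (if s is [:: j] then (phi 0 j)%:C%C else 0).
Hypothesis Ccoef_nil : Ccoef Psi [::] = 0.

Lemma vertex_moments (T : finType) (X : T -> 'I_d) (B : {set T}) : (#|T| < n)%N ->
  \sum_a kap a * \prod_(l in B) (pt a 0 (X l))%:C%C = \sum_(c : bool) vertex_factor X (c, B).
Proof.
move=> Tn; have sB : (size [seq X l | l <- enum B] < n)%N.
  by rewrite size_map -cardE (leq_ltn_trans (max_card _)).
have := moments sB; under eq_bigr do rewrite big_map big_enum /=.
move=> ->; rewrite [RHS]big_bool /= addrC; congr (_ + _); rewrite /vertex_factor /=.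
have [/cards1P[l ->]|c1] := boolP (#|B| == 1%N).
  by rewrite enum_set1 big_set1.
move: c1; rewrite cardE; case: (enum B) => [|l [|l' s]] //=.
Qed.

Lemma vertex_factor0 (T : finType) (X : T -> 'I_d) v : ~~ admissible v ->
  vertex_factor X v = 0 :> R[i].
Proof.
case: v => -[] B; rewrite /admissible /vertex_factor /=; first by move/negPf->.
by rewrite -eqn0Ngt cards_eq0 => /eqP->; rewrite enum_set0 /= Ccoef_nil mulr0.
Qed.

(** Moments of blocks of legs are sums over the two types of a vertex. *)
Lemma graph_expansion_legs (T : finType) (X : T -> 'I_d) : (#|T| < n)%N ->
  \sum_(k < n) (k`!)%:R^-1 * \sum_(g : {ffun 'I_k -> A}) (\prod_i kap (g i)) *
     \prod_l ((\sum_i pt (g i)) 0 (X l))%:C%C =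
  \sum_(G | graph_like G) \prod_(v in G) vertex_factor X v.
Proof.
move=> Tn; rewrite -(@sum_graph_like _ _ _ (@vertex_factor0 T X) n)//.
apply: eq_bigr => k _; congr (_ * _).
rewrite -[RHS](eq_bigr _ (fun f _ => eq_bigr _ (fun i _ => vertex_moments X _ Tn))).
transitivity (\sum_(g : {ffun 'I_k -> A}) (\prod_i kap (g i)) *
    \prod_l \sum_i (pt (g i) 0 (X l))%:C%C : R[i]).
  apply: eq_bigr => g _; congr (_ * _); apply: eq_bigr => l _.
  by rewrite summxE rmorph_sum.
exact: (prod_sum_moments kap (fun a j => (pt a 0 j)%:C%C) X).
Qed.

Lemma graph_valueE m (G : pregraph pbar m) : is_graph (vertices G) ->
  graph_value Psi lam G t phi =
  \sum_(X : {ffun leg (valence_of G) -> 'I_d}) (couplings X)%:C%C *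
    \prod_(v in vertices G) vertex_factor X v.
Proof.
move=> /and3P[_ _ /forall_inP out]; apply: eq_bigr => X _.
rewrite rmorph_prod mulrC; congr (_ * _).
rewrite [RHS](bigID (@is_outer pbar m (valence_of G)))/=; congr (_ * _).
  apply: eq_bigr => -[c B] /andP[vG]; rewrite /is_outer /= => c1.
  by have := out _ vG; rewrite /is_outer /joined /vertex_factor /= c1 /= => ->.
by apply: eq_bigr => -[c B] /andP[_]; rewrite /is_inner /vertex_factor /= => /negPf->.
Qed.

(** A graph has at most as many empty vertices as legs, so that the terms with
    k >= n would vanish. Couplings that are 0 contribute nothing to the power
    of V, which is the restriction on the valences in Fbar. *)
Lemma graph_expansion m : (m * pbar < n)%N ->
  \sum_(k < n) (k`!)%:R^-1 * \sum_(g : {ffun 'I_k -> A}) (\prod_i kap (g i)) *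
     (potential pbar lam (\sum_i pt (g i)) ^+ m)%:C%C =
  \sum_(G in Fbar pbar lam m) graph_value Psi lam G t phi.
Proof.
move=> mn; have legs (p : valence pbar m) : (#|leg p| < n)%N.
  apply: leq_ltn_trans mn; rewrite card_tagged sumnE big_map big_enum /=.
  rewrite -[X in (_ <= X * _)%N]card_ord -sum_nat_const; apply: leq_sum => j _.
  by rewrite card_ord -ltnS.
transitivity (\sum_(p : valence pbar m) \sum_(X : {ffun leg p -> 'I_d}) (couplings X)%:C%C *
    \sum_(G | graph_like G) \prod_(v in G) vertex_factor X v).
  transitivity (\sum_(k < n) \sum_(p : valence pbar m) \sum_(X : {ffun leg p -> 'I_d})
      (k`!)%:R^-1 * \sum_(g : {ffun 'I_k -> A}) (\prod_i kap (g i)) *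
        (couplings X * \prod_l (\sum_i pt (g i)) 0 (X l))%:C%C).
    apply: eq_bigr => k _; under [RHS]eq_bigr do rewrite -mulr_sumr.
    rewrite -mulr_sumr; congr (_ * _); under [RHS]eq_bigr do rewrite exchange_big /=.
    rewrite exchange_big /=; apply: eq_bigr => g _; rewrite potentialX rmorph_sum mulr_sumr.
    by apply: eq_bigr => p _; rewrite rmorph_sum mulr_sumr.
  rewrite exchange_big; apply: eq_bigr => p _ /=.
  rewrite exchange_big; apply: eq_bigr => X _ /=.
  rewrite -graph_expansion_legs ?legs// mulr_sumr; apply: eq_bigr => k _.
  rewrite mulrCA; congr (_ * _); rewrite mulr_sumr; apply: eq_bigr => g _.
  by rewrite real_complexM mulrCA; do 2 congr (_ * _); exact: rmorph_prod.
rewrite (eq_bigl (fun G : pregraph pbar m => [forall j, lam (valence_of G j) != 0] && is_graph (vertices G)));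
  last by move=> G; rewrite inE.
under [RHS]eq_bigr => G /andP[_ gG] do rewrite graph_valueE//.
rewrite -(sig_big_dep (fun p : valence pbar m => [forall j, lam (p j) != 0]) (fun p => @is_graph pbar m p)
  (fun p G => \sum_(X : {ffun leg p -> 'I_d}) (couplings X)%:C%C *
    \prod_(v in G) vertex_factor X v)).
rewrite [LHS](bigID (fun p : valence pbar m => [forall j, lam (p j) != 0]))/= [X in _ + X]big1 ?addr0; last first.
  move=> p; rewrite negb_forall => /existsP[j]; rewrite negbK => /eqP l0.
  rewrite big1// => X _; rewrite /couplings (bigD1 j)//= l0 ffunE mul0r.
  by rewrite rmorph0 mul0r.
apply: eq_bigr => p _; under eq_bigr do rewrite mulr_sumr.
by rewrite exchange_big.
Qed.

End GraphExpansion.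

(** * Approximation of the symbol by an exponential of grid characters *)
Section GridSymbol.
Context {R : realType} {d : nat}.
Local Notation MI := (multi_index d).
Local Notation grid n := {ffun 'I_d -> 'I_n}.

(** The Fourier transform of the measure kap. *)
Definition theta n (kap : grid n -> R[i]) (x : 'rV[R]_d) : R[i] :=
  \sum_g kap g * cis (- dotp x (gridpt g)).

Lemma cabs_i : cabs ('i%C : R[i]) = 1.
Proof. by rewrite /= expr0n /= add0r expr1n sqrtr1. Qed.

Lemma cabs_nat k : cabs (k%:R : R[i]) = k%:R.
Proof. by rewrite -(rmorph_nat (real_complex R)) cabs_real ger0_norm. Qed.

Lemma cabs_theta n (kap : grid n -> R[i]) x : cabs (theta kap x) <= \sum_g cabs (kap g).
Proof.
rewrite (le_trans (cabs_sum _ _ _))//; apply: ler_sum => g _.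
by rewrite cabsM cabs_cis mulr1.
Qed.

(** Each character is a product over the coordinates, in which the
    exponentials are replaced by their Taylor polynomials of degree n - 1. The
    product of these is a sum over the box of multi-indices with entries < n,
    and the moments of kap turn it into the series with coefficients e. *)
Lemma theta_taylor n (kap : grid n -> R[i]) (e : MI -> R[i]) :
  (forall b : grid n, \sum_g kap g * \prod_j (g j)%:R ^+ b j =
     e (box_index b) * 'i%C ^+ mdeg (box_index b) * (mfact (box_index b))%:R) ->
  exists2 C, 0 <= C & forall x, `|x| <= 1 ->
  cabs (theta kap x - box_sum n (fun a => e a * (dmono mono0 a x)%:C%C)) <= C * `|x| ^+ n.
Proof.
move=> hm.
pose D : R := (2 * n%:R) ^+ n * expR n%:R.
have D0 : 0 <= D by rewrite mulr_ge0 ?expR_ge0 ?exprn_ge0 ?mulr_ge0.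
pose M : R := 1 + D.
pose E (g : grid n) : R := d%:R * M ^+ d * D.
exists (\sum_(g : grid n) cabs (kap g) * E g).
  apply: sumr_ge0 => g _; rewrite mulr_ge0 ?cabs_ge0// !mulr_ge0 ?exprn_ge0//.
  by rewrite addr_ge0.
move=> x x1.
pose w (g : grid n) j : R[i] := Complex 0 (- (x 0 j * (g j)%:R)).
have wE g j : w g j = - 'i%C * (x 0 j)%:C%C * (g j)%:R.
  by rewrite /w -(rmorph_nat (real_complex R)); apply: complex_eq;
     rewrite /= ?(mul0r, mulr0, subr0, addr0, add0r, oppr0, mul1r, mulN1r, mulNr, sub0r, oppr0).
have cw g j : cabs (w g j) <= n%:R * `|x|.
  rewrite wE !cabsM cabsN cabs_i mul1r cabs_real cabs_nat mulrC.
  by apply: ler_pM => //; [rewrite ler_nat ltnW|exact: norm_coord].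
have cwn g j : cabs (w g j) <= n%:R by rewrite (le_trans (cw g j))// ler_piMr.
pose F g : R[i] := \prod_j exp_poly n (w g j).
have -> : box_sum n (fun a => e a * (dmono mono0 a x)%:C%C) = \sum_g kap g * F g.
  transitivity (\sum_g \sum_(b : grid n) kap g * \prod_j (w g j ^+ b j / ((b j)`!)%:R)); last first.
    by apply: eq_bigr => g _; rewrite -mulr_sumr /F /exp_poly bigA_distr_bigA.
  rewrite exchange_big; apply: eq_bigr => b _ /=.
  have f0 : ((mfact (box_index b))%:R : R[i]) != 0.
    by rewrite pnatr_eq0 -lt0n prodn_gt0// => j; exact: fact_gt0.
  have mE : (mfact (box_index b))%:R = \prod_j ((b j)`!)%:R :> R[i].
    by rewrite natr_prod; apply: eq_bigr => j _; rewrite ffunE.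
  have iE : (- 'i%C) ^+ mdeg (box_index b) = \prod_j (- 'i%C) ^+ b j :> R[i].
    rewrite /mdeg (big_morph (fun k => (- 'i%C) ^+ k) (exprD (- 'i%C)) (expr0 (- 'i%C))).
    by apply: eq_bigr => j _; rewrite ffunE.
  have xE : (dmono mono0 (box_index b) x)%:C%C = \prod_j (x 0 j)%:C%C ^+ b j :> R[i].
    by rewrite dmono0E rmorph_prod; apply: eq_bigr => j _; rewrite rmorphXn ffunE.
  transitivity ((\sum_g kap g * \prod_j (g j)%:R ^+ b j) * ((dmono mono0 (box_index b) x)%:C%C *
      (- 'i%C) ^+ mdeg (box_index b) / (mfact (box_index b))%:R)).
    rewrite hm.
    have hi : 'i%C ^+ mdeg (box_index b) * (- 'i%C) ^+ mdeg (box_index b) = 1 :> R[i].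
      by rewrite -exprMn mulrN -expr2 sqr_i opprK expr1n.
    transitivity (e (box_index b) * (dmono mono0 (box_index b) x)%:C%C *
      ('i%C ^+ mdeg (box_index b) * (- 'i%C) ^+ mdeg (box_index b)) *
      ((mfact (box_index b))%:R / (mfact (box_index b))%:R)); last by ring.
    by rewrite hi divff// !mulr1.
  rewrite mulr_suml; apply: eq_bigr => g _; rewrite -mulrA; congr (_ * _).
  rewrite mE iE xE -prodfV -!big_split /=; apply: eq_bigr => j _.
  by rewrite wE !exprMn; ring.
have -> : theta kap x = \sum_g kap g * \prod_j cexp (w g j).
  apply: eq_bigr => g _; congr (_ * _).
  rewrite /dotp -sumrN cis_sum; apply: eq_bigr => j _.
  by rewrite /cis /gridpt mxE.
rewrite -sumrB mulr_suml (le_trans (cabs_sum _ _ _))//; apply: ler_sum => g _.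
rewrite -mulrBr cabsM -mulrA ler_wpM2l ?cabs_ge0// /F.
have h j : cabs (cexp (w g j) - exp_poly n (w g j)) <= D * `|x| ^+ n.
  rewrite (le_trans (cexp_taylor n (w g j)))//.
  rewrite /D mulrAC; apply: ler_pM; rewrite ?expR_ge0 ?exprn_ge0 ?mulr_ge0 ?cabs_ge0//.
    by rewrite -exprMn lerXn2r ?nnegrE ?mulr_ge0 ?cabs_ge0// -mulrA ler_pM2l.
  by rewrite ler_expR.
have -> : E g * `|x| ^+ n = d%:R * M ^+ d * (D * `|x| ^+ n) by rewrite /E mulrA.
have hc j : cabs (cexp (w g j)) = 1 by exact: cabs_cexp_i.
have hx j : cabs (cexp (w g j) - exp_poly n (w g j)) <= D.
  by rewrite (le_trans (h j))// ler_piMr// exprn_ile1.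
have := @cabs_prod_diff R _ (index_enum 'I_d) (fun j => cexp (w g j)) (fun j => exp_poly n (w g j)) M (D * `|x| ^+ n).
have -> : size (index_enum 'I_d) = d by rewrite -[RHS]card_ord cardT enumT.
apply => //.
- by rewrite lerDl.
- by rewrite mulr_ge0// exprn_ge0.
- by move=> j; rewrite hc lerDl.
- move=> j; rewrite -[exp_poly _ _](subrK (cexp (w g j))) addrC.
  by rewrite (le_trans (cabsD _ _))// hc lerD2l cabsBC.
Qed.

End GridSymbol.

Section SymbolApproximation.
Context {R : realType} {d : nat}.
Local Notation MI := (multi_index d).
Local Notation grid n := {ffun 'I_d -> 'I_n}.

Lemma mdeg_mcount (s : seq 'I_d) : mdeg (mcount s) = size s.
Proof.
elim: s => [|j s IH]; rewrite /mdeg; first by apply: big1 => i _; rewrite ffunE.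
under eq_bigr do rewrite ffunE /=.
rewrite big_split /= (bigD1 j)//= eqxx big1 ?addn0 ?add1n => [|i /negPf]; last first.
  by rewrite eq_sym => ->.
by congr _.+1; rewrite -IH; apply: eq_bigr => i _; rewrite ffunE.
Qed.

Lemma prod_mcount (K : comNzRingType) (z : 'I_d -> K) (s : seq 'I_d) :
  \prod_(j <- s) z j = \prod_j z j ^+ mcount s j.
Proof.
elim: s => [|j s IH]; first by rewrite big_nil big1// => i _; rewrite ffunE.
rewrite big_cons IH; under [RHS]eq_bigr do rewrite ffunE /= exprD.
rewrite big_split /=; congr (_ * _); last by apply: eq_bigr => i _; rewrite ffunE.
rewrite (bigD1 j)//= eqxx expr1 big1 ?mulr1// => i /negPf.
by rewrite eq_sym => ->; rewrite expr0.
Qed.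

Lemma mcount_box n (s : seq 'I_d) : (size s < n)%N -> exists b : grid n, box_index b = mcount s.
Proof.
move=> sn; exists [ffun j => Ordinal (leq_ltn_trans (count_size (pred1 j) s) sn)].
by apply/ffunP => j; rewrite !ffunE.
Qed.

Lemma box_index_inj n : injective (@box_index d n).
Proof. by move=> b b' /ffunP e; apply/ffunP => j; apply/val_inj; have := e j; rewrite !ffunE. Qed.

Lemma mcount1_inj j j' : (mcount [:: j] == mcount [:: j'] :> MI) = (j == j').
Proof.
apply/eqP/eqP => [/ffunP/(_ j)|->//]; rewrite !ffunE /= eqxx.
by case: (j' =P j).
Qed.

Lemma mfact_mcount1 j : mfact (mcount [:: j] : MI) = 1%N.
Proof. by rewrite /mfact big1// => i _; rewrite ffunE /= addn0; case: eqP. Qed.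

Lemma dmono_mcount1 j (x : 'rV[R]_d) : dmono mono0 (mcount [:: j]) x = x 0 j.
Proof. by rewrite dmono0E -(prod_mcount (fun j => x 0 j)) big_seq1. Qed.

Lemma box_sum_delta n (b0 : grid n) (F : MI -> R[i]) :
  box_sum n (fun a => (a == box_index b0)%:R * F a) = F (box_index b0).
Proof.
rewrite /box_sum (bigD1 b0)//= eqxx mul1r big1 ?addr0// => b /negPf bb0.
by rewrite (inj_eq (@box_index_inj n)) bb0 mul0r.
Qed.

Lemma cabs_dotp_le (x y : 'rV[R]_d) : `|dotp x y| <= (\sum_j `|y 0 j|) * `|x|.
Proof.
rewrite (le_trans (ler_norm_sum _ _ _))// mulr_suml; apply: ler_sum => j _.
by rewrite normrM mulrC ler_wpM2l// norm_coord.
Qed.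

Lemma enorm_le (x : 'rV[R]_d) : enorm x <= d.+1%:R * `|x|.
Proof.
rewrite -[leRHS]ger0_norm ?mulr_ge0// -sqrtr_sqr ler_wsqrtr//.
apply: (@le_trans _ _ (\sum_(j < d) `|x| ^+ 2)).
  by apply: ler_sum => j _; rewrite -expr2 -[leLHS]ger0_norm ?sqr_ge0// normrX lerXn2r ?nnegrE ?norm_coord.
rewrite sumr_const card_ord -[leLHS]mulr_natl exprMn ler_wpM2r ?exprn_ge0//.
by rewrite -natrX ler_nat; nia.
Qed.

Lemma exp_poly_lipschitz n (z w : R[i]) (M del : R) : 1 <= M -> 0 <= del ->
  cabs z <= M -> cabs w <= M -> cabs (z - w) <= del ->
  cabs (exp_poly n z - exp_poly n w) <= \sum_(l < n) (l%:R * M ^+ l) * del.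
Proof.
move=> M1 del0 zM wM zw; rewrite /exp_poly -sumrB (le_trans (cabs_sum _ _ _))//.
apply: ler_sum => l _; rewrite -mulrBl cabsM.
have h : cabs (z ^+ l - w ^+ l) <= l%:R * M ^+ l * del.
  have := @cabs_prod_diff R _ (nseq l tt) (fun _ => z) (fun _ => w) M del M1 del0.
  by rewrite !big_const_seq !count_predT !size_nseq !iter_mulr !mulr1; apply.
rewrite (le_trans _ h)// ler_piMr ?cabs_ge0//.
rewrite cabsV cabs_nat invf_le1 ?ltr0n ?fact_gt0//.
by rewrite ler1n fact_gt0.
Qed.

Lemma cabs_exp_poly n (z : R[i]) (M : R) : cabs z <= M ->
  cabs (exp_poly n z) <= \sum_(l < n) M ^+ l.
Proof.
move=> zM; rewrite (le_trans (cabs_sum _ _ _))//; apply: ler_sum => l _.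
rewrite cabsM cabsX cabsV cabs_nat; apply: (@le_trans _ _ (cabs z ^+ l)).
  by rewrite ler_piMr ?exprn_ge0 ?cabs_ge0// invf_le1 ?ltr0n ?fact_gt0// ler1n fact_gt0.
by rewrite lerXn2r ?nnegrE ?cabs_ge0// (le_trans (cabs_ge0 z)).
Qed.

Variable Psi : 'rV[R[i]]_d -> R[i].
Hypothesis hPsi : is_symbol Psi.
Variables (t : R) (phi : 'rV[R]_d).
Hypothesis t0 : 0 <= t.

Lemma Ccoef_nil : Ccoef Psi [::] = 0.
Proof.
rewrite /Ccoef /= -[RHS](symbol_0 hPsi); congr Psi.
by apply/rowP => j; rewrite !mxE.
Qed.

(** The condition on the real part makes the propagator grow at most
    polynomially. *)
Lemma propagator_bound : exists L : nat, forall x : 'rV[R]_d,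
  cabs (cexp (t%:C%C * symbol Psi x)) <= (1 + d.+1%:R * `|x|) ^+ L.
Proof.
have [c [c0 hc]] := symbol_log_bound hPsi.
exists (Num.truncn (t * c)).+1 => x.
set L := (Num.truncn _).+1.
have tL : t * c <= L%:R by rewrite ltW// truncnS_gt.
have e0 : 0 <= enorm x by exact: sqrtr_ge0.
rewrite cabs_cexp ReZ; apply: (@le_trans _ _ (expR (L%:R * ln (1 + enorm x)))).
  rewrite ler_expR (le_trans (ler_wpM2l t0 (hc x)))// mulrA ler_wpM2r//.
  by rewrite ln_ge0// lerDl.
rewrite expRM_natl lnK ?posrE ?ltr_wpDr// lerXn2r ?nnegrE ?addr_ge0 ?mulr_ge0//.
by rewrite lerD2l enorm_le.
Qed.

(** The logarithm of the propagator, after the translation by phi. *)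
Definition tilted_symbol x : R[i] := t%:C%C * symbol Psi x - 'i%C * (dotp x phi)%:C%C.

Lemma propagatorE x : cexp (t%:C%C * symbol Psi x) = cis (dotp x phi) * cexp (tilted_symbol x).
Proof.
rewrite /cis -cexpD; congr cexp; rewrite /tilted_symbol addrC.
have -> : Complex 0 (dotp x phi) = 'i%C * (dotp x phi)%:C%C.
  by apply: complex_eq => /=; ring.
by rewrite subrK.
Qed.

(** The weights are chosen so that theta has the Taylor coefficients of the
    tilted symbol. The tilted symbol vanishes at 0, so that the truncation of
    the exponential series also costs |x|^n for small x. For the other x the
    polynomial growth of the propagator is enough, since theta is bounded and
    |x|^n is bounded below. *)
Lemma grid_approximation n : (1 < n)%N -> exists kap : grid n -> R[i],
  (forall s : seq 'I_d, (size s < n)%N ->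
     \sum_g kap g * \prod_(j <- s) (gridpt g 0 j)%:C%C =
     t%:C%C * Ccoef Psi s + (if s is [:: j] then (phi 0 j)%:C%C else 0)) /\
  exists (C : R) (L : nat), 0 <= C /\ forall x,
    cabs (cexp (t%:C%C * symbol Psi x) - cis (dotp x phi) * exp_poly n (theta kap x)) <=
    C * (`|x| ^+ n * (1 + d.+1%:R * `|x|) ^+ L).
Proof.
move=> n1; have n0 : (0 < n)%N by exact: ltnW.
have [c [rho [B [r0 cB ps1 ps2]]]] := symbol_series hPsi.
have B0 : 0 <= B.
  apply: le_trans (cB 0%N); apply: sumr_ge0 => b _.
  by rewrite mulr_ge0 ?cabs_ge0// exprn_ge0// ltW.
pose e (a : MI) : R[i] := t%:C%C * c a - 'i%C * \sum_j (phi 0 j)%:C%C * (a == mcount [:: j])%:R.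
have [kap hk] := @grid_moments R d n (fun a => e a * 'i%C ^+ mdeg a * (mfact a)%:R).
exists kap; split.
  move=> s sn; have [b bE] := mcount_box sn.
  have CE : Ccoef Psi s = c (mcount s) * 'i%C ^+ mdeg (mcount s) * (mfact (mcount s))%:R.
    apply: (pseries_at0 r0 (pseries_partials r0 _ s ps2)) => k; apply: le_trans (cB k).
    by apply: ler_sum => a _; rewrite cabsM cabsX cabs_i expr1n mulr1.
  transitivity (e (mcount s) * 'i%C ^+ mdeg (mcount s) * (mfact (mcount s))%:R).
    rewrite -bE -hk; apply: eq_bigr => g _; congr (_ * _).
    rewrite (prod_mcount (fun j => (gridpt g 0 j)%:C%C)); apply: eq_bigr => j _.
    by rewrite mxE rmorph_nat -bE ffunE.
  rewrite CE /e; rewrite !mulrBl; congr (_ + _); first by ring.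
  case: s {sn bE CE} => [|j [|j' s]].
  - rewrite big1 ?mulr0 ?mul0r ?oppr0// => j _.
    rewrite [_ == _](_ : _ = false) ?mulr0//; apply/eqP => /(congr1 (@mdeg d)).
    by rewrite !mdeg_mcount.
  - rewrite (bigD1 j)//= eqxx big1 ?addr0 => [|i /negPf ij].
      rewrite mdeg_mcount mfact_mcount1 /= !mulr1 expr1.
      have -> : - ('i%C * (phi 0 j)%:C%C * 'i%C) = - ('i%C ^+ 2) * (phi 0 j)%:C%C :> R[i] by ring.
      by rewrite sqr_i opprK mul1r.
    by rewrite mcount1_inj eq_sym ij mulr0.
  - rewrite big1 ?mulr0 ?mul0r ?oppr0// => i _.
    rewrite [_ == _](_ : _ = false) ?mulr0//; apply/eqP => /(congr1 (@mdeg d)).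
    by rewrite !mdeg_mcount.
have [C1 C10 hC1] := @theta_taylor R d n kap e hk.
pose S : R := \sum_g cabs (kap g).
have S0 : 0 <= S by apply: sumr_ge0 => g _; exact: cabs_ge0.
pose A : R := t * (B / rho) + \sum_j `|phi 0 j|.
have A0 : 0 <= A by rewrite addr_ge0 ?sumr_ge0// mulr_ge0// divr_ge0// ltW.
pose D : R := t * (B / rho ^+ n) + C1.
have D0 : 0 <= D by rewrite addr_ge0// mulr_ge0// divr_ge0// exprn_ge0// ltW.
pose M : R := 1 + A + S.
have M1 : 1 <= M by rewrite /M -addrA lerDl addr_ge0.
have c00 : c mono0 = 0.
  have := pseries_at0 r0 ps1; rewrite /mfact big1 ?mulr1 => [<-|j _]; last by rewrite ffunE.
  rewrite /symbol -[RHS](symbol_0 hPsi); congr Psi.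
  by apply/rowP => j; rewrite !mxE rmorph0 mulr0.
have zA x : `|x| < rho -> cabs (tilted_symbol x) <= A * `|x|.
  move=> xr; rewrite /tilted_symbol (le_trans (cabsB _ _))// !cabsM cabs_i mul1r !cabs_real.
  rewrite (ger0_norm t0) /A mulrDl lerD// ?cabs_dotp_le// -mulrA ler_wpM2l//.
  have := pseries_taylor r0 cB ps1 (ltn0Sn 0) xr; rewrite !expr1.
  rewrite [box_sum _ _]big1 ?subr0// => b _.
  rewrite (_ : box_index b = mono0) ?c00 ?mul0r//.
  by apply/ffunP => j; rewrite !ffunE ord1.
have zD x : `|x| < rho -> `|x| <= 1 -> cabs (tilted_symbol x - theta kap x) <= D * `|x| ^+ n.
  move=> xr x1.
  have -> : tilted_symbol x - theta kap x =
      t%:C%C * (symbol Psi x - box_sum n (fun a => c a * (dmono mono0 a x)%:C%C)) -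
      (theta kap x - box_sum n (fun a => e a * (dmono mono0 a x)%:C%C)).
    have -> : box_sum n (fun a => e a * (dmono mono0 a x)%:C%C) =
      t%:C%C * box_sum n (fun a => c a * (dmono mono0 a x)%:C%C) - 'i%C * (dotp x phi)%:C%C.
      rewrite /box_sum mulr_sumr /dotp rmorph_sum mulr_sumr /=.
      transitivity (\sum_(b : grid n) t%:C%C * (c (box_index b) * (dmono mono0 (box_index b) x)%:C%C) -
         \sum_j 'i%C * (phi 0 j)%:C%C * box_sum n (fun a => (a == mcount [:: j])%:R * (dmono mono0 a x)%:C%C)).
        rewrite /box_sum; under [X in _ = _ - X]eq_bigr do rewrite mulr_sumr.
        rewrite exchange_big /= -sumrB; apply: eq_bigr => b _.
        rewrite /e mulrBl mulr_sumr mulr_suml mulrA; congr (_ - _); apply: eq_bigr => j _; ring.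
      congr (_ - _); apply: eq_bigr => j _.
      have [b bE] := @mcount_box n [:: j] n1.
      rewrite -bE box_sum_delta bE dmono_mcount1 -mulrA; congr (_ * _).
      by rewrite -real_complexM mulrC.
    by rewrite /tilted_symbol; ring.
  rewrite (le_trans (cabsB _ _))// /D mulrDl lerD ?hC1//.
  by rewrite cabsM cabs_real ger0_norm// -mulrA ler_wpM2l// pseries_taylor.
have [L hL] := propagator_bound.
pose r1 : R := Num.min 1 rho.
have r10 : 0 < r1 by rewrite lt_min ltr01.
pose Q : R := \sum_(l < n) M ^+ l.
have Q0 : 0 <= Q by apply: sumr_ge0 => l _; rewrite exprn_ge0// (le_trans ler01).
pose C2 : R := (2 * A) ^+ n * expR A + \sum_(l < n) (l%:R * M ^+ l) * D.
have C20 : 0 <= C2.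
  rewrite addr_ge0 ?mulr_ge0 ?expR_ge0 ?exprn_ge0 ?mulr_ge0// sumr_ge0// => l _.
  by rewrite !mulr_ge0// exprn_ge0// (le_trans ler01).
exists (C2 + (1 + Q) / r1 ^+ n), L; split.
  by rewrite addr_ge0// divr_ge0 ?addr_ge0// exprn_ge0// ltW.
move=> x; have E1 : 1 <= 1 + d.+1%:R * `|x| by rewrite lerDl mulr_ge0.
have E2 : 1 <= (1 + d.+1%:R * `|x|) ^+ L by rewrite exprn_ege1.
have [xr1|xr1] := ltP `|x| r1.
  have x1 : `|x| <= 1 by rewrite ltW// (lt_le_trans xr1)// ge_min lexx.
  have xr : `|x| < rho by rewrite (lt_le_trans xr1)// ge_min lexx orbT.
  apply: (@le_trans _ _ (C2 * `|x| ^+ n)); last first.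
    apply: ler_pM; rewrite ?exprn_ge0//.
      by rewrite lerDl divr_ge0 ?addr_ge0// exprn_ge0// ltW.
    by rewrite ler_peMr// exprn_ge0.
  rewrite propagatorE -mulrBr cabsM cabs_cis mul1r.
  have hz := zA x xr; have hz1 : cabs (tilted_symbol x) <= A by rewrite (le_trans hz)// ler_piMr.
  rewrite -(subrK (exp_poly n (tilted_symbol x)) (cexp _)) -addrA (le_trans (cabsD _ _))//.
  rewrite mulrDl lerD//.
    rewrite (le_trans (cexp_taylor _ _))// mulrAC; apply: ler_pM;
      rewrite ?expR_ge0 ?exprn_ge0 ?mulr_ge0 ?cabs_ge0 ?ler_expR//.
    by rewrite -exprMn lerXn2r ?nnegrE ?mulr_ge0 ?cabs_ge0// -mulrA ler_pM2l.
  rewrite mulr_suml; under [leRHS]eq_bigr do rewrite -mulrA.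
  apply: exp_poly_lipschitz => //.
  - by rewrite mulr_ge0// exprn_ge0.
  - by rewrite (le_trans hz1)// /M addrAC lerDr addr_ge0.
  - by rewrite (le_trans (cabs_theta _ _))// /M lerDr addr_ge0.
  - exact: zD.
have xn : 1 <= `|x| ^+ n / r1 ^+ n.
  by rewrite ler_pdivlMr ?exprn_gt0// mul1r lerXn2r ?nnegrE// ltW.
apply: (@le_trans _ _ ((1 + Q) * (1 + d.+1%:R * `|x|) ^+ L)).
  rewrite mulrDl mul1r (le_trans (cabsB _ _))// lerD// cabsM cabs_cis mul1r.
  apply: (@le_trans _ _ Q); last by rewrite ler_peMr.
  apply: cabs_exp_poly; rewrite (le_trans (cabs_theta _ _))// /M lerDr addr_ge0//.
rewrite [leRHS]mulrDl; apply: (@le_trans _ _ ((1 + Q) / r1 ^+ n * (`|x| ^+ n * (1 + d.+1%:R * `|x|) ^+ L))).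
  rewrite [leRHS](_ : _ = (`|x| ^+ n / r1 ^+ n) * ((1 + Q) * (1 + d.+1%:R * `|x|) ^+ L)); last by ring.
  by rewrite ler_peMl// mulr_ge0 ?addr_ge0// (le_trans ler01).
by rewrite lerDr !mulr_ge0// ?exprn_ge0// (le_trans ler01).
Qed.

End SymbolApproximation.

(** * The solution at small coupling *)
Section SmallCoupling.
Context {R : realType} (d' : nat).
Local Notation d := d'.+1.
Variables (w : @pexp R d) (Cw : R).
Hypothesis coercive : forall (eps : R) (u : 'rV[R]_d), 0 < eps <= 1 ->
  `|u| - Cw <= peval w eps u.

(** The factor (1 + k |xi|)^L and the weight lorentz are paid for by further
    powers of |xi|, which come with further powers of eps <= 1. *)
Lemma fhat_boltz_weighted (n L : nat) (k : R) : 0 <= k ->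
  exists C : R, 0 <= C /\ forall eps, 0 < eps <= 1 -> forall xi : 'rV[R]_d,
  `|xi| ^+ n * (1 + k * `|xi|) ^+ L * cabs (fhat (boltz w eps) xi) <=
  C * (eps ^+ n / eps ^+ (2 * d)) * lorentz xi.
Proof.
move=> k0; pose q := (L + 2 * d)%N; pose K := Num.max 1 k.
have K1 : 1 <= K by rewrite le_max lexx.
have K0 : 0 <= K by exact: le_trans K1.
have [C1 [C10 h1]] := fhat_boltz_decay coercive n.
have [C2 [C20 h2]] := fhat_boltz_decay coercive (n + q).
exists ((2 * K) ^+ q * (C1 + C2)); split.
  by rewrite mulr_ge0 ?addr_ge0// exprn_ge0// mulr_ge0.
move=> eps e01 xi; have /andP[e0 e1] := e01.
set f := cabs _; have f0 : 0 <= f by exact: cabs_ge0.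
set x := `|xi|; have x0 : 0 <= x by exact: normr_ge0.
set E := eps ^+ n / eps ^+ (2 * d).
have E0 : 0 <= E by rewrite divr_ge0// exprn_ge0// ltW.
have b1 : x ^+ n * f <= C1 * E by exact: h1.
have b2 : x ^+ (n + q) * f <= C2 * E.
  apply: le_trans (h2 _ e01 xi) _; rewrite ler_wpM2l// /E ler_wpM2r ?invr_ge0 ?exprn_ge0 ?(ltW e0)//.
  by rewrite exprD ler_piMr ?exprn_ge0 ?(ltW e0)// exprn_ile1// ltW.
have b3 : (1 + K * x) ^+ q <= (2 * K) ^+ q * (1 + x ^+ q).
  have [x1|x1] := leP x 1.
    apply: (@le_trans _ _ ((2 * K) ^+ q)).
      rewrite lerXn2r ?nnegrE ?addr_ge0 ?mulr_ge0// mulr_natl mulr2n lerD//.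
      by rewrite ler_piMr.
    by rewrite ler_peMr ?lerDl ?exprn_ge0// mulr_ge0.
  apply: (@le_trans _ _ ((2 * K * x) ^+ q)).
    rewrite lerXn2r ?nnegrE ?addr_ge0 ?mulr_ge0// -mulrA mulr_natl mulr2n lerD2r.
    by rewrite mulr_ege1// ltW.
  by rewrite exprMn ler_wpM2l ?lerDr// exprn_ge0// mulr_ge0.
have b4 : (1 + k * x) ^+ L * (1 + x) ^+ (2 * d) <= (1 + K * x) ^+ q.
  rewrite /q exprD; apply: ler_pM; rewrite ?exprn_ge0 ?addr_ge0 ?mulr_ge0//.
    by rewrite lerXn2r ?nnegrE ?addr_ge0 ?mulr_ge0// lerD2l ler_wpM2r// le_max lexx orbT.
  by rewrite lerXn2r ?nnegrE ?addr_ge0 ?mulr_ge0// lerD2l ler_peMl.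
have X0 : 0 < (1 + x) ^+ (2 * d) by rewrite exprn_gt0// ltr_pwDl.
apply: (@le_trans _ _ ((2 * K) ^+ q * (C1 + C2) * E * ((1 + x) ^+ (2 * d))^-1)); last first.
  by apply: ler_wpM2l; [apply: mulr_ge0 => //; apply: mulr_ge0; [apply: exprn_ge0; exact: mulr_ge0|exact: addr_ge0]|exact: lorentz_lower].
rewrite ler_pdivlMr//.
apply: (@le_trans _ _ (x ^+ n * f * ((2 * K) ^+ q * (1 + x ^+ q)))).
  rewrite [leLHS](_ : _ = x ^+ n * f * ((1 + k * x) ^+ L * (1 + x) ^+ (2 * d))); last by ring.
  by rewrite ler_wpM2l ?mulr_ge0 ?exprn_ge0// (le_trans b4).
rewrite [leLHS](_ : _ = (2 * K) ^+ q * (x ^+ n * f + x ^+ (n + q) * f)); last by rewrite exprD; ring.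
rewrite -!mulrA ler_wpM2l ?exprn_ge0 ?mulr_ge0// mulrDl lerD//.
Qed.

Lemma fhat_boltz_lorentz eps : 0 < eps <= 1 -> exists C : R, forall xi : 'rV[R]_d,
  cabs (fhat (boltz w eps) xi) <= C * lorentz xi.
Proof.
have [C [_ h]] := fhat_boltz_weighted 0 0 ler01.
move=> e01; exists (C * (eps ^+ 0 / eps ^+ (2 * d))) => xi.
by apply: le_trans (h _ e01 xi); rewrite !expr0 !mul1r.
Qed.

Lemma boltz_lorentz eps : 0 < eps <= 1 -> exists C : R, forall y : 'rV[R]_d,
  boltz w eps y <= C * lorentz y.
Proof.
have [C [_ h]] := boltz_bound coercive.
by move=> e01; exists (C / eps ^+ (2 * d)) => y; exact: h.
Qed.

Lemma cmeasurable_fhat_boltz eps : 0 < eps <= 1 ->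
  cmeasurable (fun x : d.-tuple (measurableTypeR R) => fhat (boltz w eps) (rowt x)).
Proof.
move=> e01; have [C hC] := boltz_lorentz e01.
exact: (cmeasurable_fhat (@continuous_boltz _ _ _ _) (fun y => expR_ge0 _) hC 0 ltr01).
Qed.

(** The powers of theta are finite sums of characters, to each of which the
    inversion formula applies. *)
Lemma cint_grid_boltz eps n (kap : {ffun 'I_d -> 'I_n} -> R[i]) (phi : 'rV[R]_d) : 0 < eps <= 1 ->
  cintegrable (tleb d) (fun x => cis (dotp (rowt x) phi) * exp_poly n (theta kap (rowt x)) *
     fhat (boltz w eps) (rowt x)) /\
  cint (tleb d) (fun x => cis (dotp (rowt x) phi) * exp_poly n (theta kap (rowt x)) *
     fhat (boltz w eps) (rowt x)) =
  ((2 * pi) ^+ d)%:C%C * \sum_(k < n) (k`!)%:R^-1 *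
    \sum_(g : {ffun 'I_k -> {ffun 'I_d -> 'I_n}}) (\prod_i kap (g i)) *
      (boltz w eps (phi - \sum_i gridpt (g i)))%:C%C.
Proof.
move=> e01; have [C hC] := boltz_lorentz e01.
have [C' hC'] := fhat_boltz_lorentz e01.
have g0 (y : 'rV[R]_d) : 0 <= boltz w eps y by exact: expR_ge0.
have inv a : cintegrable (tleb d) (fun x => cis (dotp (rowt x) a) * fhat (boltz w eps) (rowt x)) /\
   cint (tleb d) (fun x => cis (dotp (rowt x) a) * fhat (boltz w eps) (rowt x)) =
   ((2 * pi) ^+ d * boltz w eps a)%:C%C.
  split; last exact: (fourier_inversion (@continuous_boltz _ _ _ _) g0 hC a hC').
  apply: (cintegrable_bound (integrable_lorentzZ d C')).
    apply: cmeasurableM; last exact: cmeasurable_fhat_boltz.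
    by apply: cmeasurable_cis; apply: measurable_dotp => j; [exact: measurable_coord|exact: measurable_cst].
  by move=> x; rewrite cabsM cabs_cis mul1r.
pose J : Type := {k : 'I_n & {ffun 'I_k -> {ffun 'I_d -> 'I_n}}}.
pose T k (g : {ffun 'I_k -> {ffun 'I_d -> 'I_n}}) : R[i] := (k`!)%:R^-1 * \prod_i kap (g i).
have expand x : cis (dotp x phi) * exp_poly n (theta kap x) * fhat (boltz w eps) x =
  \sum_(k < n) \sum_(g : {ffun 'I_k -> {ffun 'I_d -> 'I_n}}) T k g *
    (cis (dotp x (phi - \sum_i gridpt (g i))) * fhat (boltz w eps) x).
  rewrite /exp_poly mulr_sumr mulr_suml; apply: eq_bigr => k _.
  have -> : theta kap x ^+ k = \sum_(g : {ffun 'I_k -> {ffun 'I_d -> 'I_n}}) (\prod_i kap (g i)) *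
     cis (- dotp x (\sum_i gridpt (g i))).
    transitivity (\prod_(i < k) theta kap x); first by rewrite prodr_const card_ord.
    rewrite /theta bigA_distr_bigA; apply: eq_bigr => g _.
    rewrite big_split; congr (_ * _) => /=; rewrite -cis_sum; congr cis.
    rewrite sumrN; congr (- _); rewrite /dotp exchange_big; apply: eq_bigr => j _ /=.
    by rewrite summxE mulr_sumr.
  rewrite mulr_suml mulr_sumr mulr_suml; apply: eq_bigr => g _.
  by rewrite dotpBr cisD /T; ring.
have fe : (fun x => cis (dotp (rowt x) phi) * exp_poly n (theta kap (rowt x)) *
     fhat (boltz w eps) (rowt x)) = fun x : d.-tuple (measurableTypeR R) =>
  \sum_(k < n) \sum_(g : {ffun 'I_k -> {ffun 'I_d -> 'I_n}}) T k g *
    (cis (dotp (rowt x) (phi - \sum_i gridpt (g i))) * fhat (boltz w eps) (rowt x)).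
  by apply/funext => x; exact: expand.
rewrite fe; split.
  apply: cintegrable_sum => k; apply: cintegrable_sum => g; apply: cintegrableZ.
  exact: (inv _).1.
rewrite cint_sum; last first.
  by move=> k; apply: cintegrable_sum => g; apply: cintegrableZ; exact: (inv _).1.
rewrite mulr_sumr; apply: eq_bigr => k _.
rewrite cint_sum; last by move=> g; apply: cintegrableZ; exact: (inv _).1.
rewrite !mulr_sumr; apply: eq_bigr => g _.
rewrite cintZ; last exact: (inv _).1.
by rewrite (inv _).2 real_complexM /T; ring.
Qed.

End SmallCoupling.

Section Solution.
Context {R : realType} (d' : nat).
Local Notation d := d'.+1.
Local Notation grid n := {ffun 'I_d -> 'I_n}.
Variables (Psi : 'rV[R[i]]_d -> R[i]) (pbar : nat) (lam : forall p, tensor R d p).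
Hypothesis hPsi : is_symbol Psi.
Hypothesis hlam : is_interaction pbar lam.
Variables (t : R) (phi : 'rV[R]_d).
Hypothesis t0 : 0 <= t.

Let w := scaled_potential pbar lam phi.
Let K x : R[i] := cexp (t%:C%C * symbol Psi x).

Lemma cmeasurable_propagator :
  cmeasurable (fun x : d.-tuple (measurableTypeR R) => K (rowt x)).
Proof.
have [cre cim _] := symbol_smooth hPsi [::].
apply: cmeasurable_cexp; apply: cmeasurableM; first exact: cmeasurable_cst.
by split; [exact: (@continuous_measurable_rowt _ _ _ cre)|exact: (@continuous_measurable_rowt _ _ _ cim)].
Qed.

Lemma cintegrable_propagator_boltz eps : 0 < eps <= 1 -> cintegrable (tleb d)
  (fun x => K (rowt x) * fhat (boltz w eps) (rowt x)).
Proof.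
move=> e01; have [Cw coer] := coercive_scaled_potential phi hlam.
have [L hL] := propagator_bound hPsi t0.
have k0 : 0 <= d.+1%:R :> R by [].
have [C [_ hC]] := fhat_boltz_weighted coer 0 L k0.
apply: (cintegrable_bound (integrable_lorentzZ d (C * (eps ^+ 0 / eps ^+ (2 * d))))).
  by apply: cmeasurableM; [exact: cmeasurable_propagator|exact: (cmeasurable_fhat_boltz coer e01)].
move=> x; rewrite cabsM (le_trans _ (hC _ e01 _))// expr0 mul1r.
by rewrite ler_wpM2r ?cabs_ge0// hL.
Qed.

Lemma solutionE eps : 0 < eps <= 1 ->
  solution Psi pbar lam (eps ^+ pbar) t phi = (((2 * pi) ^+ d)^-1)%:C%C *
    cint (tleb d) (fun x => K (rowt x) * fhat (boltz w eps) (rowt x)).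
Proof.
move=> e01; rewrite -cintZ; last exact: cintegrable_propagator_boltz.
have bE : (fun y : 'rV[R]_d => initial pbar lam (eps ^+ pbar) (phi - y)) =
    fun y => (boltz w eps y)%:C%C.
  by apply/funext => y; rewrite /initial boltz_scaled_potential.
rewrite /solution /convolution /nu /inv_fourier_distribution /regular_distribution.
rewrite cintegralE bE; apply: eq_cint => x.
by rewrite -/(K _) [RHS]mulrCA -inv_fourierE.
Qed.

(** The integral of F against the truncated exponential series of kap for
    convolution. *)
Definition grid_sum n (kap : grid n -> R[i]) (F : 'rV[R]_d -> R) : R[i] :=
  \sum_(k < n) (k`!)%:R^-1 * \sum_(g : {ffun 'I_k -> grid n}) (\prod_i kap (g i)) *
    (F (\sum_i gridpt (g i)))%:C%C.

(** The propagator is replaced by its approximation of order n, at the cost of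
    |x|^n times a polynomial, which the decay of the transform turns into
    eps^(n - 2 d). *)
Lemma solution_near_grid N : exists n (kap : grid n -> R[i]), [/\ (N * pbar < n)%N,
  forall s : seq 'I_d, (size s < n)%N ->
     \sum_g kap g * \prod_(j <- s) (gridpt g 0 j)%:C%C =
     t%:C%C * Ccoef Psi s + (if s is [:: j] then (phi 0 j)%:C%C else 0) &
  exists C : R, forall eps, 0 < eps <= 1 ->
    cabs (solution Psi pbar lam (eps ^+ pbar) t phi -
      grid_sum kap (fun v => expR (- (eps ^+ pbar * potential pbar lam v)))) <=
    C * (eps ^+ pbar) ^+ N.+1].
Proof.
have [Cw coer] := coercive_scaled_potential phi hlam.
(* This makes eps^(n - 2 d) at most (eps^pbar)^(N + 1). *)
pose n := (pbar * N.+1 + 2 + 2 * d)%N.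
have n1 : (1 < n)%N by rewrite /n; lia.
have [kap [mom [C [L [C0 hC]]]]] := grid_approximation hPsi phi t0 n1.
exists n, kap; split => //; first by rewrite /n mulnS mulnC; lia.
have k0 : 0 <= d.+1%:R :> R by [].
have [C1 [C10 h1]] := fhat_boltz_weighted coer n L k0.
pose D := ((2 * pi) ^+ d)^-1 * (2 * (C * C1 * pi ^+ d)).
have pi0 : 0 < (2 * pi : R) ^+ d by rewrite exprn_gt0// mulr_gt0// pi_gt0.
exists D => eps e01; have /andP[e0 e1] := e01.
set E := eps ^+ n / eps ^+ (2 * d).
have EE : E <= (eps ^+ pbar) ^+ N.+1.
  rewrite /E /n exprD mulfK ?expf_neq0 ?gt_eqF// exprD -exprM ler_piMr//.
    by rewrite exprn_ge0// ltW.
  by rewrite exprn_ile1// ltW.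
have [ig Eg] := cint_grid_boltz coer kap phi e01.
have -> : grid_sum kap (fun v => expR (- (eps ^+ pbar * potential pbar lam v))) =
    (((2 * pi) ^+ d)^-1)%:C%C * cint (tleb d) (fun x => cis (dotp (rowt x) phi) *
       exp_poly n (theta kap (rowt x)) * fhat (boltz w eps) (rowt x)).
  rewrite Eg mulrA -real_complexM mulVf ?gt_eqF// rmorph1 mul1r.
  apply: eq_bigr => k _; congr (_ * _); apply: eq_bigr => g _; congr (_ * _).
  by rewrite boltz_scaled_potential opprB addrC subrK.
rewrite solutionE// -mulrBr.
have iK := cintegrable_propagator_boltz e01.
set f1 := (fun x => K _ * _) in iK *; set f2 := (fun x => _ * _) in ig Eg *.
have -> : cint (tleb d) f1 - cint (tleb d) f2 = cint (tleb d) (fun x => f1 x + (-1) * f2 x).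
  rewrite cintD//; last exact: cintegrableZ.
  by rewrite cintZ// mulN1r.
rewrite cabsM cabs_real ger0_norm ?invr_ge0 ?(ltW pi0)//.
apply: (@le_trans _ _ (((2 * pi) ^+ d)^-1 * (2 * (C * (C1 * E) * pi ^+ d)))); last first.
  rewrite /D [leLHS](_ : _ = ((2 * pi) ^+ d)^-1 * (2 * (C * C1 * pi ^+ d)) * E); last by ring.
  apply: ler_wpM2l EE; rewrite mulr_ge0 ?invr_ge0 ?(ltW pi0)// mulr_ge0// mulr_ge0 ?exprn_ge0 ?pi_ge0//.
  exact: mulr_ge0.
rewrite ler_wpM2l ?invr_ge0 ?(ltW pi0)// -integral_lorentz -RintegralZl//; last exact: integrable_lorentz.
apply: cabs_cint; first exact: integrable_lorentzZ.
  apply: cmeasurableD; first exact: (cintegrable_measurable iK).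
  by apply: cmeasurableM; [exact: cmeasurable_cst|exact: (cintegrable_measurable ig)].
move=> x; rewrite /f1 /f2 mulN1r -mulrBl cabsM -mulrA.
apply: (@le_trans _ _ (C * (`|rowt x| ^+ n * (1 + d.+1%:R * `|rowt x|) ^+ L) *
   cabs (fhat (boltz w eps) (rowt x)))).
  by rewrite ler_wpM2r ?cabs_ge0// hC.
by rewrite -mulrA ler_wpM2l// h1.
Qed.

Lemma exp_taylor_real N (v : R) : exists C : R, forall beta, 0 <= beta <= 1 ->
  cabs ((expR (- (beta * v)))%:C%C - \sum_(m < N.+1) ((- beta) ^+ m / (m`!)%:R)%:C%C * (v ^+ m)%:C%C)
    <= C * beta ^+ N.+1.
Proof.
exists ((2 * `|v|) ^+ N.+1 * expR `|v|) => beta /andP[b0 b1].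
have := cexp_taylor N.+1 (- (beta * v))%:C%C.
have -> : cexp (- (beta * v))%:C%C = (expR (- (beta * v)))%:C%C :> R[i].
  by rewrite /cexp /= cos0 sin0; apply: complex_eq; rewrite ?ReZ ?ImZ /= ?mulr1 ?mulr0.
have -> : exp_poly N.+1 (- (beta * v))%:C%C =
    \sum_(m < N.+1) ((- beta) ^+ m / (m`!)%:R)%:C%C * (v ^+ m)%:C%C.
  apply: eq_bigr => m _; rewrite -real_complexM -rmorphXn -(rmorph_nat (real_complex R)).
  rewrite -fmorphV -real_complexM; congr (_%:C%C); rewrite -mulNr exprMn; ring.
move=> /le_trans; apply; rewrite cabs_real normrN normrM (ger0_norm b0) mulrCA exprMn.
rewrite [leLHS](_ : _ = (2 * `|v|) ^+ N.+1 * expR (beta * `|v|) * beta ^+ N.+1); last by ring.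
rewrite ler_wpM2r ?exprn_ge0// ler_wpM2l ?exprn_ge0 ?mulr_ge0// ler_expR.
by rewrite ler_piMl.
Qed.

(** The exponentials in the finite sum are expanded in beta at finitely many
    points; the coefficients are the sums over graphs. *)
Lemma solution_expansion N : exists C : R, forall beta, 0 < beta <= 1 ->
  cabs (solution Psi pbar lam beta t phi - \sum_(m < N.+1) ((- beta) ^+ m / (m`!)%:R)%:C%C *
     \sum_(G in Fbar pbar lam m) graph_value Psi lam G t phi) <= C * beta ^+ N.+1.
Proof.
have p0 := interaction_pos hlam.
have [n [kap [Nn mom [C1 h1]]]] := solution_near_grid N.
have /choice[C2 h2] := exp_taylor_real N.
pose C3 : R := \sum_(k < n) \sum_(g : {ffun 'I_k -> grid n})
   cabs ((k`!)%:R^-1 * \prod_i kap (g i)) * C2 (potential pbar lam (\sum_i gridpt (g i))).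
exists (C1 + C3) => beta /andP[b0 b1].
have [eps [e01 eE]] : exists eps : R, 0 < eps <= 1 /\ eps ^+ pbar = beta.
  exists (beta `^ (pbar%:R^-1)); split.
    have r0 : 0 <= pbar%:R^-1 :> R by rewrite invr_ge0.
    have /= := ge0_ler_powR r0 (x := beta) (y := 1); rewrite powR1 powR_gt0//=.
    by apply; rewrite ?nnegrE// ltW.
  by rewrite -powR_mulrn ?powR_ge0// -powRrM mulVf ?powRr1 ?pnatr_eq0 -?lt0n// ltW.
have GE (m : 'I_N.+1) : \sum_(G in Fbar pbar lam m) graph_value Psi lam G t phi =
   grid_sum kap (fun v => potential pbar lam v ^+ m).
  rewrite -(graph_expansion lam mom)//; first exact: Ccoef_nil.
  by rewrite (leq_ltn_trans _ Nn)// leq_mul2r -ltnS ltn_ord orbT.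
set T := \sum_(m < N.+1) _.
have -> : solution Psi pbar lam beta t phi - T =
  (solution Psi pbar lam beta t phi -
     grid_sum kap (fun v => expR (- (beta * potential pbar lam v)))) +
  (grid_sum kap (fun v => expR (- (beta * potential pbar lam v))) - T) by ring.
rewrite (le_trans (cabsD _ _))// mulrDl lerD//.
  by have := h1 _ e01; rewrite eE.
have -> : grid_sum kap (fun v => expR (- (beta * potential pbar lam v))) - T =
  \sum_(k < n) \sum_(g : {ffun 'I_k -> grid n}) ((k`!)%:R^-1 * \prod_i kap (g i)) *
    ((expR (- (beta * potential pbar lam (\sum_i gridpt (g i)))))%:C%C -
     \sum_(m < N.+1) ((- beta) ^+ m / (m`!)%:R)%:C%C *
        (potential pbar lam (\sum_i gridpt (g i)) ^+ m)%:C%C).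
  have -> : T = \sum_(k < n) \sum_(g : {ffun 'I_k -> grid n}) ((k`!)%:R^-1 * \prod_i kap (g i)) *
     \sum_(m < N.+1) ((- beta) ^+ m / (m`!)%:R)%:C%C *
        (potential pbar lam (\sum_i gridpt (g i)) ^+ m)%:C%C.
    rewrite /T; under eq_bigr do rewrite GE /grid_sum mulr_sumr.
    rewrite exchange_big /=; apply: eq_bigr => k _.
    under [RHS]eq_bigr do rewrite mulr_sumr.
    rewrite exchange_big /=; apply: eq_bigr => m _.
    by rewrite !mulr_sumr; apply: eq_bigr => g _; ring.
  rewrite /grid_sum -sumrB; apply: eq_bigr => k _; rewrite mulr_sumr -sumrB.
  by apply: eq_bigr => g _; rewrite mulrA mulrBr.
rewrite (le_trans (cabs_sum _ _ _))// /C3 mulr_suml; apply: ler_sum => k _.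
rewrite (le_trans (cabs_sum _ _ _))// mulr_suml; apply: ler_sum => g _.
rewrite cabsM -mulrA ler_wpM2l ?cabs_ge0//; apply: h2.
by rewrite (ltW b0) b1.
Qed.

End Solution.

Theorem theorem2p11 (R : realType) (d : nat) (hd : (0 < d)%N)
    (Psi : 'rV[R[i]]_d -> R[i]) (hPsi : is_symbol Psi)
    (pbar : nat) (lam : forall p, tensor R d p)
    (hlam : is_interaction pbar lam)
    (t : R) (ht : 0 <= t) (phi : 'rV[R]_d) (N : nat) :
  (fun beta : R => beta ^- N *
     cabs (solution Psi pbar lam beta t phi -
       \sum_(m < N.+1) ((- beta) ^+ m / (m`!)%:R)%:C%C *
         \sum_(G in Fbar pbar lam m) graph_value Psi lam G t phi))
    @ (0 : R)^'+ --> (0 : R).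
Proof.
case: d hd Psi hPsi lam hlam phi => // d _ Psi hPsi lam hlam phi.
have [C hC] := solution_expansion hPsi hlam phi ht N.
apply: (@squeeze_cvgr _ _ _ _ (fun=> 0) (fun beta => C * beta)).
- near=> beta.
  have b0 : 0 < beta by near: beta; exact: nbhs_right_gt.
  have b1 : beta <= 1 by near: beta; exact: nbhs_right_le.
  rewrite mulr_ge0 ?invr_ge0 ?exprn_ge0 ?(ltW b0) ?cabs_ge0//=.
  by rewrite mulrC ler_pdivrMr ?exprn_gt0// -mulrA -exprS hC// b0.
- exact: cvg_cst.
- rewrite -[X in _ --> X](mulr0 C); apply: cvgMl_tmp.
  by apply: cvg_at_right_filter; exact: cvg_id.
Unshelve. all: by end_near.
Qed.
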